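(* Let $\mathfrak X\subset\mathbb R^n$ be an open region, and let $A=\sum_{|\alpha|>0}\mathfrak a_\alpha(x)\partial_{x^\alpha}$ be an affine generator, $\mathfrak a_\alpha(x)=c_\alpha+x^\top d_\alpha$, such that $\sum_{|\alpha|>0}\mathfrak a_\alpha(x)(\mathfrak iu)^\alpha$ converges absolutely for all $u\in\mathbb R^n$. Let $f_u(x)=e^{\mathfrak iu^\top x}$, suppose that $\{f_u,\ u\in\mathbb R^n\}$ is a set of analytic vectors for $A$ in $\mathfrak X$, and let $\widehat p(s,x,u)$ be the solution of $\partial_s\widehat p=A\widehat p$, $\widehat p(0,x,u)=f_u(x)$. Suppose that for a fixed $u\in\mathbb R^n$ there is a constant $R_u>0$ such that for each $x\in\mathfrak X$ the map $s\mapsto\widehat p(s,x,u)$ has a holomorphic extension to $$G_{R_u}:=\{z\in\mathbb C:|z|<R_u\}\cup\{z\in\mathbb C:\operatorname{Re}z>0,\ |\operatorname{Im}z|<R_u\},$$ and that, in addition, $\widehat p(s,x,u)\ne0$ for all $s\in G_{R_u}$ and $x\in\mathfrak X$. Then there exists $\eta_u>0$ such that the functions $\rho_k^{(\eta_u)}$ defined by $$\rho_0^{(\eta_u)}(x,u)=\mathfrak iu^\top x,\qquad \rho_k^{(\eta_u)}(x,u)=\frac1{f_u(x)}\Big[q_k^{(\eta_u)}(x,u)-\frac1k\sum_{j=1}^{k-1}j\,\rho_j^{(\eta_u)}(x,u)\,q_{k-j}^{(\eta_u)}(x,u)\Big],\quad k\ge1,$$ are affine in $x$, $\rho_k^{(\eta_u)}(x,u)=:\rho_k^{(\eta_u,0)}(u)+x^\top\rho_k^{(\eta_u,1)}(u)$,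 and for $x\in\mathfrak X$ $$\widehat p(s,x,u)=\exp\Big[\sum_{k=0}^\infty\big(\rho_k^{(\eta_u,0)}(u)+x^\top\rho_k^{(\eta_u,1)}(u)\big)(1-e^{-\eta_us})^k\Big],\qquad 0\le s<\infty.$$
   Context: Multi-index notation: $\alpha\in\mathbb N_0^n$, $\partial_{x^\alpha}$, $u^\alpha$ as usual; $c_\alpha$ is a scalar, $d_\alpha\in\mathbb R^n$; $\mathfrak i$ is the imaginary unit. $A$ acts by $Af(x)=\sum_{|\alpha|>0}\mathfrak a_\alpha(x)\partial_{x^\alpha}f(x)$; this is the (formal) Taylor-expanded form of an integro-differential generator $\frac12\sum a_{ij}\partial_{ij}f+\sum b_i\partial_if+\int[f(x+z)-f(x)-\frac{\partial f}{\partial x}\cdot z]v(x,dz)$, regarded as a closed operator on $C(\mathfrak X)$ (continuous functions $\mathfrak X\to\mathbb C$ with uniform convergence on compacta). Standing assumption: the Cauchy problem $\partial_s\widehat p=A\widehat p$, $\widehat p(0,\cdot,u)=f_u$ on $\mathfrak X$ has a unique solution (on $[0,\infty)$, and uniqueness holds on each interval $[0,T)$). Analytic vectors: $\{f_u\}$ is a set of analytic vectors for $A$ in $\mathfrak X$ if $A^kf_u$ exists for all $u$ and $k\in\mathbb N$, and for every $u$ there is a radius $R>0$ such that for all $x\in\mathfrak X$, $\sum_{k\ge0}\frac{s^k}{k!}|A^kf_u(x)|<\infty$ for $0\le s<R$, with convergence uniform in $x$ over compact subsets of $\mathfrak X$. For $\eta>0$, $q_k^{(\eta)}(x,u):=\frac1{k!}\prod_{r=0}^{k-1}(\eta^{-1}A+rI)f_u(x)$,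 $k\ge0$, with $I$ the identity operator (so $q_0^{(\eta)}=f_u$). *)

(* Defs.v *)
From mathcomp Require Import all_boot all_order all_algebra.
From mathcomp Require Import complex.
From mathcomp Require Import all_classical all_reals all_analysis.

Set Implicit Arguments.
Unset Strict Implicit.
Unset Printing Implicit Defensive.

Import Order.TTheory GRing.Theory Num.Theory.
Import numFieldNormedType.Exports.

Local Open Scope classical_set_scope.
Local Open Scope ring_scope.
Local Open Scope complex_scope.

(* The library puts the norm topology of a field F on F^o; [cplx R] is
   therefore the type at which limits and derivatives of complex-valued
   functions are taken.  It is convertible to R[i]. *)
Notation cplx R := (R[i]^o).

Section Complex.
Variable R : realType.

Definition cmod (z : R[i]) : R := complex.Re `|z|.

Definition cexp (z : R[i]) : R[i] :=
  (expR (complex.Re z))%:C * (cos (complex.Im z) +i* sin (complex.Im z)).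

Definition holomorphic_on (G : set R[i]) (f : R[i] -> R[i]) :=
  forall z, G z -> derivable (f : cplx R -> cplx R) z 1.

Definition disc_strip (r : R) : set R[i] :=
  [set z | cmod z < r] `|`
  [set z | 0 < complex.Re z /\ `|complex.Im z| < r].

End Complex.

Section MultiIndex.
Variables (R : realType) (n : nat).

Definition multi_index := {ffun 'I_n -> nat}.

Definition mi_deg (al : multi_index) : nat := \sum_(j < n) al j.

Definition mi_pow (v : 'I_n -> R[i]) (al : multi_index) : R[i] :=
  \prod_(j < n) v j ^+ al j.

Definition dotv (u x : 'rV[R]_n) : R := \sum_(j < n) u 0 j * x 0 j.

Definition abs_summable (t : multi_index -> R[i]) : Prop :=
  (\esum_(al in [set al | (0 < mi_deg al)%N]) (cmod (t al))%:E < +oo)%E.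

(* Sum of the t al over the al <> 0 all of whose components are < N.  Under
   [abs_summable t] the limit in N is the sum of t over all al <> 0, in any
   order. *)
Definition box_sum (t : multi_index -> R[i]) (N : nat) : cplx R :=
  \sum_(al : {ffun 'I_n -> 'I_N}
        | (0 < mi_deg [ffun j => nat_of_ord (al j)])%N)
     t [ffun j => nat_of_ord (al j)].

(* Partial derivatives of complex-valued functions of a real vector, taken on
   real and imaginary parts. *)
Definition partial_exists (j : 'I_n) (f : 'rV[R]_n -> R[i]) (x : 'rV[R]_n) :=
  derivable (fun y => complex.Re (f y) : R^o) x (delta_mx 0 j) /\
  derivable (fun y => complex.Im (f y) : R^o) x (delta_mx 0 j).

Definition partial (j : 'I_n) (f : 'rV[R]_n -> R[i]) : 'rV[R]_n -> R[i] :=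
  fun x => ('D_(delta_mx 0 j) (fun y => complex.Re (f y) : R^o) x : R) +i*
           ('D_(delta_mx 0 j) (fun y => complex.Im (f y) : R^o) x : R).

Definition mi_partial (al : multi_index) (f : 'rV[R]_n -> R[i]) :=
  foldr (fun j g => iter (al j) (partial j) g) f (enum 'I_n).

Definition smooth_on (X : set 'rV[R]_n) (f : 'rV[R]_n -> R[i]) :=
  forall js : seq 'I_n,
    {within X, continuous (foldr partial f js : _ -> cplx R)} /\
    (forall j x, X x -> partial_exists j (foldr partial f js) x).

End MultiIndex.

Section Operators.
Variables (R : realType) (n : nat).

(* Uniform convergence on the compact subsets of X, for the topology of C(X). *)
Definition cvg_compacta (W : uniformType) (X : set 'rV[R]_n)
    (f_ : nat -> 'rV[R]_n -> W) (f : 'rV[R]_n -> W) :=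
  {family [set K | compact K /\ K `<=` X], f_ @ \oo --> f}.

(* A closed linear operator on C(X).  An element of C(X) is represented by any
   total function extending it, so membership in the domain and the values on X
   depend only on the restriction to X ([clo_ext]); values of [clo_fun] off the
   domain, or of [clo_fun f] off X, are meaningless.  As X is open, C(X) is
   metrizable, and closedness is sequential closedness of the graph. *)
Record closed_operator (X : set 'rV[R]_n) := ClosedOperator {
  clo_dom : set ('rV[R]_n -> R[i]);
  clo_fun :> ('rV[R]_n -> R[i]) -> ('rV[R]_n -> R[i]);
  clo_ext : forall f g, (forall x, X x -> f x = g x) -> clo_dom f ->
    clo_dom g /\ forall x, X x -> clo_fun f x = clo_fun g x;
  clo_cont : forall f, clo_dom f ->
    {within X, continuous (f : _ -> cplx R)} /\
    {within X, continuous (clo_fun f : _ -> cplx R)};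
  clo_dom0 : clo_dom (fun=> 0);
  clo_linear : forall (a : R[i]) f g, clo_dom f -> clo_dom g ->
    clo_dom (fun x => a * f x + g x) /\
    forall x, X x ->
      clo_fun (fun y => a * f y + g y) x = a * clo_fun f x + clo_fun g x;
  clo_closed : forall (f_ : nat -> 'rV[R]_n -> R[i]) (f g : 'rV[R]_n -> R[i]),
    (forall k, clo_dom (f_ k)) ->
    @cvg_compacta (cplx R) X f_ f ->
    @cvg_compacta (cplx R) X (fun k => clo_fun (f_ k)) g ->
    clo_dom f /\ forall x, X x -> clo_fun f x = g x }.

Variable X : set 'rV[R]_n.

(* A f = sum_(|al| > 0) a_al d_al f, for every smooth f in the domain of A for
   which the series makes sense (converges absolutely) at each point of X. *)
Definition acts_as (A : closed_operator X)
    (a : multi_index n -> 'rV[R]_n -> R) :=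
  forall f, clo_dom A f -> smooth_on X f ->
    (forall x, X x ->
      abs_summable (fun al => (a al x)%:C * mi_partial al f x)) ->
    forall x, X x ->
      box_sum (fun al => (a al x)%:C * mi_partial al f x) @ \oo
        --> (A f x : cplx R).

Definition affine_coef (c : multi_index n -> R) (d : multi_index n -> 'rV[R]_n)
    (al : multi_index n) (x : 'rV[R]_n) : R := c al + dotv x (d al).

(* p solves d_s p = A p on [0, T[ x X with p(0, .) = f0; the derivative in s is
   taken within [0, +oo[, hence is the right derivative at s = 0. *)
Definition cauchy_solution (A : closed_operator X) (f0 : 'rV[R]_n -> R[i])
    (T : \bar R) (p : R -> 'rV[R]_n -> R[i]) :=
  (forall x, X x -> p 0 x = f0 x) /\
  (forall s : R, 0 <= s -> (s%:E < T)%E ->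
    clo_dom A (p s) /\
    forall x, X x ->
      (fun h : R => (h%:C)^-1 * (p (s + h) x - p s x) : cplx R)
        @ within [set h | 0 <= s + h] (0 : R)^' --> (A (p s) x : cplx R)).

Definition cauchy_uniquely_solvable (A : closed_operator X)
    (f0 : 'rV[R]_n -> R[i]) :=
  (exists p, cauchy_solution A f0 +oo%E p) /\
  (forall (T : \bar R) p q,
    cauchy_solution A f0 T p -> cauchy_solution A f0 T q ->
    forall (s : R) x, 0 <= s -> (s%:E < T)%E -> X x -> p s x = q s x).

Definition analytic_vectors (A : closed_operator X) (I : Type)
    (f : I -> 'rV[R]_n -> R[i]) :=
  (forall u k, clo_dom A (iter k A (f u))) /\
  (forall u, exists2 r : R, 0 < r &
    forall s : R, 0 <= s < r -> exists S : 'rV[R]_n -> R,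
      cvg_compacta X
        (fun N x => \sum_(k < N) s ^+ k / k`!%:R * cmod (iter k A (f u) x)) S).

End Operators.

Section Expansion.
Variables (R : realType) (n : nat) (X : set 'rV[R]_n) (A : closed_operator X).

Definition fexp (u x : 'rV[R]_n) : R[i] := cexp ('i * (dotv u x)%:C).

(* \prod_(r < k) (eta^-1 A + r I) f; the factors commute. *)
Fixpoint rising_op (eta : R) (k : nat) (f : 'rV[R]_n -> R[i]) :=
  if k is r.+1 then
    fun x => (eta^-1)%:C * A (rising_op eta r f) x + r%:R * rising_op eta r f x
  else f.

Definition qfun (eta : R) (u : 'rV[R]_n) (k : nat) (x : 'rV[R]_n) : R[i] :=
  (k`!%:R)^-1 * rising_op eta k (fexp u) x.

(* [:: rho_0; ...; rho_k] at x, by course-of-values recursion; see [rhoE]. *)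
Fixpoint rho_seq (eta : R) (u x : 'rV[R]_n) (k : nat) : seq R[i] :=
  if k is m.+1 then
    let l := rho_seq eta u x m in
    rcons l ((fexp u x)^-1 *
      (qfun eta u k x -
       (k%:R)^-1 * \sum_(1 <= j < k) j%:R * l`_j * qfun eta u (k - j) x))
  else [:: 'i * (dotv u x)%:C].

Definition rho (eta : R) (u : 'rV[R]_n) (k : nat) (x : 'rV[R]_n) : R[i] :=
  (rho_seq eta u x k)`_k.

Lemma size_rho_seq eta u x k : size (rho_seq eta u x k) = k.+1.
Proof. by elim: k => //= k IH; rewrite size_rcons IH. Qed.

Lemma nth_rho_seq eta u x k j : (j <= k)%N ->
  (rho_seq eta u x k)`_j = rho eta u j x.
Proof.
elim: k => [|k IH]; first by rewrite leqn0 => /eqP->.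
rewrite leq_eqVlt => /predU1P[->//|jk].
by rewrite /= nth_rcons size_rho_seq jk IH.
Qed.

Lemma rho0 eta u x : rho eta u 0 x = 'i * (dotv u x)%:C.
Proof. by []. Qed.

Lemma rhoE eta u k x : (0 < k)%N ->
  rho eta u k x = (fexp u x)^-1 *
    (qfun eta u k x -
     (k%:R)^-1 * \sum_(1 <= j < k) j%:R * rho eta u j x * qfun eta u (k - j) x).
Proof.
case: k => // k _; rewrite {1}/rho /= nth_rcons size_rho_seq ltnn eqxx.
congr (_ * (_ - _ * _)); apply: eq_big_nat => j /andP[_ jk].
by rewrite nth_rho_seq.
Qed.

End Expansion.

(* Main.v *)
(* Put [w = 1 - exp (- eta s)], that is [s = mlog1 w / eta] with
   [mlog1 w = - log (1 - w)].  For large [eta] this substitution maps the unit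
   disc into [disc_strip Ru], so [Q w = p (mlog1 w / eta)] is holomorphic and
   zero-free on the unit disc.  Near 0, [p] is the sum of [s^k / k! * A^k f_u],
   by uniqueness for the Cauchy problem, and the substitution turns these
   coefficients into the [q_k].  The logarithmic derivative of [Q] is again
   holomorphic on the disc, with coefficients [(k + 1) rho_(k+1)], whence
   [Q w = exp (sum_k rho_k w^k)].  Affinity of the [rho_k] is by induction:
   formally [eta (1 - w) Q' = A Q] with [Q] the exponential of
   [sum_k rho_k w^k], and an affine generator multiplies the exponential of an
   affine function by an affine function. *)

Require Import Defs.
From mathcomp Require Import all_boot all_order all_algebra.
From mathcomp Require Import complex.
From mathcomp Require Import all_classical all_reals all_analysis.
From mathcomp Require Import ring lra zify.

Set Implicit Arguments.
Unset Strict Implicit.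
Unset Printing Implicit Defensive.

Import Order.TTheory GRing.Theory Num.Theory.
Import numFieldNormedType.Exports.

Local Open Scope classical_set_scope.
Local Open Scope ring_scope.
Local Open Scope complex_scope.

(** * Complex modulus, exponential and derivative *)

(** The formal identity cannot be obtained by applying [A] to the exponential: [acts_as] speaks only
    of smooth functions in the domain whose series converges absolutely. So affinity is proved one
    coefficient of $w$ at a time. Each $q_j$ lies in the domain and, once $\rho_0,\dots,\rho_k$ are
    affine and $j\le k$, its partial derivatives are combinations of $q_0,\dots,q_j$ with
    coefficients independent of $x$. These grow at most like a monomial $M^\alpha$, so the symbol at
    a large real vector dominates the series for $Aq_j$. Its partial sums yield affine functions of
    $x$, and pointwise limits of affine functions on an open set are affine.

    On the analytic side, two descriptions of one function often share only a short real segment: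
    [p] is given for real $s$, and the local series has its own radius. Taylor coefficients are
    therefore identified as those of an asymptotic expansion at 0, which such a segment determines.
    Holomorphy is bare complex differentiability, with no continuity of the derivative, hence
    Goursat's argument. The value [(1 + pi) / Ru] of [eta] comes from the bounds [-1 <= Re] and
    [|Im| < pi / 2] for [mlog1] on the unit disc. *)

Section Modulus.
Variable R : realType.
Implicit Types z w : R[i].

Lemma cmodE z : cmod z = Num.sqrt (complex.Re z ^+ 2 + complex.Im z ^+ 2).
Proof. by rewrite /cmod normc_def. Qed.

Lemma normC_cmod z : `|z| = (cmod z)%:C.
Proof. by rewrite cmodE normc_def. Qed.

Lemma cmod_ge0 z : 0 <= cmod z. Proof. by rewrite cmodE sqrtr_ge0. Qed.

Lemma cmod0 : cmod (0 : R[i]) = 0.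
Proof. by apply: complexI; rewrite -normC_cmod normr0. Qed.

Lemma cmod1 : cmod (1 : R[i]) = 1.
Proof. by apply: complexI; rewrite -normC_cmod normr1. Qed.

Lemma cmod_eq0 z : (cmod z == 0) = (z == 0).
Proof. by rewrite -[RHS]normr_eq0 normC_cmod eq_complex /= eqxx andbT. Qed.

Lemma cmod_gt0 z : (0 < cmod z) = (z != 0).
Proof. by rewrite lt_def cmod_eq0 cmod_ge0 andbT. Qed.

Lemma cmodM z w : cmod (z * w) = cmod z * cmod w.
Proof. by apply: complexI; rewrite rmorphM -!normC_cmod normrM. Qed.

Lemma cmodX z k : cmod (z ^+ k) = cmod z ^+ k.
Proof. by apply: complexI; rewrite rmorphXn -!normC_cmod normrX. Qed.

Lemma cmodV z : cmod z^-1 = (cmod z)^-1.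
Proof. by apply: complexI; rewrite fmorphV -!normC_cmod normfV. Qed.

Lemma cmodN z : cmod (- z) = cmod z.
Proof. by rewrite /cmod normrN. Qed.

Lemma cmodBC z w : cmod (z - w) = cmod (w - z).
Proof. by rewrite -cmodN opprB. Qed.

Lemma cmodR (x : R) : cmod x%:C = `|x|.
Proof. by rewrite cmodE /= expr0n addr0 sqrtr_sqr. Qed.

Lemma cmod_nat k : cmod (k%:R : R[i]) = k%:R.
Proof. by rewrite -(rmorph_nat (real_complex R)) cmodR normr_nat. Qed.

Lemma cmodD z w : cmod (z + w) <= cmod z + cmod w.
Proof. by rewrite -lecR rmorphD -!normC_cmod ler_normD. Qed.

Lemma cmodB z w : cmod (z - w) <= cmod z + cmod w.
Proof. by rewrite -(cmodN w) cmodD. Qed.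

Lemma cmod_dist z w v : cmod (z - v) <= cmod (z - w) + cmod (w - v).
Proof. by rewrite -[z - v](subrKA w) cmodD. Qed.

Lemma cmod_sum (I : Type) (r : seq I) (P : pred I) (F : I -> R[i]) :
  cmod (\sum_(i <- r | P i) F i) <= \sum_(i <- r | P i) cmod (F i).
Proof.
elim/big_rec2: _ => [|i y z _ h]; first by rewrite cmod0.
exact: le_trans (cmodD _ _) (lerD _ h).
Qed.

Lemma Re_le_cmod z : `|complex.Re z| <= cmod z.
Proof. by rewrite -lecR -normC_cmod normc_ge_Re. Qed.

Lemma Im_le_cmod z : `|complex.Im z| <= cmod z.
Proof.
by rewrite cmodE -sqrtr_sqr ler_wsqrtr// lerDr sqr_ge0.
Qed.

Lemma cmod_le z : cmod z <= `|complex.Re z| + `|complex.Im z|.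
Proof.
rewrite [in leLHS](complexE z); apply: le_trans (cmodD _ _) _.
rewrite cmodM !cmodR (_ : cmod 'i = 1) ?mul1r//.
by rewrite cmodE /= expr0n expr1n add0r sqrtr1.
Qed.

Lemma cmod_i : cmod ('i : R[i]) = 1.
Proof. by rewrite cmodE /= expr0n expr1n add0r sqrtr1. Qed.

Lemma cReD z w : complex.Re (z + w) = complex.Re z + complex.Re w.
Proof. by case: z w => [a b] [c d]. Qed.
Lemma cImD z w : complex.Im (z + w) = complex.Im z + complex.Im w.
Proof. by case: z w => [a b] [c d]. Qed.
Lemma cReN z : complex.Re (- z) = - complex.Re z.
Proof. by case: z => [a b]. Qed.
Lemma cImN z : complex.Im (- z) = - complex.Im z.
Proof. by case: z => [a b]. Qed.
Lemma cReM z w : complex.Re (z * w) =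
  complex.Re z * complex.Re w - complex.Im z * complex.Im w.
Proof. by case: z w => [a b] [c d]. Qed.
Lemma cImM z w : complex.Im (z * w) =
  complex.Re z * complex.Im w + complex.Im z * complex.Re w.
Proof. by case: z w => [a b] [c d]. Qed.
Lemma cplxP z w : complex.Re z = complex.Re w -> complex.Im z = complex.Im w -> z = w.
Proof. by case: z w => [a b] [c d] /= -> ->. Qed.

Lemma cexp0 : cexp 0 = 1 :> R[i].
Proof. by rewrite /cexp /= expR0 cos0 sin0; apply: cplxP; rewrite /= ?mulr1 ?mulr0 ?mul0r ?subr0 ?addr0. Qed.

Lemma cexpD z w : cexp (z + w) = cexp z * cexp w.
Proof.
case: z w => [a b] [c d]; rewrite /cexp /= expRD cosD sinD.
by apply: cplxP; rewrite /=; ring.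
Qed.

Lemma cmod_cexp z : cmod (cexp z) = expR (complex.Re z).
Proof.
rewrite /cexp cmodM cmodR ger0_norm ?expR_ge0// cmodE /= cos2Dsin2.
by rewrite sqrtr1 mulr1.
Qed.

Lemma cexp_neq0 z : cexp z != 0.
Proof. by rewrite -cmod_gt0 cmod_cexp expR_gt0. Qed.

Lemma cexpN z : cexp (- z) = (cexp z)^-1.
Proof.
by apply: (mulfI (cexp_neq0 z)); rewrite -cexpD subrr cexp0 divff ?cexp_neq0.
Qed.

End Modulus.

(** * Limits and complex derivatives expressed with the real modulus *)

Section Limits.
Variable R : realType.

(** The norm of [cplx R] takes values in [R[i]], where [0 < e] forces the imaginary part of [e] to
    vanish; real radii therefore suffice. *)
Lemma cvgC_cmod (T : Type) (F : set_system T) {FF : Filter F}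
    (f : T -> cplx R) (l : cplx R) :
  (forall e : R, 0 < e -> \forall x \near F, cmod (l - f x) < e) <-> f @ F --> l.
Proof.
split=> [h|/cvgrPdist_lt h e e0].
  apply/cvgrPdist_lt => e e0.
  have /andP[/eqP ie re] : (complex.Im e == 0) && (0 < complex.Re e).
    by move: e0; rewrite ltcE /=.
  have := h _ re; apply: filterS => x.
  rewrite -ltcR -normC_cmod => /lt_le_trans; apply.
  by rewrite lecE /= ie eqxx lexx.
have := h e%:C; rewrite ltcR => /(_ e0).
by apply: filterS => x; rewrite normC_cmod ltcR.
Qed.

Lemma nbhs_cmod (z : cplx R) (P : set (cplx R)) :
  nbhs z P <-> exists2 e : R, 0 < e & forall w, cmod (w - z) < e -> P w.
Proof.
split=> [/nbhs_normP [e /= e0 he]|[e e0 he]].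
  have /andP[/eqP ie re] : (complex.Im e == 0) && (0 < complex.Re e).
    by move: e0; rewrite ltcE /=.
  exists (complex.Re e) => // w wz; apply: he => /=.
  rewrite /ball_ /= distrC normC_cmod (lt_le_trans (y := (complex.Re e)%:C))//.
    by rewrite ltcR.
  by rewrite lecE /= ie eqxx lexx.
apply/(nbhs_normP (V := cplx R) z P); exists e%:C; first by rewrite /= ltcR.
by move=> w /=; rewrite /ball_ /= distrC normC_cmod ltcR => /he.
Qed.

(** Multiplying out the difference quotient admits [h = 0], and differentiability becomes an
    estimate between real numbers. *)
Lemma is_deriveC (f : cplx R -> cplx R) (z d : cplx R) :
  is_derive z 1 f d <->
  forall e : R, 0 < e -> exists2 r : R, 0 < r &
    forall h, cmod h < r -> cmod (f (z + h) - f z - d * h) <= e * cmod h.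
Proof.
split=> [df e e0|H].
  have [dfz dfe] := df.
  have : (fun h => h^-1 *: (f (h *: (1 : cplx R) + z) - f z)) @ (0 : cplx R)^' --> d.
    rewrite -dfe; exact: dfz.
  move/cvgC_cmod => /(_ e e0).
  rewrite /dnbhs /within /= => /(nbhs_cmod 0)[r r0 hr].
  exists r => // h hh; have [->|h0] := eqVneq h 0.
    by rewrite addr0 subrr mulr0 subr0 cmod0 mulr0.
  have := hr h; rewrite subr0 => /(_ hh h0) /ltW.
  have hp : 0 < cmod h by rewrite cmod_gt0.
  rewrite -(ler_pM2r hp) -cmodM; congr (_ <= _).
  rewrite cmodBC; congr cmod; rewrite mulrBl; congr (_ - _).
  rewrite -[_ *: _]/(_ * _) -[h *: _]/(h * 1) mulr1 mulrC mulrA mulfV// mul1r.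
  by rewrite [h + z]addrC.
have cv : (fun h => h^-1 *: (f (h *: (1 : cplx R) + z) - f z)) @ (0 : cplx R)^' --> d.
  apply/cvgC_cmod => e e0.
  have [r r0 hr] := H (e / 2) (divr_gt0 e0 (ltr0n _ 2)).
  apply/(nbhs_cmod 0); exists r => // h; rewrite subr0 => hh h0.
  have hp : 0 < cmod h by rewrite cmod_gt0.
  rewrite -(ltr_pM2r hp) -cmodM mulrBl -[_ *: _]/(_ * _) -[h *: _]/(h * 1) mulr1.
  rewrite mulrAC mulVf// mul1r cmodBC [h + z]addrC.
  apply: le_lt_trans (hr _ hh) _; rewrite ltr_pM2r// ltr_pdivrMr//.
  by rewrite ltr_pMr// ltr1n.
by apply: DeriveDef; [apply/cvg_ex; exists d | exact/cvg_lim].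
Qed.

Lemma derivableC_continuous (f : cplx R -> cplx R) (z : cplx R) :
  derivable f z 1 -> {for z, continuous f}.
Proof. by move/derivable1_diffP/differentiable_continuous. Qed.

Lemma is_deriveC_comp (f g : cplx R -> cplx R) (z a b : cplx R) :
  is_derive (g z) 1 f a -> is_derive z 1 g b -> is_derive z 1 (f \o g) (a * b).
Proof.
move=> /is_deriveC df /is_deriveC dg; apply/is_deriveC => e e0.
have a1 : 0 < 2 * (cmod a + 1) by rewrite mulr_gt0// ltr_wpDl// cmod_ge0.
have b1 : 0 < 2 * (cmod b + 1) by rewrite mulr_gt0// ltr_wpDl// cmod_ge0.
have [r1 r10 hf] := df _ (divr_gt0 e0 b1).
have e2p : 0 < Num.min 1 (e / (2 * (cmod a + 1))) by rewrite lt_min ltr01 divr_gt0.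
have [r2 r20 hg] := dg _ e2p.
exists (Num.min r2 (r1 / (cmod b + 1))).
  by rewrite lt_min r20 divr_gt0// ltr_wpDl// cmod_ge0.
move=> h; rewrite lt_min => /andP[hr2 hr1].
have {}hg := hg _ hr2; set k := g (z + h) - g z.
have kle : cmod k <= (cmod b + 1) * cmod h.
  rewrite -[k](subrK (b * h)) mulrDl mul1r addrC -cmodM.
  apply: le_trans (cmodD _ _) _; rewrite lerD2l (le_trans hg)//.
  by rewrite ler_piMl ?cmod_ge0// ge_min lexx.
have kr : cmod k < r1.
  by rewrite (le_lt_trans kle)// mulrC -ltr_pdivlMr// ltr_wpDl// cmod_ge0.
have gk : g z + k = g (z + h) by rewrite addrC subrK.
have := hf _ kr; rewrite gk => hk /=.
(* The error is that of [f] for the increment [k], plus [a] times that of [g]. The tolerances were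
   chosen to make each at most [e / 2 * cmod h], the [+ 1] keeping denominators positive when [a] or
   [b] is 0. *)
rewrite -[_ - _ - _](subrKA (a * k)) -mulrA -mulrBr.
apply: le_trans (cmodD _ _) _; rewrite (splitr e) mulrDl; apply: lerD.
  apply: le_trans hk _; rewrite -!mulrA ler_pM2l// ler_pdivrMl//.
  have := kle; have := cmod_ge0 h; have := cmod_ge0 b; nra.
rewrite cmodM; apply: le_trans (ler_wpM2l (cmod_ge0 a) hg) _.
rewrite mulrA ler_wpM2r ?cmod_ge0//.
apply: (@le_trans _ _ (cmod a * (e / (2 * (cmod a + 1))))).
  by rewrite ler_wpM2l ?cmod_ge0// ge_min lexx orbT.
rewrite mulrCA ler_pM2l// ler_pdivrMr//.
have := cmod_ge0 a; nra.
Qed.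

End Limits.

(** * Primitives and integrals of complex functions of a real variable *)

Section Curves.
Variable R : realType.

(** Componentwise, so that the real mean value theorem and the real fundamental theorem of calculus
    apply to each part. *)
Definition rderiv (G : R -> R[i]) (t : R) (d : R[i]) : Prop :=
  is_derive t 1 (fun s => complex.Re (G s) : R) (complex.Re d) /\
  is_derive t 1 (fun s => complex.Im (G s) : R) (complex.Im d).

Lemma continuous_Re (T : topologicalType) (g : T -> cplx R) :
  continuous g -> continuous (fun x => complex.Re (g x) : R).
Proof.
move=> cg x; apply/cvgrPdist_lt => e e0.
have /cvgC_cmod/(_ e e0) := cg x; apply: filterS => y.
by apply: le_lt_trans; rewrite -cReN -cReD Re_le_cmod.
Qed.

Lemma continuous_Im (T : topologicalType) (g : T -> cplx R) :
  continuous g -> continuous (fun x => complex.Im (g x) : R).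
Proof.
move=> cg x; apply/cvgrPdist_lt => e e0.
have /cvgC_cmod/(_ e e0) := cg x; apply: filterS => y.
by apply: le_lt_trans; rewrite -cImN -cImD Im_le_cmod.
Qed.

Lemma continuous_Complex (T : topologicalType) (f g : T -> R) :
  continuous f -> continuous g -> continuous (fun x => f x +i* g x : cplx R).
Proof.
move=> cf cg x; apply/cvgC_cmod => e e0.
have e2 : 0 < e / 2 by rewrite divr_gt0.
have /cvgrPdist_lt/(_ _ e2) := cf x; have /cvgrPdist_lt/(_ _ e2) := cg x.
apply: filterS2 => y h1 h2; apply: le_lt_trans (cmod_le _) _.
by rewrite cReD cImD cReN cImN /= [e]splitr ltrD.
Qed.

Lemma rderiv_lin (c : R[i]) (F G : R -> R[i]) t d e : rderiv F t d -> rderiv G t e ->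
  rderiv (fun s => c * F s + G s) t (c * d + e).
Proof.
move=> [F1 F2] [G1 G2]; split.
  rewrite (_ : (fun s => complex.Re _) = (fun s => complex.Re c * complex.Re (F s)
      - complex.Im c * complex.Im (F s) + complex.Re (G s))); last first.
    by apply/funext => s; rewrite cReD cReM.
  by apply: trigger_derive; rewrite cReD cReM.
rewrite (_ : (fun s => complex.Im _) = (fun s => complex.Re c * complex.Im (F s)
      + complex.Im c * complex.Re (F s) + complex.Im (G s))); last first.
  by apply/funext => s; rewrite cImD cImM.
by apply: trigger_derive; rewrite cImD cImM.
Qed.

Lemma mvt_bound (f f' : R -> R) (a b M : R) : a <= b ->
  (forall t : R, is_derive t 1 f (f' t)) ->
  (forall t, a <= t <= b -> `|f' t| <= M) -> `|f b - f a| <= M * (b - a).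
Proof.
move=> ab df hM.
have [|c] := @MVT_segment _ f f' a b ab.
  apply: continuous_subspaceT => x; apply: differentiable_continuous.
  by apply/derivable1_diffP; have [] := df x.
rewrite in_itv /= => /hM cM ->.
by rewrite normrM (ger0_norm (x := b - a)) ?subr_ge0// ler_wpM2r// subr_ge0.
Qed.

(** The mean value theorem is applied to real and imaginary part separately, which costs the factor
    2. *)
Lemma rderiv_bound (G g : R -> R[i]) (a b M : R) : a <= b ->
  (forall t, rderiv G t (g t)) ->
  (forall t, a <= t <= b -> cmod (g t) <= M) -> cmod (G b - G a) <= 2 * M * (b - a).
Proof.
move=> ab dG hM; apply: le_trans (cmod_le _) _.
rewrite cReD cImD cReN cImN -mulrA mulr_natl mulr2n; apply: lerD.
  have dR (t : R) : is_derive t 1 (fun s => complex.Re (G s) : R) (complex.Re (g t)) by have [] := dG t.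
  apply: (mvt_bound ab dR) => t /hM; exact/le_trans/Re_le_cmod.
have dI (t : R) : is_derive t 1 (fun s => complex.Im (G s) : R) (complex.Im (g t)) by have [] := dG t.
apply: (mvt_bound ab dI) => t /hM; exact/le_trans/Im_le_cmod.
Qed.

(** Integrals from [- K] give a primitive below [K] only. Normalised to vanish at 0 they no longer
    depend on [K], so taking [K] just above [|x|] glues them into one primitive on the whole
    line. *)
Lemma primitive_exists_real (g : R -> R) : continuous g ->
  exists G : R -> R, forall t : R, is_derive t 1 G (g t).
Proof.
move=> cg.
pose F K x := \int[@lebesgue_measure R]_(t in `[- K, x]) g t.
have dF (K x : R) : `|x| < K -> is_derive x 1 (F K) (g x).
  move=> xK; have /andP[xK1 xK2] : - K < x < K by rewrite -ltr_norml.
  have ig : lebesgue_measure.-integrable `[- K, K] (EFin \o g).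
    apply: continuous_compact_integrable; first exact: segment_compact.
    exact: continuous_subspaceT.
  have [] := continuous_FTC1_closed xK2 ig xK1 (cg x).
  rewrite -/(F K) derive1E => dFx <-; exact: derivableP.
have indep (K L x : R) : `|x| < K -> `|x| < L -> F K x - F K 0 = F L x - F L 0.
  move=> xK xL.
  have K0 (y : R) : `|y| <= `|x| -> `|y| < K by move=> /le_lt_trans->.
  have L0 (y : R) : `|y| <= `|x| -> `|y| < L by move=> /le_lt_trans->.
  have d (y : R) : `|y| <= `|x| -> is_derive y 1 (F K \- F L) 0.
    move=> yx; have d1 := dF _ _ (K0 _ yx); have d2 := dF _ _ (L0 _ yx).
    by have := is_deriveB d1 d2; rewrite subrr.
  have key : (F K \- F L) x = (F K \- F L) 0.
    have [x0|x0] := leP 0 x.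
      have [||c _] := @MVT_segment _ (F K \- F L) (fun=> 0) 0 x x0.
      - move=> y; rewrite in_itv /= => /andP[y0 yx]; apply: d.
        by rewrite !ger0_norm// ?ltW.
      - apply: derivable_within_continuous => y; rewrite in_itv /= => /andP[y0 yx].
        by have [] : is_derive y 1 (F K \- F L) 0 by apply: d; rewrite !ger0_norm.
      by rewrite mul0r => /eqP; rewrite subr_eq0 => /eqP.
    have [||c _] := @MVT_segment _ (F K \- F L) (fun=> 0) x 0 (ltW x0).
    - move=> y; rewrite in_itv /= => /andP[y0 yx]; apply: d.
      by rewrite !ler0_norm ?lerN2// ?ltW// (lt_trans _ x0).
    - apply: derivable_within_continuous => y; rewrite in_itv /= => /andP[y0 yx].
      by have [] : is_derive y 1 (F K \- F L) 0 by apply: d; rewrite !ler0_norm ?lerN2// ltW.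
    by rewrite mul0r => /eqP; rewrite subr_eq0 => /eqP.
  by move: key => /=; lra.
exists (fun x => F (`|x| + 1) x - F (`|x| + 1) 0) => t.
pose K := `|t| + 2.
have tK : `|t| < K by rewrite ltrDl.
have dG : is_derive t 1 (fun x => F K x - F K 0) (g t).
  have dFt := dF _ _ tK.
  by apply: trigger_derive; rewrite subr0.
apply: near_eq_is_derive dG.
apply: filterS (nbhsx_ballx t 1 ltr01) => x; rewrite /ball /= => tx.
apply: indep; last by rewrite ltrDl.
move: (x : R) tx => {}x tx.
by have := lerB_dist x t; rewrite distrC /K => h; lra.
Qed.

Lemma primitive_exists (g : R -> cplx R) : continuous g ->
  exists G : R -> R[i], forall t, rderiv G t (g t).
Proof.
move=> cg; have [G1 h1] := primitive_exists_real (continuous_Re cg).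
have [G2 h2] := primitive_exists_real (continuous_Im cg).
by exists (fun t => G1 t +i* G2 t) => t; split => /=.
Qed.

(** A difference of values of one chosen global primitive: additivity in the interval then holds for
    every [g], and for continuous [g] the choice is immaterial up to a constant that cancels. *)
Definition cint (g : R -> R[i]) (a b : R) : R[i] :=
  let G := xget (fun=> 0) [set G : R -> R[i] | forall t, rderiv G t (g t)] in
  G b - G a.

Lemma cint_prim (g : R -> cplx R) : continuous g ->
  exists2 G : R -> R[i], (forall t, rderiv G t (g t)) &
    forall a b, cint g a b = G b - G a.
Proof.
move=> /primitive_exists[G hG]; rewrite /cint.
case: xgetP => [H _ hH|/(_ G)//]; by exists H.
Qed.

Lemma cint_chasles (g : R -> cplx R) a b c : cint g a c = cint g a b + cint g b c.
Proof. by rewrite /cint; ring. Qed.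

Lemma cint_approx (g : R -> cplx R) (H h : R -> R[i]) (a b M : R) : a <= b ->
  continuous g -> (forall t, rderiv H t (h t)) ->
  (forall t, a <= t <= b -> cmod (g t - h t) <= M) ->
  cmod (cint g a b - (H b - H a)) <= 2 * M * (b - a).
Proof.
move=> ab /cint_prim[G dG ->] dH hM.
rewrite (_ : _ - _ = (-1 * H b + G b) - (-1 * H a + G a)); last by ring.
apply: (@rderiv_bound (fun t => -1 * H t + G t) (fun t => -1 * h t + g t)) => // t.
  exact: rderiv_lin.
by move=> /hM; rewrite mulN1r addrC.
Qed.

Lemma cint_eq (g : R -> cplx R) (H : R -> R[i]) (a b : R) : a <= b ->
  continuous g -> (forall t, rderiv H t (g t)) -> cint g a b = H b - H a.
Proof.
move=> ab cg dH; apply/eqP; rewrite -subr_eq0 -cmod_eq0 eq_le cmod_ge0 andbT.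
have := @cint_approx g H g a b 0 ab cg dH; rewrite mulr0 mul0r; apply => t _.
by rewrite subrr cmod0.
Qed.

Lemma rderiv_cst (c : R[i]) t : rderiv (fun=> c) t 0.
Proof. by split; exact: is_derive_cst. Qed.

Lemma cint_le (g : R -> cplx R) (a b M : R) : a <= b ->
  continuous g -> (forall t, a <= t <= b -> cmod (g t) <= M) ->
  cmod (cint g a b) <= 2 * M * (b - a).
Proof.
move=> ab cg hM; rewrite -[cint _ _ _]subr0 -[X in _ - X](subrr (0 : R[i])).
apply: (cint_approx (H := fun=> 0) (h := fun=> 0)) => // t.
  exact: rderiv_cst.
by rewrite subr0; exact: hM.
Qed.

Lemma cint_lin (c : R[i]) (f g : R -> cplx R) (a b : R) : a <= b ->
  continuous f -> continuous g ->
  cint (fun t => c * f t + g t) a b = c * cint f a b + cint g a b.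
Proof.
move=> ab cf cg; have [F dF ->] := cint_prim cf; have [G dG ->] := cint_prim cg.
have cfg : continuous (fun t => c * f t + g t : cplx R).
  move=> t; have cc : {for t, continuous (fun=> c : cplx R)} by exact: cvg_cst.
  exact: continuousD (continuousM cc (cf t)) (cg t).
have dFG t : rderiv (fun t => c * F t + G t) t (c * f t + g t) by exact: rderiv_lin.
by rewrite (cint_eq ab cfg dFG); ring.
Qed.

End Curves.

(** * Vanishing of additive functions of rectangles *)

Section Rectangles.
Variable R : realType.

Lemma max4 (a b c d e : R[i]) : a = b + c + d + e ->
  [\/ cmod a <= 4 * cmod b, cmod a <= 4 * cmod c, cmod a <= 4 * cmod d | cmod a <= 4 * cmod e].
Proof.
move=> ->; have := cmodD (b + c + d) e; have := cmodD (b + c) d; have := cmodD b c.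
set s := cmod (b + c + d + e) => h1 h2 h3.
have [?|?] := leP s (4 * cmod b); first by constructor 1.
have [?|?] := leP s (4 * cmod c); first by constructor 2.
have [?|?] := leP s (4 * cmod d); first by constructor 3.
have [?|?] := leP s (4 * cmod e); first by constructor 4.
lra.
Qed.

(** The point is the supremum of the left ends, each right end being an upper bound for all of
    them. *)
Lemma nested_point (x l : nat -> R) :
  (forall n, x n <= x n.+1) -> (forall n, x n.+1 + l n.+1 <= x n + l n) ->
  (forall n, 0 <= l n) -> exists p, forall n, x n <= p <= x n + l n.
Proof.
move=> xi yd l0.
have xle m n : (m <= n)%N -> x m <= x n.
  elim: n => [|n IH]; first by rewrite leqn0 => /eqP->.
  by rewrite leq_eqVlt => /predU1P[->//|/IH/le_trans]; apply.
have yle m n : (m <= n)%N -> x n + l n <= x m + l m.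
  elim: n => [|n IH]; first by rewrite leqn0 => /eqP->.
  rewrite leq_eqVlt => /predU1P[->//|/IH]; exact: le_trans (yd n).
have xy m n : x m <= x n + l n.
  apply: (@le_trans _ _ (x (maxn m n) + l (maxn m n))).
    by rewrite (le_trans (xle _ _ (leq_maxl m n)))// lerDl.
  by apply: yle; exact: leq_maxr.
exists (sup (range x)) => n; apply/andP; split.
  apply: ub_le_sup; last by exists n.
  by exists (x 0%N + l 0%N) => _ [m _ <-].
by apply: sup_le_ub; [exists (x 0%N), 0%N|move=> _ [m _ <-]].
Qed.

(* Goursat's bisection argument. *)
Lemma rect_vanish (F : R -> R -> R -> R -> R[i]) (a b c d : R) :
  (forall x m y z t, F x y z t = F x m z t + F m y z t) ->
  (forall x y z m t, F x y z t = F x y z m + F x y m t) ->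
  a <= b -> c <= d ->
  (forall p q, a <= p <= b -> c <= q <= d -> forall e, 0 < e ->
     exists2 r, 0 < r & forall a' b' c' d', a <= a' <= p -> p <= b' <= b ->
       c <= c' <= q -> q <= d' <= d -> b' - a' < r -> d' - c' < r ->
       cmod (F a' b' c' d') <= e * ((b' - a') + (d' - c')) ^+ 2) ->
  F a b c d = 0.
Proof.
move=> F1 F2 ab cd loc.
pose l n := (b - a) / 2 ^+ n; pose m n := (d - c) / 2 ^+ n.
have l2 n : l n.+1 = l n / 2 by rewrite /l exprS invfM mulrCA mulrC.
have m2 n : m n.+1 = m n / 2 by rewrite /m exprS invfM mulrCA mulrC.
have l0 n : 0 <= l n by rewrite divr_ge0 ?exprn_ge0 ?subr_ge0.
have m0 n : 0 <= m n by rewrite divr_ge0 ?exprn_ge0 ?subr_ge0.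
pose Q (n : nat) (v : R * R) := F v.1 (v.1 + l n) v.2 (v.2 + m n).
have step (nv : nat * (R * R)) : exists w : R * R,
    [/\ w.1 = nv.2.1 \/ w.1 = nv.2.1 + l nv.1.+1,
        w.2 = nv.2.2 \/ w.2 = nv.2.2 + m nv.1.+1 &
        cmod (Q nv.1 nv.2) <= 4 * cmod (Q nv.1.+1 w)].
  case: nv => n [x y] /=; rewrite /Q /=.
  have lh : x + l n = (x + l n.+1) + l n.+1 by rewrite l2; field.
  have mh : y + m n = (y + m n.+1) + m n.+1 by rewrite m2; field.
  have E : F x (x + l n) y (y + m n) =
      F x (x + l n.+1) y (y + m n.+1) + F x (x + l n.+1) (y + m n.+1) (y + m n.+1 + m n.+1)
    + F (x + l n.+1) (x + l n.+1 + l n.+1) y (y + m n.+1)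
    + F (x + l n.+1) (x + l n.+1 + l n.+1) (y + m n.+1) (y + m n.+1 + m n.+1).
    rewrite lh mh (F1 x (x + l n.+1)) (F2 _ _ y (y + m n.+1)).
    by rewrite (F2 (x + l n.+1) _ y (y + m n.+1)) addrA.
  have [h|h|h|h] := max4 E.
  - by exists (x, y); split; [left|left|].
  - by exists (x, y + m n.+1); split; [left|right|].
  - by exists (x + l n.+1, y); split; [right|left|].
  - by exists (x + l n.+1, y + m n.+1); split; [right|right|].
have [f hf] := choice step.
pose v := fix v n := if n is k.+1 then f (k, v k) else (a, c).
have hv n := hf (n, v n).
have vS n : v n.+1 = f (n, v n) by [].
have [p hp] : exists p, forall n, (v n).1 <= p <= (v n).1 + l n.
  apply: nested_point => // n; have [h _ _] := hv n; rewrite vS.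
    by case: h => ->; rewrite ?lerDl.
  by case: h => -> /=; rewrite l2; have := l0 n; lra.
have [q hq] : exists q, forall n, (v n).2 <= q <= (v n).2 + m n.
  apply: nested_point => // n; have [_ h _] := hv n; rewrite vS.
    by case: h => ->; rewrite ?lerDl.
  by case: h => -> /=; rewrite m2; have := m0 n; lra.
have v1 n : a <= (v n).1 /\ (v n).1 + l n <= b.
  elim: n => [|n [IH1 IH2]]; first by rewrite /l /= expr0 divr1; lra.
  have [h _ _] := hv n; rewrite vS; move: h (l0 n); rewrite l2.
  by case=> -> /=; lra.
have v2 n : c <= (v n).2 /\ (v n).2 + m n <= d.
  elim: n => [|n [IH1 IH2]]; first by rewrite /m /= expr0 divr1; lra.
  have [_ h _] := hv n; rewrite vS; move: h (m0 n); rewrite m2.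
  by case=> -> /=; lra.
have Qn n : cmod (F a b c d) <= 4 ^+ n * cmod (Q n (v n)).
  elim: n => [|n IH].
    by rewrite expr0 mul1r /Q /l /m /= expr0 !divr1 ![_ + (_ - _)]addrC !subrK.
  apply: le_trans IH _; rewrite exprSr -mulrA ler_wpM2l ?exprn_ge0//.
  by have [_ _] := hv n.
have pab : a <= p <= b.
  by have := hp 0%N; have := v1 0%N; lra.
have qcd : c <= q <= d.
  by have := hq 0%N; have := v2 0%N; lra.
apply/eqP; rewrite -cmod_eq0 eq_le cmod_ge0 andbT; apply/ler_addgt0Pl => e e0.
pose K := ((b - a) + (d - c)) ^+ 2 + 1.
have K0 : 0 < K by rewrite ltr_wpDl ?sqr_ge0.
have [r r0 hr] := loc p q pab qcd (e / K) (divr_gt0 e0 K0).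
have [n hn] : exists n, ((b - a) + (d - c)) / 2 ^+ n < r.
  set C := _ + _; have C0 : 0 <= C by rewrite addr_ge0 ?subr_ge0.
  exists (Num.bound (C / r)).
  rewrite ltr_pdivrMr ?exprn_gt0// mulrC -ltr_pdivrMr//.
  apply: lt_trans (archi_boundP (divr_ge0 C0 (ltW r0))) _.
  by rewrite -natrX ltr_nat ltn_expl.
have {}hn : l n + m n < r by rewrite /l /m -mulrDl.
have := hr (v n).1 ((v n).1 + l n) (v n).2 ((v n).2 + m n).
have [/andP[hp1 hp2] /andP[hq1 hq2]] := (hp n, hq n).
have [[v11 v12] [v21 v22]] := (v1 n, v2 n).
rewrite v11 hp1 hp2 v12 v21 hq1 hq2 v22 ![_ + _ - _]addrC !addKr.
have ln := l0 n; have mn := m0 n.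
move=> /(_ erefl erefl erefl erefl); rewrite (le_lt_trans _ hn) ?lerDl//.
rewrite (le_lt_trans _ hn) ?lerDr// => /(_ erefl erefl) hQ.
(* The factor [4 ^+ n] lost in the bisections is cancelled by the squared half-perimeter, which
   carries the factor [(2 ^- n) ^+ 2]. *)
apply: le_trans (Qn n) _; rewrite addr0.
apply: (@le_trans _ _ (4 ^+ n * (e / K * (l n + m n) ^+ 2))).
  by rewrite ler_wpM2l// exprn_ge0.
rewrite /l /m -mulrDl expr_div_n -exprM mulnC exprM (_ : 2 ^+ 2 = 4 :> R); last by rewrite expr2; ring.
rewrite mulrCA [4 ^+ n * _]mulrC divfK ?expf_neq0// mulrAC.
rewrite -mulrA ler_piMr ?(ltW e0)// ler_pdivrMr// mul1r /K lerDl ler01//.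
Qed.

End Rectangles.

(** * Cauchy's integral formula on circles *)

Section ContinuousC.
Variables (R : realType) (T : topologicalType).
Implicit Types f g : T -> cplx R.

Lemma ccM f g : continuous f -> continuous g -> continuous (fun x => f x * g x : cplx R).
Proof. by move=> cf cg x; exact: continuousM (cf x) (cg x). Qed.

Lemma ccD f g : continuous f -> continuous g -> continuous (fun x => f x + g x : cplx R).
Proof. by move=> cf cg x; exact: continuousD (cf x) (cg x). Qed.

Lemma cccst (c : cplx R) : continuous (fun _ : T => c).
Proof. by move=> x; exact: cvg_cst. Qed.

End ContinuousC.

Section Circle.
Variable R : realType.

Definition cis (t : R) : R[i] := cos t +i* sin t.

Lemma cisD s t : cis (s + t) = cis s * cis t.
Proof. by rewrite /cis cosD sinD; apply: cplxP; rewrite /=; ring. Qed.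

Lemma cis0 : cis 0 = 1. Proof. by rewrite /cis cos0 sin0. Qed.

Lemma cmod_cis t : cmod (cis t) = 1.
Proof. by rewrite cmodE /= cos2Dsin2 sqrtr1. Qed.

Lemma cis_neq0 t : cis t != 0.
Proof. by rewrite -cmod_gt0 cmod_cis. Qed.

Lemma cis2pi : cis (2 * pi) = 1.
Proof. by rewrite -[2 * pi]add0r mulr_natl /cis cosD2pi sinD2pi cos0 sin0. Qed.

Lemma cisX k t : cis (k%:R * t) = cis t ^+ k.
Proof.
elim: k => [|k IH]; first by rewrite mul0r cis0 expr0.
by rewrite -natr1 mulrDl mul1r cisD IH exprSr.
Qed.

Lemma cisN t : cis (- t) = (cis t)^-1.
Proof. by apply: (mulfI (cis_neq0 t)); rewrite -cisD subrr cis0 divff ?cis_neq0. Qed.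

Lemma continuous_cis : continuous (cis : R -> cplx R).
Proof. exact: continuous_Complex (@continuous_cos R) (@continuous_sin R). Qed.

Lemma rderiv_cis (k t : R) : rderiv (fun s => cis (k * s)) t (k%:C * 'i * cis (k * t)).
Proof. by split => /=; apply: trigger_derive; rewrite /GRing.scale /=; ring. Qed.

Lemma rderiv_id (t : R) : rderiv (fun s => s%:C) t 1.
Proof. by split => /=; [exact: is_derive_id|exact: is_derive_cst]. Qed.

Lemma rderiv_exp (t : R) : rderiv (fun s => (expR s)%:C) t (expR t)%:C.
Proof. by split => /=; [exact: is_derive_expR|exact: is_derive_cst]. Qed.

Lemma continuous_RC (T : topologicalType) (g : T -> R) : continuous g ->
  continuous (fun x => (g x)%:C : cplx R).
Proof. by move=> cg; apply: continuous_Complex => // x; exact: cvg_cst. Qed.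

End Circle.

Section CauchyFormula.
Variables (R : realType) (f : R[i] -> R[i]) (r : R) (w : R[i]).
Hypothesis wr : cmod w < r.
Hypothesis df : forall z, cmod z <= r -> derivable (f : cplx R -> cplx R) z 1.

Let r0 : 0 < r. Proof. exact: le_lt_trans (cmod_ge0 w) wr. Qed.

Let z (t : R) : cplx R := r%:C * cis t.
Let m (t : R) : cplx R := z t - w.
(** [ka t dt] is the form [dz / (z - w)] pulled back to the circle, since [z' = 'i * z]. *)
Let ka (t : R) : cplx R := 'i * (z t / m t).

Let cmod_z t : cmod (z t) = r.
Proof. by rewrite /z cmodM cmod_cis mulr1 cmodR ger0_norm ?ltW. Qed.

Let m_ge t : r - cmod w <= cmod (m t).
Proof.
by rewrite /m lerBlDr -[leLHS](cmod_z t) -[in leLHS](subrK w (z t)) cmodD.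
Qed.

Let m_le t : cmod (m t) <= 2 * r.
Proof. by have := cmodB (z t) w; rewrite cmod_z -/(m t) => h; have := wr; lra. Qed.

Let m0 t : m t != 0.
Proof. by rewrite -cmod_gt0 (lt_le_trans _ (m_ge t))// subr_gt0. Qed.

Let z0 t : z t != 0. Proof. by rewrite -cmod_gt0 cmod_z. Qed.

Let Mk := r / (r - cmod w).

Let Mk0 : 0 < Mk. Proof. by rewrite divr_gt0// subr_gt0. Qed.

Let ka_le t : cmod (ka t) <= Mk.
Proof.
rewrite /ka cmodM cmod_i mul1r cmodM cmodV cmod_z ler_pM2l//.
by rewrite lef_pV2 ?m_ge// posrE ?subr_gt0// cmod_gt0.
Qed.

Let cz : continuous z.
Proof.
move=> t; have cc : {for t, continuous (fun=> r%:C : cplx R)} by exact: cvg_cst.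
exact: continuousM cc (@continuous_cis R t).
Qed.

Let cm : continuous m.
Proof.
move=> t; have cc : {for t, continuous (fun=> w : cplx R)} by exact: cvg_cst.
exact: continuousB (cz (x:=t)) cc.
Qed.

Let cka : continuous ka.
Proof.
move=> t; have cc : {for t, continuous (fun=> 'i : cplx R)} by exact: cvg_cst.
have cv := continuousV (m0 t) (cm (x:=t)).
exact: continuousM cc (continuousM (cz (x:=t)) cv).
Qed.

Let dm t : rderiv m t (z t * 'i).
Proof.
have h := rderiv_lin r%:C (rderiv_cis 1 t) (rderiv_cst (- w) t).
rewrite (_ : m = fun s => r%:C * cis (1 * s) + - w); last first.
  by apply/funext => s; rewrite mul1r.
rewrite (_ : z t * 'i = r%:C * (1%:C * 'i * cis (1 * t)) + 0) //.
by rewrite /z mul1r addr0 mul1r mulrA mulrAC.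
Qed.

Let ccomp (g : R -> cplx R) : continuous g -> (forall t, cmod (g t) <= r) ->
  continuous (fun t => f (g t) : cplx R).
Proof.
move=> cg gr t; apply: (@continuous_comp _ _ _ g (f : cplx R -> cplx R)); first exact: cg.
exact: derivableC_continuous (df (gr t)).
Qed.

(** Contraction of the circle towards [w]: [s = 0] is the circle itself, and [s] tending to minus
    infinity shrinks it to [w]. On it [dz / (z - w)] is [ds + ka dt], with [ka] independent of [s].
    Clamping [s] at 0 keeps the image in the disc, so that [h] is continuous on the whole line, as
    [cint] wants. *)
Let ga (s t : R) : cplx R := w + (expR (Num.min s 0))%:C * m t.

Let ga_le s t : cmod (ga s t) <= r.
Proof.
have e0 := expR_gt0 (Num.min s 0).
have e1 : expR (Num.min s 0) <= 1 by rewrite -expR0 ler_expR ge_min lexx orbT.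
rewrite /ga /m (_ : _ + _ = (1 - expR (Num.min s 0))%:C * w +
                          (expR (Num.min s 0))%:C * z t); last first.
  by rewrite rmorphB; ring.
apply: le_trans (cmodD _ _) _; rewrite (cmodM _ w) (cmodM _ (z t)) !cmodR cmod_z.
rewrite !ger0_norm ?subr_ge0 ?(ltW e0)//.
by have := wr; nra.
Qed.

Let h (s t : R) : cplx R := f (ga s t).

Let ch1 s : continuous (fun t => h s t : cplx R).
Proof.
refine (ccomp (g := fun t => ga s t) _ (ga_le s)).
exact: ccD (@cccst _ _ w) (ccM (@cccst _ _ (expR (Num.min s 0))%:C) cm).
Qed.

Let chk s : continuous (fun t => h s t * ka t : cplx R).
Proof.
have H := ccM (@ch1 s) cka.
exact H.
Qed.

Let ch2 t : continuous (fun s => h s t : cplx R).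
Proof.
refine (ccomp (g := fun s => ga s t) _ (fun s => ga_le s t)).
have ce : continuous (fun s : R => (expR (Num.min s 0))%:C : cplx R).
  apply: continuous_RC => x.
  apply: (@continuous_comp _ _ _ (fun s : R => Num.min s 0) (@expR R)); last exact: continuous_expR.
  by apply: continuous_min; [exact: cvg_id|exact: cvg_cst].
exact: ccD (@cccst _ _ w) (ccM ce (@cccst _ _ (m t))).
Qed.

(* Integral over the boundary of [a, b] x [c, d] of the pull-back by [ga] of
   [f z / (z - w) dz], which is [h ds + h * ka dt] for [s <= 0]. *)
Let F (a b c d : R) : R[i] := cint (fun t => h b t * ka t) c d
  - cint (fun t => h a t * ka t) c d - cint (fun s => h s d) a b + cint (fun s => h s c) a b.

(** Replacing [f] by its first-order approximation makes the form exact, with explicit primitives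
    along all four sides. Only the approximation error contributes: it is of order [e1 * D] on sides
    of length at most [D]. *)
Let F_local (p q a b c d : R) : a <= p <= b -> b <= 0 -> c <= q <= d ->
  forall e1 D k, 0 <= e1 -> (b - a) + (d - c) = D ->
  (forall v, cmod v <= 2 * r * D ->
     cmod (f (ga p q + v) - f (ga p q) - k * v) <= e1 * cmod v) ->
  cmod (F a b c d) <= 8 * r * e1 * (Mk + 1) * D ^+ 2.
Proof.
move=> /andP[ap pb] b0 /andP[cq qd] e1 D k e10 DE hk.
have ab : a <= b by lra. have cd : c <= d by lra.
have [K dK EK] := cint_prim cka.
(* Recentred at [w], the linear approximation of [f] at [ga p q] reads [c0 + k * (ga s t - w)], and
   [ga s t - w] is [expR s * m t] for [s <= 0]. *)
pose c0 := f (ga p q) - k * ga p q + k * w.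
have minE s : s <= b -> Num.min s 0 = s.
  by move=> sb; apply: min_l; lra.
have gaD s t : a <= s <= b -> c <= t <= d -> cmod (ga s t - ga p q) <= 2 * r * D.
  move=> /andP[as_ sb] /andP[ct td]; rewrite /ga !minE//.
  rewrite (_ : _ - _ = (expR s - expR p)%:C * m t + (expR p)%:C * (m t - m q)); last first.
    by rewrite rmorphB; ring.
  have mq : cmod (m t - m q) <= 2 * r * (d - c).
    have aux x y : c <= x -> x <= y -> y <= d -> cmod (m y - m x) <= 2 * r * (d - c).
      move=> cx xy yd; apply: le_trans (_ : 2 * r * (y - x) <= _).
        apply: (@rderiv_bound _ m (fun t => z t * 'i)) => // u _.
        by rewrite cmodM cmod_z cmod_i mulr1.
      by rewrite ler_pM2l ?mulr_gt0//; lra.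
    have [tq|/ltW qt] := leP t q; first by rewrite cmodBC; apply: aux; lra.
    by apply: aux; lra.
  have es : `|expR s - expR p| <= b - a.
    have aux x y : a <= x -> x <= y -> y <= b -> `|expR y - expR x| <= b - a.
      move=> ax xy yb; rewrite ger0_norm ?subr_ge0 ?ler_expR//.
      have := expR_ge1Dx (x - y); have ey : expR y <= 1 by rewrite -expR0 ler_expR; lra.
      have -> : expR x = expR (x - y) * expR y by rewrite -expRD subrK.
      by have := expR_gt0 y; nra.
    have [sp|/ltW ps] := leP s p; first by rewrite distrC; apply: aux; lra.
    by apply: aux; lra.
  apply: le_trans (cmodD _ _) _; rewrite (cmodM _ (m t)) (cmodM _ (m t - m q)) !cmodR -DE mulrDr; apply: lerD.
    rewrite mulrC; apply: ler_pM => //; exact: cmod_ge0.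
  rewrite ger0_norm ?expR_ge0//; apply: le_trans mq.
  by rewrite ler_piMl ?cmod_ge0// -expR0 ler_expR; lra.
have D0 : 0 <= D by lra.
have hE s t : a <= s <= b -> c <= t <= d ->
    cmod (h s t - (c0 + k * (expR s)%:C * m t)) <= e1 * (2 * r * D).
  move=> sab tcd; have := hk _ (gaD _ _ sab tcd).
  have -> : ga p q + (ga s t - ga p q) = ga s t by ring.
  move=> hh.
  apply: le_trans (_ : e1 * cmod (ga s t - ga p q) <= _); last first.
    by rewrite ler_wpM2l// gaD.
  apply: le_trans hh; rewrite le_eqVlt; apply/orP; left; apply/eqP; congr cmod.
  have gE : ga s t = w + (expR s)%:C * m t by rewrite /ga minE//; case/andP: sab.
  rewrite /h /c0 [in k * (ga s t - _)]gE.
  by ring.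
have E1 s : a <= s <= b -> cmod (cint (fun t => h s t * ka t) c d -
     ((c0 * K d + (k * (expR s)%:C * m d + 0)) - (c0 * K c + (k * (expR s)%:C * m c + 0))))
     <= 2 * (e1 * (2 * r * D) * Mk) * (d - c).
  move=> sab.
  apply: (@cint_approx _ _ (fun t => c0 * K t + (k * (expR s)%:C * m t + 0))
     (fun t => c0 * ka t + (k * (expR s)%:C * (z t * 'i) + 0)) c d _ cd (@chk s)).
    by move=> t; apply: rderiv_lin => //; apply: rderiv_lin => //; exact: rderiv_cst.
  move=> t tcd.
  have -> : z t * 'i = m t * ka t.
    by rewrite /ka; have := m0 t; move: (m t) (z t) => M Z M0; field.
  rewrite addr0 (_ : _ - _ = (h s t - (c0 + k * (expR s)%:C * m t)) * ka t); last by ring.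
  rewrite cmodM; apply: ler_pM => //; [exact: cmod_ge0|exact: cmod_ge0|exact: hE].
have E2 t : c <= t <= d -> cmod (cint (fun s => h s t) a b -
     ((c0 * b%:C + (k * m t * (expR b)%:C + 0)) - (c0 * a%:C + (k * m t * (expR a)%:C + 0))))
     <= 2 * (e1 * (2 * r * D)) * (b - a).
  move=> tcd.
  apply: (@cint_approx _ _ (fun s => c0 * s%:C + (k * m t * (expR s)%:C + 0))
     (fun s => c0 * 1 + (k * m t * (expR s)%:C + 0)) a b _ ab (@ch2 t)).
    move=> s; apply: rderiv_lin; first exact: rderiv_id.
    by apply: rderiv_lin; [exact: rderiv_exp|exact: rderiv_cst].
  move=> s sab; rewrite mulr1 addr0 (_ : k * m t * _ = k * (expR s)%:C * m t); last by ring.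
  exact: hE.
have aa : a <= a <= b by rewrite lexx.
have bb : a <= b <= b by rewrite lexx ab.
have cc : c <= c <= d by rewrite lexx.
have dd : c <= d <= d by rewrite lexx cd.
have := E1 _ aa; have := E1 _ bb; have := E2 _ cc; have := E2 _ dd.
set X1 := cint _ _ _ - _; set X2 := cint _ _ _ - _.
set X3 := cint _ _ _ - _; set X4 := cint _ _ _ - _ => h1 h2 h3 h4.
(* The increments of the explicit primitives cancel around the boundary. *)
have -> : F a b c d = X3 - X4 - X1 + X2.
  by rewrite /F /X1 /X2 /X3 /X4; ring.
apply: le_trans (cmodD _ _) _.
have := cmodB (X3 - X4) X1; have := cmodB X3 X4.
have P0 : 0 <= e1 * (2 * r * D) by rewrite !mulr_ge0// ltW.
set P := e1 * (2 * r * D) in h1 h2 h3 h4 P0.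
have -> : 8 * r * e1 * (Mk + 1) * D ^+ 2 = 4 * P * ((Mk + 1) * D) by rewrite /P; ring.
have PM : 0 <= P * Mk by rewrite mulr_ge0// ltW.
have : P * Mk * (d - c) + P * (b - a) <= P * ((Mk + 1) * D).
  have -> : P * ((Mk + 1) * D) = P * Mk * D + P * D by ring.
  apply: lerD; rewrite ler_wpM2l//; lra.
lra.
Qed.

(** The sides [t = 0] and [t = 2 * pi] have the same image, so their contributions to the vanishing
    boundary integral cancel and the two circles remain. *)
Let circle_shrink (a : R) : a <= 0 ->
  cint (fun t => h 0 t * ka t) 0 (2 * pi) = cint (fun t => h a t * ka t) 0 (2 * pi).
Proof.
move=> a0.
have pi2 : 0 <= 2 * pi :> R by rewrite mulr_ge0 ?pi_ge0.
have F0 : F a 0 0 (2 * pi) = 0.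
  have F1 x y1 y z' t : F x y z' t = F x y1 z' t + F y1 y z' t.
    rewrite /F (cint_chasles (fun s => h s t) x y1 y) (cint_chasles (fun s => h s z') x y1 y).
    by move: (cint _ _ _) (cint _ _ _) (cint _ _ _) (cint _ _ _) (cint _ _ _)
      (cint _ _ _) (cint _ _ _) => *; ring.
  have F2 x y z' y1 t : F x y z' t = F x y z' y1 + F x y y1 t.
    rewrite /F (cint_chasles (fun t => h x t * ka t) z' y1 t).
    rewrite (cint_chasles (fun t => h y t * ka t) z' y1 t).
    by move: (cint _ _ _) (cint _ _ _) (cint _ _ _) (cint _ _ _) (cint _ _ _)
      (cint _ _ _) (cint _ _ _) => *; ring.
  apply: (rect_vanish F1 F2 a0 pi2).
  move=> p q /andP[ap p0] /andP[q0 qpi] e e0.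
  have K0 : 0 < 8 * r * (Mk + 1) by rewrite !mulr_gt0// ltr_wpDl// ltW.
  have [d0 /is_deriveC dd] : exists d, is_derive (ga p q : cplx R) 1 (f : cplx R -> cplx R) d.
    exists ('D_1 (f : cplx R -> cplx R) (ga p q)); exact: derivableP (df (ga_le p q)).
  have [rr rr0 hr] := dd _ (divr_gt0 e0 K0).
  exists (rr / (8 * r)); first by rewrite divr_gt0 ?mulr_gt0.
  move=> a' b' c' d' /andP[aa' a'p] /andP[pb' b'0] /andP[cc' c'q] /andP[qd' d'd] ba dc.
  have := @F_local p q a' b' c' d'; rewrite a'p pb' c'q qd' b'0 => /(_ erefl erefl erefl).
  move=> /(_ (e / (8 * r * (Mk + 1))) _ d0 (ltW (divr_gt0 e0 K0)) erefl) H.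
  have {}H := H _; apply: le_trans (H _) _; last first.
    rewrite le_eqVlt; apply/orP; left; apply/eqP; congr (_ * _).
    by rewrite mulrAC mulrC divfK ?gt_eqF.
  move=> v hv; apply: hr; apply: le_lt_trans hv _.
  have : b' - a' + (d' - c') < rr / (8 * r) *+ 2 by rewrite mulr2n ltrD.
  have -> : rr / (8 * r) *+ 2 = rr / (4 * r) by rewrite -mulr_natr; field; rewrite gt_eqF.
  rewrite ltr_pdivlMr ?mulr_gt0// => hh.
  have D0 : 0 <= b' - a' + (d' - c') by lra.
  have := mulr_ge0 (ltW r0) D0; move: (_ + (d' - c')) hh => D; nra.
have hz s : h s (2 * pi) = h s 0 by rewrite /h /ga /m /z cis2pi cis0.
by move: F0; rewrite /F (_ : (fun s => h s (2 * pi)) = (fun s => h s 0)); [move/eqP; rewrite subrK subr_eq0 => /eqP|apply/funext].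
Qed.

(** On a small circle around [w] the values of [f] are close to [f w] by continuity, while [ka]
    stays the same. The integral of [ka] is left unevaluated here; [cint_ckernel] computes it. *)
Lemma cauchy_kernel :
  cint (fun t => f (z t) * ka t) 0 (2 * pi) = f w * cint ka 0 (2 * pi).
Proof.
have pi2 : 0 <= 2 * pi :> R by rewrite mulr_ge0 ?pi_ge0.
have -> : (fun t => f (z t) * ka t) = (fun t => h 0 t * ka t).
  apply/funext => t; rewrite /h /ga minxx expR0 /m mul1r.
  by rewrite (_ : w + (z t - w) = z t)//; ring.
apply/eqP; rewrite -subr_eq0 -cmod_eq0 eq_le cmod_ge0 andbT.
apply/ler_addgt0Pl => e e0; rewrite addr0.
have K0 : 0 < 2 * Mk * (2 * pi + 1) by rewrite mulr_gt0 ?ltr_wpDl// mulr_gt0.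
have e10 := divr_gt0 e0 K0.
have /cvgC_cmod/(_ _ e10)/(nbhs_cmod w)[rr rr0 hr] :
  (f : cplx R -> cplx R) @ (w : cplx R) --> (f w : cplx R).
  exact: derivableC_continuous (df (ltW wr)).
(* Since [cmod (m t) <= 2 * r], this puts the contracted circle within [rr / 2] of [w]. *)
pose a := Num.min 0 (ln (rr / (4 * r))).
have a0 : a <= 0 by rewrite ge_min lexx.
have ea : expR a <= rr / (4 * r).
  by rewrite -[leRHS]lnK ?posrE ?divr_gt0 ?mulr_gt0// ler_expR ge_min lexx orbT.
rewrite (circle_shrink a0).
have [K dK ->] := cint_prim cka; rewrite mulrBr.
have dfK t : rderiv (fun s => f w * K s + 0) t (f w * ka t + 0).
  by apply: rderiv_lin => //; exact: rderiv_cst.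
have := cint_approx (M := e / (2 * Mk * (2 * pi + 1)) * Mk) pi2 (@chk a) dfK.
rewrite !addr0 => /(_ _)/le_trans; apply; last first.
  rewrite (_ : 2 * _ * _ = e / (2 * Mk * (2 * pi + 1)) * (2 * Mk * (2 * pi))); last by ring.
  rewrite -mulrA ler_piMr ?(ltW e0)// ler_pdivrMl// mulr1.
  by apply: ler_wpM2l; [apply: mulr_ge0 => //; exact: ltW|rewrite lerDl].
move=> t _; rewrite addr0 -mulrBl cmodM; apply: ler_pM => //; try exact: cmod_ge0.
rewrite cmodBC ltW//; apply: hr.
rewrite /ga min_l// [w + _]addrC addrK cmodM cmodR ger0_norm ?expR_ge0//.
apply: le_lt_trans (_ : rr / (4 * r) * (2 * r) < _).
  by apply: ler_pM; rewrite ?expR_ge0 ?cmod_ge0.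
rewrite (_ : _ * _ = rr / 2); last by field; rewrite gt_eqF.
by rewrite ltr_pdivrMr// ltr_pMr// ltr1n.
Qed.

End CauchyFormula.

(** * Taylor expansion of holomorphic functions *)

Section Taylor.
Variable R : realType.

Lemma geo_small (q e : R) : 0 <= q < 1 -> 0 < e -> exists N, q ^+ N < e.
Proof.
move=> /andP[q0 q1] e0.
have /cvgrPdist_lt/(_ e e0)[N _ hN] : (GRing.exp q) @ \oo --> (0 : R).
  by apply: cvg_expr; rewrite ger0_norm.
exists N; have := hN N (leqnn N); rewrite sub0r normrN ger0_norm ?exprn_ge0//.
Qed.

Lemma geo_le0 (q C x : R) : 0 <= q < 1 -> (forall N, x <= C * q ^+ N) -> x <= 0.
Proof.
move=> q01 h; apply/ler_addgt0Pl => e e0; rewrite addr0.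
have C1 : 0 < `|C| + 1 by rewrite ltr_wpDl.
have [N hN] := geo_small q01 (divr_gt0 e0 C1).
have q0 : 0 <= q by case/andP: q01.
apply: le_trans (h N) _; apply: (@le_trans _ _ ((`|C| + 1) * q ^+ N)).
  by rewrite ler_wpM2r ?exprn_ge0// (le_trans (ler_norm C))// lerDl.
by rewrite mulrC -ler_pdivlMr// ltW.
Qed.

Lemma continuous_cmodf (T : topologicalType) (g : T -> cplx R) : continuous g ->
  continuous (fun x => cmod (g x) : R).
Proof.
move=> cg x; apply/cvgrPdist_lt => e e0.
have /cvgC_cmod/(_ e e0) := cg x; apply: filterS => y; apply: le_lt_trans.
rewrite ler_norml; apply/andP; split.
  by have := cmodD (g y - g x) (g x); rewrite subrK cmodBC => h; lra.
by have := cmodD (g x - g y) (g y); rewrite subrK => h; lra.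
Qed.

Definition circ (r t : R) : cplx R := r%:C * cis t.

Lemma cmod_circ r t : 0 <= r -> cmod (circ r t) = r.
Proof. by move=> r0; rewrite /circ cmodM cmod_cis mulr1 cmodR ger0_norm. Qed.

Lemma continuous_circ r : continuous (circ r).
Proof. exact: ccM (@cccst _ _ r%:C) (@continuous_cis R). Qed.

Definition ckernel (r : R) (w : R[i]) (t : R) : cplx R := 'i * (circ r t / (circ r t - w)).

(** As [dt = dz / ('i * z)] on the circle, division by [2 * pi] gives Cauchy's integral for the
    [k]-th Taylor coefficient. *)
Definition cmoment (f : R[i] -> R[i]) (r : R) (k : nat) : R[i] :=
  cint (fun t => f (circ r t) * (circ r t)^-1 ^+ k) 0 (2 * pi).

Section Fixed.
Variables (r : R) (w : R[i]).
Hypothesis wr : cmod w < r.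

Let r0 : 0 < r. Proof. exact: le_lt_trans (cmod_ge0 w) wr. Qed.

Let z0 t : circ r t != 0. Proof. by rewrite -cmod_gt0 cmod_circ ?(ltW r0). Qed.

Let zw_ge t : r - cmod w <= cmod (circ r t - w).
Proof. by rewrite lerBlDr -[leLHS](cmod_circ t (ltW r0)) -[in leLHS](subrK w (circ r t)) cmodD. Qed.

Let zw0 t : circ r t - w != 0.
Proof. by rewrite -cmod_gt0 (lt_le_trans _ (zw_ge t))// subr_gt0. Qed.

Lemma continuous_ckernel : continuous (ckernel r w).
Proof.
have cd : continuous (fun t => circ r t - w : cplx R).
  exact: ccD (@continuous_circ r) (@cccst _ _ (- w)).
have cv : continuous (fun t => (circ r t - w)^-1 : cplx R).
  by move=> t; exact: continuousV (zw0 t) (cd t).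
exact: ccM (@cccst _ _ 'i) (ccM (@continuous_circ r) cv).
Qed.

Lemma continuous_circV k : continuous (fun t => (circ r t)^-1 ^+ k : cplx R).
Proof.
have cv : continuous (fun t => (circ r t)^-1 : cplx R).
  by move=> t; exact: continuousV (z0 t) (@continuous_circ r t).
elim: k => [|k IH]; first exact: cccst.
rewrite (_ : (fun t => _) = (fun t => (circ r t)^-1 * (circ r t)^-1 ^+ k)).
  exact: ccM cv IH.
by apply/funext => t; rewrite exprS.
Qed.

Lemma ckernel_le t : cmod (ckernel r w t) <= r / (r - cmod w).
Proof.
rewrite /ckernel cmodM cmod_i mul1r cmodM cmodV cmod_circ ?(ltW r0)// ler_pM2l//.
by rewrite lef_pV2 ?zw_ge// posrE ?subr_gt0// cmod_gt0.
Qed.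

(** What remains of the Cauchy integral after [N] terms of the geometric expansion of the kernel
    have been split off. *)
Let I (f : R[i] -> R[i]) N : R[i] :=
  cint (fun t => f (circ r t) * (w ^+ N * (circ r t)^-1 ^+ N) * ckernel r w t) 0 (2 * pi).

Let cI (f : R[i] -> R[i]) N : continuous (fun t => f (circ r t) : cplx R) ->
  continuous (fun t => f (circ r t) * (w ^+ N * (circ r t)^-1 ^+ N) * ckernel r w t : cplx R).
Proof.
move=> cf.
exact: ccM (ccM cf (ccM (@cccst _ _ (w ^+ N)) (@continuous_circV N))) continuous_ckernel.
Qed.

Let pi2 : 0 <= 2 * pi :> R. Proof. by rewrite mulr_ge0 ?pi_ge0. Qed.

(** Integrates [z / (z - w) = 1 + (w / z) * (z / (z - w))]. *)
Let IS (f : R[i] -> R[i]) N : continuous (fun t => f (circ r t) : cplx R) ->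
  I f N = 'i * w ^+ N * cmoment f r N + I f N.+1.
Proof.
move=> cf.
have cJ : continuous (fun t => f (circ r t) * (circ r t)^-1 ^+ N : cplx R).
  exact: ccM cf (@continuous_circV N).
rewrite /cmoment -(cint_lin ('i * w ^+ N) pi2 cJ (@cI f N.+1 cf)) /I.
congr cint; apply/funext => t; rewrite /ckernel !exprS.
have := z0 t; have := zw0 t; move: (circ r t) => z h1 h2.
move: (w ^+ N) (z^-1 ^+ N) (f z) => a b c.
by field; rewrite h1 h2.
Qed.

Let I_sum (f : R[i] -> R[i]) N : continuous (fun t => f (circ r t) : cplx R) ->
  I f 0 = \sum_(k < N) 'i%C * w ^+ k * cmoment f r k + I f N.
Proof.
move=> cf; elim: N => [|N IH]; first by rewrite big_ord0 add0r.
by rewrite big_ord_recr /= IH IS// addrA.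
Qed.

Let I_le (f : R[i] -> R[i]) M N : continuous (fun t => f (circ r t) : cplx R) ->
  0 <= M -> (forall t, 0 <= t <= 2 * pi -> cmod (f (circ r t)) <= M) ->
  cmod (I f N) <= 4 * pi * M * (r / (r - cmod w)) * (cmod w / r) ^+ N.
Proof.
move=> cf M0 hM.
apply: (@le_trans _ _ (2 * (M * (cmod w / r) ^+ N * (r / (r - cmod w))) * (2 * pi - 0))).
  apply: (cint_le pi2 (@cI f N cf)) => t ht.
  rewrite cmodM; apply: ler_pM; rewrite ?cmod_ge0//; last exact: ckernel_le.
  rewrite cmodM; apply: ler_pM; rewrite ?cmod_ge0//; first exact: hM.
  by rewrite cmodM !cmodX cmodV cmod_circ ?(ltW r0)// -exprMn.
rewrite subr0 le_eqVlt; apply/orP; left; apply/eqP.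
by move: (_ ^+ N) (r / _) => *; ring.
Qed.

Let q01 : 0 <= cmod w / r < 1.
Proof. by rewrite divr_ge0 ?cmod_ge0 ?(ltW r0)//= ltr_pdivrMr// mul1r. Qed.

Let moment1 k : cmoment (fun=> 1) r k = (2 * pi * (k == 0)%:R)%:C.
Proof.
rewrite /cmoment; case: k => [|k].
  rewrite (@cint_eq _ _ (fun t => t%:C) _ _ pi2) ?subr0 ?mulr1//.
    by under eq_fun do rewrite expr0 mulr1; exact: cccst.
  by move=> t; rewrite expr0 mulr1; exact: rderiv_id.
(* Normalises [cis (- k.+1%:R * t)] into a primitive of the integrand; being [2 * pi]-periodic, it
   has increment 0. *)
pose c : R[i] := - (r%:C^-1 ^+ k.+1) / (k.+1%:R * 'i).
have k0 : (k.+1%:R : R[i]) != 0 by rewrite pnatr_eq0.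
have i0 : ('i : R[i]) != 0 by rewrite -cmod_gt0 cmod_i.
have H (t : R) : (1 : R[i]) * (circ r t)^-1 ^+ k.+1 =
    c * ((- k.+1%:R)%:C * 'i * cis (- k.+1%:R * t)) + 0.
  rewrite /c mul1r addr0 /circ invfM exprMn mulNr cisN cisX -exprVn rmorphN rmorph_nat.
  have aux (x y K I0 : R[i]) : K != 0 -> I0 != 0 ->
      x * y = - x / (K * I0) * (- K * I0 * y).
    move=> K0 I00; rewrite !mulNr mulrN opprK -[RHS]mulrA mulKf//.
    exact: mulf_neq0.
  exact: aux.
rewrite (_ : (fun t => _) = fun t => c * ((- k.+1%:R)%:C * 'i * cis (- k.+1%:R * t)) + 0).
  have cc : continuous (fun t : R => c * ((- k.+1%:R)%:C * 'i * cis (- k.+1%:R * t)) + 0 : cplx R).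
    rewrite (_ : (fun t : R => _) = fun t => 1 * (circ r t)^-1 ^+ k.+1 : cplx R).
      exact: ccM (@cccst _ _ 1) (@continuous_circV k.+1).
    by apply/funext => t; rewrite H.
  rewrite (@cint_eq _ _ (fun t => c * cis (- k.+1%:R * t) + 0) _ _ pi2 cc).
    rewrite mulr0 cis0 mulNr cisN cisX cis2pi expr1n invr1 subrr.
    by rewrite mulr0.
  by move=> t; apply: rderiv_lin; [exact: rderiv_cis|exact: rderiv_cst].
by apply/funext => t; rewrite -H.
Qed.

(** Expanding the kernel with [f = 1], only the moment of order 0 survives, and the remainder tends
    to 0 geometrically. *)
Lemma cint_ckernel : cint (ckernel r w) 0 (2 * pi) = 'i * (2 * pi)%:C.
Proof.
have cf1 : continuous (fun t => (fun=> 1) (circ r t) : cplx R) by exact: cccst.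
have E N : cint (ckernel r w) 0 (2 * pi) - 'i * (2 * pi)%:C = I (fun=> 1) N.+1.
  rewrite (_ : cint _ _ _ = I (fun=> 1) 0); last first.
    by congr cint; apply/funext => t; rewrite !expr0 !mul1r.
  rewrite (I_sum N.+1 cf1) big_ord_recl /= big1 => [|k _].
    by rewrite moment1 expr0 !mulr1 addr0 addrC addKr.
  by rewrite moment1 /= mulr0 mulr0.
apply/eqP; rewrite -subr_eq0 -cmod_eq0 eq_le cmod_ge0 andbT.
pose C := 4 * pi * 1 * (r / (r - cmod w)).
apply: (@geo_le0 _ C _ q01) => N; rewrite (E N).
apply: le_trans (I_le N.+1 cf1 ler01 _) _; first by move=> t _; rewrite cmod1.
rewrite -/C; apply: ler_wpM2l.
  rewrite /C mulr1; apply: mulr_ge0; first by rewrite mulr_ge0 ?pi_ge0.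
  by rewrite divr_ge0 ?subr_ge0 ?(ltW r0) ?(ltW wr).
by case/andP: q01 => h0 h1; rewrite exprS ler_piMl ?exprn_ge0// ltW.
Qed.

Lemma taylor_remainder (f : R[i] -> R[i]) M N :
  (forall z, cmod z <= r -> derivable (f : cplx R -> cplx R) z 1) -> 0 <= M ->
  (forall t, 0 <= t <= 2 * pi -> cmod (f (circ r t)) <= M) ->
  cmod (f w - \sum_(k < N) cmoment f r k / (2 * pi)%:C * w ^+ k) <=
  2 * M * (r / (r - cmod w)) * (cmod w / r) ^+ N.
Proof.
move=> df M0 hM.
have cf : continuous (fun t => f (circ r t) : cplx R).
  move=> t; apply: (@continuous_comp _ _ _ (circ r) (f : cplx R -> cplx R)).
    exact: continuous_circ.
  by apply: derivableC_continuous; apply: df; rewrite cmod_circ ?(ltW r0).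
have K : I f 0 = f w * ('i * (2 * pi)%:C).
  rewrite -cint_ckernel -(cauchy_kernel wr df); congr cint; apply/funext => t.
  by rewrite !expr0 mul1r mulr1.
have i0 : ('i : R[i]) != 0 by rewrite -cmod_gt0 cmod_i.
have p0 : (2 * pi)%:C != 0 :> R[i].
  by rewrite -cmod_gt0 cmodR ger0_norm// mulr_gt0 ?pi_gt0.
have E : f w - \sum_(k < N) cmoment f r k / (2 * pi)%:C * w ^+ k = I f N / ('i * (2 * pi)%:C).
  apply: (mulIf (mulf_neq0 i0 p0)); rewrite divfK ?mulf_neq0// mulrBl -K (I_sum N cf).
  rewrite mulr_suml addrC addrA (_ : - _ + _ = 0) ?add0r//.
  rewrite addrC -sumrB big1// => k _.
  by move: (w ^+ k) (cmoment _ _ _) ((2 * pi)%:C) p0 ('i%C : R[i]) => x y P P0 J; field.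
rewrite E cmodM cmodV cmodM cmod_i mul1r cmodR ger0_norm//.
have pp : 0 < 2 * pi :> R by rewrite mulr_gt0 ?pi_gt0.
rewrite ler_pdivrMr//; apply: le_trans (I_le N cf M0 hM) _.
rewrite le_eqVlt; apply/orP; left; apply/eqP.
by move: (_ ^+ N) (r / _) => *; ring.
Qed.

End Fixed.

(** One constant [C] for all [N] and [w]. For fixed [w] with [cmod w < r], large [N] gives
    convergence of the series at a geometric rate; for fixed [N], small [w] gives an asymptotic
    expansion at 0. *)
Definition exp1 (a : nat -> R[i]) (r : R) (f : R[i] -> R[i]) :=
  exists C : R, forall N w, cmod w <= r ->
    cmod (f w - \sum_(k < N) a k * w ^+ k) * r ^+ N <= C * cmod w ^+ N.

(** Restricting [w] to the smaller disc keeps the factor [1 / (r - cmod w)] of the remainder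
    bounded; the maximum of [cmod f] on the circle exists by compactness. *)
Lemma taylor_circle (f : R[i] -> R[i]) (s r : R) : 0 < s < r ->
  (forall z, cmod z <= r -> derivable (f : cplx R -> cplx R) z 1) ->
  exp1 (fun k => cmoment f r k / (2 * pi)%:C) s f.
Proof.
move=> /andP[s0 sr] df; have r0 : 0 < r by exact: lt_trans sr.
have pi2 : 0 <= 2 * pi :> R by rewrite mulr_ge0 ?pi_ge0.
have cf : continuous (fun t => f (circ r t) : cplx R).
  move=> t; apply: (@continuous_comp _ _ _ (circ r) (f : cplx R -> cplx R)).
    exact: continuous_circ.
  by apply: derivableC_continuous; apply: df; rewrite cmod_circ ?(ltW r0).
have [c _ hc] := EVT_max pi2 (continuous_subspaceT (continuous_cmodf cf)).
pose M := cmod (f (circ r c)).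
exists (2 * M * (r / (r - s))) => N w ws.
have wr : cmod w < r by exact: le_lt_trans sr.
have hM t : 0 <= t <= 2 * pi -> cmod (f (circ r t)) <= M.
  by move=> ht; apply: hc; rewrite in_itv.
have := taylor_remainder wr N df (cmod_ge0 _) hM.
move=> /(ler_wpM2r (exprn_ge0 N (ltW s0)))/le_trans; apply.
rewrite -[leLHS]mulrA -exprMn; apply: ler_pM.
- apply: mulr_ge0; first by rewrite mulr_ge0 ?cmod_ge0.
  by rewrite divr_ge0 ?subr_ge0 ?(ltW r0) ?(ltW wr).
- by rewrite exprn_ge0// mulr_ge0 ?(ltW s0)// divr_ge0 ?cmod_ge0 ?(ltW r0).
- rewrite ler_wpM2l ?mulr_ge0 ?cmod_ge0// ler_pM2l// lef_pV2 ?posrE ?subr_gt0//.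
  by rewrite lerB.
rewrite lerXn2r ?nnegrE ?cmod_ge0//.
  by rewrite mulr_ge0 ?(ltW s0)// divr_ge0 ?cmod_ge0 ?(ltW r0).
rewrite mulrAC -mulrA ler_piMr ?cmod_ge0// ler_pdivrMr// mul1r ltW//.
Qed.

End Taylor.

(** * Asymptotic expansions and power series *)

Section PowerSeries.
Variable R : realType.
Implicit Types (a b c : nat -> R[i]) (f g : R[i] -> R[i]).

Definition asym a f := forall N, exists C d : R, 0 < d /\
  forall w, cmod w < d -> cmod (f w - \sum_(k < N) a k * w ^+ k) <= C * cmod w ^+ N.

Lemma exp1_asym a r f : 0 < r -> exp1 a r f -> asym a f.
Proof.
move=> r0 [C hC] N; exists (C / r ^+ N), r; split=> // w wr.
have rN : 0 < r ^+ N by rewrite exprn_gt0.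
by rewrite mulrAC ler_pdivlMr// hC// ltW.
Qed.

(** Once the lower coefficients agree, [(a N - b N) * x ^+ N] is of order [x ^+ N.+1]. Agreement on
    positive reals alone is enough, which allows comparison with solutions known only for real
    time. *)
Lemma asym_uniq a b f g (d : R) : 0 < d -> asym a f -> asym b g ->
  (forall x : R, 0 < x < d -> f x%:C = g x%:C) -> a =1 b.
Proof.
move=> d0 ha hb fg N; elim/ltn_ind: N => N IH.
have [Ca [da [da0 hda]]] := ha N.+1; have [Cb [db [db0 hdb]]] := hb N.+1.
apply/eqP; rewrite -subr_eq0 -cmod_eq0 eq_le cmod_ge0 andbT.
apply/ler_addgt0Pl => e e0; rewrite addr0.
pose K := `|Ca| + `|Cb| + 1.
have K0 : 0 < K by rewrite ltr_wpDl// addr_ge0.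
pose x := Num.min (Num.min da db) (Num.min d (e / K)) / 2.
have m0 : 0 < Num.min (Num.min da db) (Num.min d (e / K)).
  by rewrite !lt_min da0 db0 d0 divr_gt0.
have x0 : 0 < x by rewrite divr_gt0.
have : x < Num.min (Num.min da db) (Num.min d (e / K)).
  by rewrite /x ltr_pdivrMr// ltr_pMr// ltr1n.
rewrite !lt_min => /andP[/andP[xa xb] /andP[xd xe]].
have cx : cmod x%:C = x by rewrite cmodR gtr0_norm.
have := hda x%:C; have := hdb x%:C; rewrite cx => /(_ xb) h1 /(_ xa) h2.
have E : (a N - b N) * x%:C ^+ N = (g x%:C - \sum_(k < N.+1) b k * x%:C ^+ k)
     - (f x%:C - \sum_(k < N.+1) a k * x%:C ^+ k).
  rewrite fg ?x0// !big_ord_recr /=.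
  have -> : \sum_(k < N) a k * x%:C ^+ k = \sum_(k < N) b k * x%:C ^+ k.
    by apply: eq_bigr => k _; rewrite IH.
  by move: (\sum_(_ < N) _) => S; ring.
have xN : 0 < x ^+ N by rewrite exprn_gt0.
rewrite -(ler_pM2r xN) -[in leLHS]cx -cmodX -cmodM E.
apply: le_trans (cmodB _ _) _; apply: le_trans (lerD h1 h2) _.
rewrite -mulrDl exprS mulrA ler_pM2r//.
apply: (@le_trans _ _ (K * x)).
  by rewrite ler_pM2r// /K; have := ler_norm Ca; have := ler_norm Cb; lra.
by rewrite mulrC -ler_pdivlMr// ltW.
Qed.

Lemma horner_sum (p : {poly R[i]}) w N : (size p <= N)%N ->
  p.[w] = \sum_(k < N) p`_k * w ^+ k.
Proof. exact: horner_coef_wide. Qed.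

Definition conv a b k := \sum_(j < k.+1) a j * b (k - j)%N.

(** With [p] and [q] the truncations, the error is [(f - p) * g + p * (g - q)] plus the part of
    [p * q] of degree at least [N]; [D] bounds this last part. *)
Lemma asymM a b f g : asym a f -> asym b g -> asym (conv a b) (fun w => f w * g w).
Proof.
move=> ha hb N; have [Ca [da [da0 hda]]] := ha N; have [Cb [db [db0 hdb]]] := hb N.
pose p := \poly_(k < N) a k; pose q := \poly_(k < N) b k.
have pE w : \sum_(k < N) a k * w ^+ k = p.[w] by rewrite horner_poly.
have qE w : \sum_(k < N) b k * w ^+ k = q.[w] by rewrite horner_poly.
pose A := \sum_(k < N) cmod (a k); pose B := \sum_(k < N) cmod (b k).
have bd (e : nat -> R[i]) w : cmod w <= 1 ->
    cmod (\sum_(k < N) e k * w ^+ k) <= \sum_(k < N) cmod (e k).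
  move=> w1; apply: le_trans (cmod_sum _ _ _) _; apply: ler_sum => k _.
  by rewrite cmodM cmodX ler_piMr ?cmod_ge0// exprn_ile1 ?cmod_ge0.
pose D := \sum_(N <= k < N + N) cmod (p * q)`_k.
exists (`|Ca| * (B + `|Cb|) + A * `|Cb| + D), (Num.min 1 (Num.min da db)).
split; first by rewrite !lt_min ltr01 da0.
move=> w; rewrite !lt_min => /andP[/ltW w1 /andP[wa wb]].
have := hda w wa; have := hdb w wb; rewrite pE qE => hq hp.
have wN0 : 0 <= cmod w ^+ N by rewrite exprn_ge0 ?cmod_ge0.
have wN1 : cmod w ^+ N <= 1 by rewrite exprn_ile1 ?cmod_ge0.
have {}hp : cmod (f w - p.[w]) <= `|Ca| * cmod w ^+ N.
  by apply: le_trans hp _; rewrite ler_wpM2r// ler_norm.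
have {}hq : cmod (g w - q.[w]) <= `|Cb| * cmod w ^+ N.
  by apply: le_trans hq _; rewrite ler_wpM2r// ler_norm.
have pA : cmod p.[w] <= A by rewrite -pE bd.
have qB : cmod q.[w] <= B by rewrite -qE bd.
have gB : cmod (g w) <= B + `|Cb|.
  rewrite -[g w](subrK q.[w]) addrC; apply: le_trans (cmodD _ _) _.
  by rewrite lerD// (le_trans hq)// ler_piMr.
have E : p.[w] * q.[w] - \sum_(k < N) conv a b k * w ^+ k =
    \sum_(N <= k < N + N) (p * q)`_k * w ^+ k.
  rewrite -hornerM (@horner_sum _ _ (N + N)).
    rewrite -(big_mkord xpredT (fun k => (p * q)`_k * w ^+ k)).
    rewrite (big_cat_nat (leq0n N) (leq_addr N N)) /= big_mkord.
    rewrite (eq_bigr (fun k : 'I_N => conv a b k * w ^+ k)); last first.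
      move=> k _; congr (_ * _); rewrite coefM; apply: eq_bigr => j _.
      rewrite !coef_poly (leq_ltn_trans (leq_ord j) (ltn_ord k)).
      by rewrite (leq_ltn_trans (leq_subr _ _) (ltn_ord k)).
    by rewrite addrAC subrr add0r.
  apply: leq_trans (size_polyMleq _ _) _; apply: leq_trans (leq_pred _) _.
  by rewrite leq_add// size_poly.
have -> : f w * g w - \sum_(k < N) conv a b k * w ^+ k =
    (f w - p.[w]) * g w + p.[w] * (g w - q.[w])
    + \sum_(N <= k < N + N) (p * q)`_k * w ^+ k.
  by rewrite -E; ring.
apply: le_trans (cmodD _ _) _; rewrite [leRHS]mulrDl; apply: lerD.
  apply: le_trans (cmodD _ _) _; rewrite [leRHS]mulrDl !cmodM; apply: lerD.
    by rewrite mulrAC; apply: ler_pM; rewrite ?cmod_ge0.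
  by rewrite -mulrA; apply: ler_pM; rewrite ?cmod_ge0.
apply: le_trans (cmod_sum _ _ _) _; rewrite /D mulr_suml.
rewrite big_nat_cond [leRHS]big_nat_cond; apply: ler_sum => k /andP[/andP[Nk _] _].
by rewrite cmodM cmodX ler_wpM2l ?cmod_ge0// ler_wiXn2l ?cmod_ge0.
Qed.

Definition expands a (rho : R) f := forall r, 0 < r < rho -> exp1 a r f.

(** Radius of convergence at least [rho], in the form of Cauchy's estimates. *)
Definition bdd a (rho : R) := forall r, 0 < r < rho ->
  exists C : R, forall k, cmod (a k) * r ^+ k <= C.

Lemma expands_asym a rho f : 0 < rho -> expands a rho f -> asym a f.
Proof.
move=> r0 h; apply: (@exp1_asym _ (rho / 2)); first by rewrite divr_gt0.
by apply: h; rewrite divr_gt0//= ltr_pdivrMr// ltr_pMr// ltr1n.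
Qed.

(** Each [r] calls for its own circle and hence its own moments; uniqueness of asymptotic expansions
    shows that all circles yield the same coefficients. *)
Lemma taylor f rho : 0 < rho ->
  (forall z, cmod z < rho -> derivable (f : cplx R -> cplx R) z 1) ->
  exists a, expands a rho f.
Proof.
move=> rho0 df.
have ex r : 0 < r < rho -> exists a, exp1 a r f.
  move=> /andP[r0 rr]; exists (fun k => cmoment f ((r + rho) / 2) k / (2 * pi)%:C).
  apply: taylor_circle; first by apply/andP; split => //; lra.
  by move=> z hz; apply: df; apply: le_lt_trans hz _; lra.
have h2 : 0 < rho / 2 < rho by apply/andP; split; lra.
have [a ha] := ex _ h2; exists a => r hr; have [b hb] := ex _ hr.
have r0 : 0 < r by case/andP: hr.
have r20 : 0 < rho / 2 by case/andP: h2.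
suff -> : a = b by [].
by apply/funext; apply: (asym_uniq ltr01 (exp1_asym r20 ha) (exp1_asym r0 hb)).
Qed.

(** The [k]-th term at [r] is the difference of two consecutive remainders. *)
Lemma expands_bdd a rho f : expands a rho f -> bdd a rho.
Proof.
move=> h r hr; have r0 : 0 < r by case/andP: hr.
have [C hC] := h r hr; exists (2 * C) => k.
have cr : cmod r%:C = r by rewrite cmodR gtr0_norm.
have := hC k r%:C; have := hC k.+1 r%:C; rewrite cr lexx => /(_ erefl) h1 /(_ erefl) h2.
have rk : 0 < r ^+ k by rewrite exprn_gt0.
have rk1 : 0 < r ^+ k.+1 by rewrite exprn_gt0.
rewrite ler_pM2r// in h1; rewrite ler_pM2r// in h2.
rewrite -[r in r ^+ k]cr -cmodX -cmodM; move: h1; rewrite big_ord_recr /=.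
set S := \sum_(_ < k) _ in h2 *; set t := _ * _ => h1.
have -> : t = (f r%:C - S) - (f r%:C - (S + t)) by ring.
apply: le_trans (cmodB _ _) _; lra.
Qed.

(** The intervals of radius [e N] around the partial sums are nested, [e N] being the tail of the
    geometric majorant. This yields the limit together with its rate. *)
Lemma geo_sum_real (u : nat -> R) (C q : R) : 0 <= q < 1 ->
  (forall k, `|u k| <= C * q ^+ k) ->
  exists l : R, forall N, `|l - \sum_(k < N) u k| <= C / (1 - q) * q ^+ N.
Proof.
move=> /andP[q0 q1] hu; have q10 : 0 < 1 - q by rewrite subr_gt0.
have C0 : 0 <= C by have := hu 0%N; rewrite expr0 mulr1; apply: le_trans.
pose e N := C / (1 - q) * q ^+ N.
have eS N : e N = C * q ^+ N + e N.+1.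
  by rewrite /e exprS; field; rewrite gt_eqF.
have e0 N : 0 <= e N by rewrite mulr_ge0 ?exprn_ge0// divr_ge0// ltW.
have [l hl] : exists l, forall N, \sum_(k < N) u k - e N <= l <= \sum_(k < N) u k - e N + (e N + e N).
  apply: nested_point => [N|N|N]; last by rewrite addr_ge0.
    by rewrite big_ord_recr /= [e N]eS; have := hu N; rewrite ler_norml => /andP[]; lra.
  by rewrite big_ord_recr /= [e N]eS; have := hu N; rewrite ler_norml => /andP[]; lra.
exists l => N; rewrite ler_norml -/(e N); have := hl N; lra.
Qed.

Lemma geo_sum (u : nat -> R[i]) (C q : R) : 0 <= q < 1 ->
  (forall k, cmod (u k) <= C * q ^+ k) ->
  exists l : R[i], forall N, cmod (l - \sum_(k < N) u k) <= 2 * C / (1 - q) * q ^+ N.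
Proof.
move=> q01 hu.
have [l1 h1] := geo_sum_real q01 (fun k => le_trans (Re_le_cmod (u k)) (hu k)).
have [l2 h2] := geo_sum_real q01 (fun k => le_trans (Im_le_cmod (u k)) (hu k)).
exists (l1 +i* l2) => N; apply: le_trans (cmod_le _) _.
have ReS : complex.Re (\sum_(k < N) u k) = \sum_(k < N) complex.Re (u k).
  by elim/big_rec2: _ => // k x y _ <-; rewrite cReD.
have ImS : complex.Im (\sum_(k < N) u k) = \sum_(k < N) complex.Im (u k).
  by elim/big_rec2: _ => // k x y _ <-; rewrite cImD.
rewrite cReD cImD cReN cImN ReS ImS /=.
by have := h1 N; have := h2 N; lra.
Qed.

Lemma cvg_geo (u : nat -> R[i]) (l : R[i]) (C q : R) : 0 <= q < 1 ->
  (forall N, cmod (l - \sum_(k < N) u k) <= C * q ^+ N) ->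
  series (u : nat -> cplx R) @ \oo --> (l : cplx R).
Proof.
move=> q01 h; apply/cvgC_cmod => e e0.
have C1 : 0 < `|C| + 1 by rewrite ltr_wpDl.
have [N hN] := geo_small q01 (divr_gt0 e0 C1).
exists N => // n /= Nn; rewrite /series /= big_mkord.
apply: le_lt_trans (h n) _.
have /andP[q0 q1] := q01.
have qn : 0 <= q ^+ n by rewrite exprn_ge0.
apply: (@le_lt_trans _ _ ((`|C| + 1) * q ^+ N)); last first.
  by rewrite mulrC -ltr_pdivlMr.
apply: (@le_trans _ _ ((`|C| + 1) * q ^+ n)).
  by rewrite ler_wpM2r// (le_trans (ler_norm C))// lerDl.
by rewrite ler_wpM2l ?(ltW C1)// ler_wiXn2l ?(ltW q1).
Qed.

End PowerSeries.

(** * Sums of power series, termwise differentiation, derivative of the exponential *)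

Section PowerSeriesCalculus.
Variable R : realType.
Implicit Types (a b c : nat -> R[i]) (f g : R[i] -> R[i]).

Definition psum a (w : R[i]) : R[i] := lim (series (fun k => a k * w ^+ k : cplx R) @ \oo).

Lemma psum_unique a w (l : R[i]) :
  series (fun k => a k * w ^+ k : cplx R) @ \oo --> (l : cplx R) -> psum a w = l.
Proof. move=> h; exact (cvg_lim (@norm_hausdorff _ (cplx R)) h). Qed.

Lemma psum_expands a rho : bdd a rho -> expands a rho (psum a).
Proof.
move=> ha r /andP[r0 rr]; pose s := (r + rho) / 2.
have hs : 0 < s < rho by rewrite /s; apply/andP; split; lra.
have [C hC] := ha s hs.
have s0 : 0 < s by case/andP: hs.
have rs : r < s by rewrite /s; lra.
have C0 : 0 <= C by apply: le_trans (hC 0%N); rewrite mulr_ge0 ?cmod_ge0 ?expr0.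
exists (2 * C / (1 - r / s)) => N w wr; pose q := cmod w / s.
have qr : q <= r / s by rewrite /q ler_pM2r// invr_gt0.
have rs1 : r / s < 1 by rewrite ltr_pdivrMr// mul1r.
have q0 : 0 <= q by rewrite divr_ge0 ?cmod_ge0 ?(ltW s0).
have q01 : 0 <= q < 1 by rewrite q0 (le_lt_trans qr).
have hu k : cmod (a k * w ^+ k) <= C * q ^+ k.
  rewrite cmodM cmodX /q expr_div_n mulrA ler_pdivlMr ?exprn_gt0// mulrAC.
  by rewrite ler_wpM2r ?exprn_ge0 ?cmod_ge0.
have [l hl] := geo_sum q01 hu.
rewrite (psum_unique (cvg_geo q01 hl)).
apply: le_trans (ler_wpM2r (exprn_ge0 N (ltW r0)) (hl N)) _.
rewrite -[leLHS]mulrA; apply: ler_pM.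
- by rewrite divr_ge0 ?mulr_ge0// subr_ge0; case/andP: q01 => _ /ltW.
- by rewrite mulr_ge0 ?exprn_ge0 ?(ltW r0).
- rewrite ler_wpM2l ?mulr_ge0// lef_pV2 ?posrE ?subr_gt0//; first by rewrite lerB.
  by case/andP: q01.
have qr0 : 0 <= q * r := mulr_ge0 q0 (ltW r0).
rewrite -exprMn lerXn2r ?nnegrE ?cmod_ge0//.
by rewrite /q mulrAC -mulrA ler_piMr ?cmod_ge0// ltW.
Qed.

Lemma expands_cvg a rho f w : expands a rho f -> cmod w < rho ->
  series (fun k => a k * w ^+ k : cplx R) @ \oo --> (f w : cplx R).
Proof.
move=> ha wr; pose r := (cmod w + rho) / 2.
have w0 := cmod_ge0 w.
have hr : 0 < r < rho by rewrite /r; apply/andP; split; lra.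
have [C hC] := ha r hr; have r0 : 0 < r by case/andP: hr.
have wr' : cmod w < r by rewrite /r; lra.
apply: (@cvg_geo _ _ _ C (cmod w / r)).
  by rewrite divr_ge0 ?(ltW r0)//= ltr_pdivrMr// mul1r.
move=> N; rewrite expr_div_n mulrA ler_pdivlMr ?exprn_gt0//.
exact: hC (ltW wr').
Qed.

Lemma expands_psum a rho f w : expands a rho f -> cmod w < rho -> psum a w = f w.
Proof. by move=> h wr; apply: psum_unique; exact: expands_cvg h wr. Qed.

Lemma expands_ext a rho f g : expands a rho f ->
  (forall w, cmod w < rho -> f w = g w) -> expands a rho g.
Proof.
move=> h fg r hr; have [C hC] := h r hr; exists C => N w wr; rewrite -fg; first exact: hC.
by apply: le_lt_trans wr _; case/andP: hr.
Qed.

(** Trades a factor [k] for a slightly larger radius, so that differentiating a series does not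
    shrink its disc. *)
Lemma nat_geo (r s : R) (k : nat) : 0 < r < s -> k%:R * (s - r) * r ^+ k <= r * s ^+ k.
Proof.
move=> /andP[r0 rs]; have s0 : 0 < s by exact: lt_trans rs.
elim: k => [|k IH]; first by rewrite !mul0r mulr_ge0 ?exprn_ge0 ?ltW.
have rk : r ^+ k <= s ^+ k by rewrite lerXn2r ?nnegrE ?ltW.
have -> : k.+1%:R * (s - r) * r ^+ k.+1 =
    r * (k%:R * (s - r) * r ^+ k) + (s - r) * r * r ^+ k.
  by rewrite -natr1 exprS; ring.
have -> : r * s ^+ k.+1 = r * (r * s ^+ k) + (s - r) * r * s ^+ k.
  by rewrite exprS; ring.
apply: lerD; first by rewrite ler_pM2l.
by rewrite ler_wpM2l// mulr_ge0 ?subr_ge0 ?ltW.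
Qed.

Lemma bdd_nat a rho : bdd a rho -> bdd (fun k => k%:R * a k) rho.
Proof.
move=> ha r /andP[r0 rr]; pose s := (r + rho) / 2.
have hs : 0 < s < rho by rewrite /s; apply/andP; split; lra.
have rs : 0 < r < s by rewrite r0 /s; lra.
have [C hC] := ha s hs; exists (r / (s - r) * C) => k.
have sr0 : 0 < s - r by rewrite subr_gt0; case/andP: rs.
rewrite cmodM cmod_nat mulrAC [leRHS]mulrAC ler_pdivlMr//.
rewrite -[leLHS]mulrA [cmod _ * _]mulrC mulrA [_ * r ^+ k * _]mulrAC.
apply: le_trans (ler_wpM2r (cmod_ge0 (a k)) (nat_geo k rs)) _.
by rewrite -mulrA [_ * cmod _]mulrC ler_pM2l.
Qed.

Definition dcoef a k : R[i] := k.+1%:R * a k.+1.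

Lemma bdd_dcoef a rho : bdd a rho -> bdd (dcoef a) rho.
Proof.
move=> /bdd_nat ha r hr; have [C hC] := ha r hr; have r0 : 0 < r by case/andP: hr.
exists (C / r) => k; rewrite ler_pdivlMr// -mulrA -exprSr; exact: hC.
Qed.

Lemma geo_partial (q : R) N : 0 <= q < 1 -> \sum_(k < N) q ^+ k <= (1 - q)^-1.
Proof.
move=> /andP[q0 q1]; have h : 0 < 1 - q by rewrite subr_gt0.
rewrite -[leRHS]mul1r ler_pdivlMr// mulrC -opprB mulNr -subrX1 opprB lerBlDr lerDl.
exact: exprn_ge0.
Qed.

(** Induction through [E (k+1) = (w + h) * E k + k * w ^+ (k-1) * h ^+ 2] for the second-order error
    [E]. The factor [r ^+ 2] on the left avoids the exponent [k - 2]. *)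
Lemma pow_taylor2 (w h : R[i]) (r : R) k : cmod w <= r -> cmod (w + h) <= r ->
  r ^+ 2 * cmod ((w + h) ^+ k - w ^+ k - k%:R * w ^+ k.-1 * h) <=
  (k ^ 2)%:R * r ^+ k * cmod h ^+ 2.
Proof.
move=> wr whr; have r0 : 0 <= r := le_trans (cmod_ge0 w) wr.
elim: k => [|k IH].
  by rewrite !expr0 subrr !mul0r subr0 cmod0 mulr0.
have -> : (w + h) ^+ k.+1 - w ^+ k.+1 - k.+1%:R * w ^+ k.+1.-1 * h =
   (w + h) * ((w + h) ^+ k - w ^+ k - k%:R * w ^+ k.-1 * h) + k%:R * w ^+ k.-1 * h ^+ 2.
  rewrite -natr1 !exprS /=; case: k {IH} => [|k]; first by rewrite !expr0; ring.
  by rewrite -[k.+1.-1]/k (exprS w k); ring.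
apply: (@le_trans _ _ (r * (r ^+ 2 * cmod ((w + h) ^+ k - w ^+ k - k%:R * w ^+ k.-1 * h))
    + k%:R * r ^+ k.+1 * cmod h ^+ 2)).
  apply: le_trans (ler_wpM2l (exprn_ge0 2 r0) (cmodD _ _)) _; rewrite mulrDr; apply: lerD.
    by rewrite cmodM mulrCA ler_wpM2r// mulr_ge0 ?exprn_ge0 ?cmod_ge0.
  rewrite !cmodM !cmodX cmod_nat [leLHS]mulrA ler_wpM2r ?sqr_ge0//.
  case: k {IH} => [|k]; first by rewrite !mul0r mulr0.
  rewrite mulrCA ler_wpM2l//= -[k.+2]/(2 + k)%N exprD ler_wpM2l ?exprn_ge0//.
  by rewrite lerXn2r ?nnegrE ?cmod_ge0.
apply: (@le_trans _ _ (r * ((k ^ 2)%:R * r ^+ k * cmod h ^+ 2) + k%:R * r ^+ k.+1 * cmod h ^+ 2)).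
  by rewrite lerD2r ler_wpM2l.
have -> : r * ((k ^ 2)%:R * r ^+ k * cmod h ^+ 2) + k%:R * r ^+ k.+1 * cmod h ^+ 2 =
   (k ^ 2 + k)%:R * (r ^+ k.+1 * cmod h ^+ 2) by rewrite natrD (exprS r k); ring.
have p0 : 0 <= r ^+ k.+1 * cmod h ^+ 2 := mulr_ge0 (exprn_ge0 _ r0) (sqr_ge0 _).
rewrite -[leRHS]mulrA ler_wpM2r// ler_nat.
by rewrite !expnS !expn0; nia.
Qed.

Lemma expands_is_derive a rho f w : expands a rho f -> cmod w < rho ->
  is_derive (w : cplx R) 1 (f : cplx R -> cplx R) (psum (dcoef a) w).
Proof.
move=> ha wrho; have w0 := cmod_ge0 w.
pose r := (cmod w + rho) / 2; pose s := (r + rho) / 2.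
have wr : cmod w < r by rewrite /r; lra.
have rs : r < s by rewrite /s /r; lra.
have srho : s < rho by rewrite /s /r; lra.
have r0 : 0 < r by lra. have s0 : 0 < s by lra.
have q1 : r / s < 1 by rewrite ltr_pdivrMr// mul1r.
have q0 : 0 <= r / s by rewrite divr_ge0 ?ltW.
have q01 : 0 <= r / s < 1 by rewrite q0.
have hs : 0 < s < rho by rewrite s0.
have bda := expands_bdd ha.
have hd := psum_expands (bdd_dcoef bda).
have [C hC] := ha s hs; have [D hD] := hd s hs.
have [B hB] := bdd_nat (bdd_nat bda) hs.
have B0 : 0 <= B by apply: le_trans (hB 0%N); rewrite mulr_ge0 ?cmod_ge0 ?expr0.
have rem (g : R[i] -> R[i]) (e : nat -> R[i]) E :
    (forall N v, cmod v <= s -> cmod (g v - \sum_(k < N) e k * v ^+ k) * s ^+ N <= E * cmod v ^+ N) ->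
    forall N v, cmod v <= r -> cmod (g v - \sum_(k < N) e k * v ^+ k) <= `|E| * (r / s) ^+ N.
  move=> H N v vr; rewrite expr_div_n mulrA ler_pdivlMr ?exprn_gt0//.
  apply: le_trans (H N v (le_trans vr (ltW rs))) _.
  apply: (@le_trans _ _ (`|E| * cmod v ^+ N)).
    by rewrite ler_wpM2r ?exprn_ge0 ?cmod_ge0// ler_norm.
  by apply: ler_wpM2l => //; rewrite lerXn2r ?nnegrE ?cmod_ge0 ?(ltW r0).
(* [B] bounds [k ^ 2 * cmod (a k) * s ^+ k], so the second-order errors of the terms sum to at most
   a geometric series of ratio [r / s]. *)
pose K := B / (1 - r / s) / r ^+ 2.
have K0 : 0 <= K by rewrite !divr_ge0 ?exprn_ge0 ?subr_ge0 ?(ltW q1) ?(ltW r0).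
have key h : cmod (w + h) <= r ->
    cmod (f (w + h) - f w - psum (dcoef a) w * h) <= K * cmod h ^+ 2.
  move=> whr; rewrite -subr_le0.
  (* The quadratic bound is proved for truncations, up to errors of order [(r / s) ^+ N]. The series
     of [f] is cut at [N.+1] and the differentiated one at [N], because [dcoef] shifts the index. *)
  apply: (@geo_le0 _ (r / s) (`|C| + `|C| + `|D| * cmod h) _ q01) => N.
  have E1 : \sum_(k < N.+1) a k * ((w + h) ^+ k - w ^+ k - k%:R * w ^+ k.-1 * h) =
      \sum_(k < N.+1) a k * (w + h) ^+ k - \sum_(k < N.+1) a k * w ^+ k
      - (\sum_(k < N) dcoef a k * w ^+ k) * h.
    rewrite -sumrB mulr_suml -[in RHS](big_mkord xpredT (fun k => dcoef a k * w ^+ k * h)).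
    rewrite (_ : \sum_(0 <= k < N) _ = \sum_(k < N.+1) a k * (k%:R * w ^+ k.-1 * h)); last first.
      rewrite big_ord_recl /= !mul0r mulr0 add0r big_mkord; apply: eq_bigr => k _.
      by rewrite /dcoef /bump leq0n add1n add0n; ring.
    by rewrite -sumrB; apply: eq_bigr => k _; ring.
  have E2 : cmod (\sum_(k < N.+1) a k * ((w + h) ^+ k - w ^+ k - k%:R * w ^+ k.-1 * h)) <=
      K * cmod h ^+ 2.
    apply: le_trans (cmod_sum _ _ _) _.
    apply: (@le_trans _ _ (\sum_(k < N.+1) B / r ^+ 2 * cmod h ^+ 2 * (r / s) ^+ k)).
      apply: ler_sum => k _; rewrite cmodM.
      have r2 : 0 < r ^+ 2 by rewrite exprn_gt0.
      rewrite -(ler_pM2l r2) mulrCA.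
      apply: le_trans (ler_wpM2l (cmod_ge0 _) (pow_taylor2 _ (ltW wr) whr)) _.
      have sk : 0 < s ^+ k by rewrite exprn_gt0.
      have -> : r ^+ 2 * (B / r ^+ 2 * cmod h ^+ 2 * (r / s) ^+ k) =
         B / s ^+ k * (r ^+ k * cmod h ^+ 2).
        have n1 := lt0r_neq0 r2; have n2 := lt0r_neq0 sk.
        rewrite (expr_div_n r s k); move: (r ^+ 2) (s ^+ k) (r ^+ k) (cmod h ^+ 2) n1 n2 => P1 P2 P3 P4 n1 n2.
        by field; rewrite ?n1 ?n2.
      have p0 : 0 <= r ^+ k * cmod h ^+ 2 := mulr_ge0 (exprn_ge0 _ (ltW r0)) (sqr_ge0 _).
      have -> : cmod (a k) * ((k ^ 2)%:R * r ^+ k * cmod h ^+ 2) =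
          cmod (a k) * (k ^ 2)%:R * (r ^+ k * cmod h ^+ 2) by move: (r ^+ k) (cmod h ^+ 2) => *; ring.
      rewrite ler_wpM2r//.
      rewrite ler_pdivlMr//; apply: le_trans (hB k); rewrite !cmodM !cmod_nat mulrA -natrM.
      by rewrite -mulnn [cmod _ * _]mulrC.
    rewrite -mulr_sumr (_ : K * _ = B / r ^+ 2 * cmod h ^+ 2 * (1 - r / s)^-1); last first.
      by rewrite /K; move: (_ ^-1) (_ ^- 2) => *; ring.
    apply: ler_wpM2l; last exact: geo_partial.
    exact: mulr_ge0 (divr_ge0 B0 (sqr_ge0 _)) (sqr_ge0 _).
  have R1 := rem f a C hC N.+1 _ whr; have R2 := rem f a C hC N.+1 _ (ltW wr).
  have R3 := rem _ _ D hD N _ (ltW wr).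
  have qq : `|C| * (r / s) ^+ N.+1 <= `|C| * (r / s) ^+ N.
    by rewrite ler_wpM2l// exprS ler_piMl ?exprn_ge0// ltW.
  have -> : f (w + h) - f w - psum (dcoef a) w * h =
      (f (w + h) - \sum_(k < N.+1) a k * (w + h) ^+ k) - (f w - \sum_(k < N.+1) a k * w ^+ k)
      - (psum (dcoef a) w - \sum_(k < N) dcoef a k * w ^+ k) * h
      + \sum_(k < N.+1) a k * ((w + h) ^+ k - w ^+ k - k%:R * w ^+ k.-1 * h).
    by rewrite E1; ring.
  rewrite lerBlDr.
  apply: le_trans (cmodD _ _) _; apply: lerD => //.
  apply: le_trans (cmodB _ _) _; rewrite [leRHS]mulrDl; apply: lerD.
    apply: le_trans (cmodB _ _) _; rewrite [leRHS]mulrDl; apply: lerD.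
      exact: le_trans R1 qq.
    exact: le_trans R2 qq.
  by rewrite cmodM mulrAC ler_wpM2r ?cmod_ge0.
apply/is_deriveC => e e0.
have K1 : 0 < K + 1 by rewrite ltr_wpDl.
exists (Num.min (r - cmod w) (e / (K + 1))).
  by rewrite lt_min subr_gt0 wr divr_gt0.
move=> h; rewrite lt_min => /andP[h1 h2].
apply: le_trans (key h _) _.
  by apply: le_trans (cmodD _ _) _; lra.
rewrite expr2 mulrA ler_wpM2r ?cmod_ge0//.
rewrite ltr_pdivlMr// in h2; have := cmod_ge0 h; nra.
Qed.

Lemma expands_derivable a rho f w : expands a rho f -> cmod w < rho ->
  derivable (f : cplx R -> cplx R) w 1.
Proof. by move=> h hw; have [] := expands_is_derive h hw. Qed.

Lemma expands_dcoef a rho f g : expands a rho f ->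
  (forall w, cmod w < rho -> is_derive (w : cplx R) 1 (f : cplx R -> cplx R) (g w)) ->
  expands (dcoef a) rho g.
Proof.
move=> ha dg; apply: expands_ext (psum_expands (bdd_dcoef (expands_bdd ha))) _ => w hw.
by have [_ <-] := expands_is_derive ha hw; have [_ <-] := dg w hw.
Qed.

Lemma expands0 a rho f : 0 < rho -> expands a rho f -> f 0 = a 0%N.
Proof.
move=> r0 /(expands_asym r0)/(_ 1%N)[C [d [d0 h]]].
have := h 0; rewrite cmod0 => /(_ d0); rewrite expr1 mulr0 big_ord_recl big_ord0.
rewrite expr0 mulr1 addr0 => h1; apply/eqP; rewrite -subr_eq0 -cmod_eq0 eq_le h1.
exact: cmod_ge0.
Qed.

Lemma expands_cst (c : R[i]) rho : expands (fun k => if k is 0%N then c else 0) rho (fun=> c).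
Proof.
move=> r /andP[r0 _]; exists (cmod c) => N w wr; case: N => [|N].
  by rewrite big_ord0 subr0 !expr0.
rewrite big_ord_recl /= expr0 mulr1 big1 ?addr0 ?subrr ?cmod0 ?mul0r//.
  by rewrite mulr_ge0 ?cmod_ge0 ?exprn_ge0 ?cmod_ge0.
by move=> k _; rewrite mul0r.
Qed.

(** The differentiated series expands the zero function, so every coefficient of positive index
    vanishes. *)
Lemma holo_const f rho w : cmod w < rho ->
  (forall z, cmod z < rho -> is_derive (z : cplx R) 1 (f : cplx R -> cplx R) 0) -> f w = f 0.
Proof.
move=> wr df; have rho0 : 0 < rho := le_lt_trans (cmod_ge0 w) wr.
have [a ha] : exists a, expands a rho f.
  by apply: taylor => // z hz; have [] := df z hz.
have h0 := expands_dcoef ha df.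
have E := asym_uniq ltr01 (expands_asym rho0 h0) (expands_asym rho0 (@expands_cst 0 rho))
  (fun _ _ => erefl).
have a0 k : a k.+1 = 0.
  have : dcoef a k = 0 by rewrite E; case: k.
  by rewrite /dcoef => /eqP; rewrite mulf_eq0 pnatr_eq0 /= => /eqP.
rewrite (expands0 rho0 ha) -(expands_psum ha wr).
apply: (expands_psum (rho := rho) (f := fun=> a 0%N)) => //.
have := @expands_cst (a 0%N) rho; congr (expands _ _ _).
by apply/funext => -[|k] //; rewrite a0.
Qed.

Lemma is_derive_real (f : R -> R) (d e : R) : is_derive (0 : R) 1 f d -> 0 < e ->
  exists2 r, 0 < r & forall h, `|h| < r -> `|f h - f 0 - d * h| <= e * `|h|.
Proof.
move=> [df dfe] e0.
have : (fun h => h^-1 *: (f (h *: (1 : R) + 0) - f 0)) @ (0 : R)^' --> d.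
  by rewrite -dfe; exact: df.
move=> /cvgrPdist_lt/(_ e e0); rewrite /dnbhs /within /= => -[r /= r0 hr].
exists r => // h hh; have [->|h0] := eqVneq h 0.
  by rewrite subrr mulr0 subrr normr0 mulr0.
have := hr h; rewrite /ball_ /= sub0r normrN => /(_ hh h0) /ltW.
have hp : 0 < `|h| by rewrite normr_gt0.
rewrite -(ler_pM2r hp) -normrM; congr (_ <= _).
rewrite distrC; congr Num.norm; rewrite mulrBl; congr (_ - _).
by rewrite -[_ *: _]/(_ * _) -[h *: _]/(h * 1) mulr1 addr0 mulrC mulrA mulfV// mul1r.
Qed.

Lemma is_derive_cexp (z : cplx R) : is_derive z 1 (cexp (R := R) : cplx R -> cplx R) (cexp z).
Proof.
apply/is_deriveC => e0 e00.
have E0 : 0 < cmod (cexp z) + 1 by rewrite ltr_wpDl ?cmod_ge0.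
(* The 9 is [1 + 3 + 1 + 4], the constants of the four error terms in [main]. The addition formula
   reduces everything to the point 0. *)
have [e [e1 ele e9]] : exists e : R, [/\ 0 < e, e <= 1 & e <= e0 / (9 * (cmod (cexp z) + 1))].
  exists (Num.min 1 (e0 / (9 * (cmod (cexp z) + 1)))).
  by rewrite lt_min ltr01 divr_gt0 ?mulr_gt0// !ge_min !lexx orbT.
have dE : is_derive (0 : R) 1 (@expR R) 1 by have := is_derive_expR (0 : R); rewrite expR0.
have dS : is_derive (0 : R) 1 (@sin R) 1 by have := is_derive_sin (0 : R); rewrite cos0.
have dC : is_derive (0 : R) 1 (@cos R) 0 by have := is_derive_cos (0 : R); rewrite sin0 oppr0.
have [r1 r10 h1] := is_derive_real dE e1.
have [r2 r20 h2] := is_derive_real dS e1.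
have [r3 r30 h3] := is_derive_real dC e1.
exists (Num.min e (Num.min r1 (Num.min r2 r3))); first by rewrite !lt_min e1 r10 r20 r30.
move=> h; rewrite !lt_min => /andP[he /andP[hr1 /andP[hr2 hr3]]].
have ha := Re_le_cmod h; have hb := Im_le_cmod h.
set a := complex.Re h in ha; set b := complex.Im h in hb.
have := h1 a (le_lt_trans ha hr1); have := h2 b (le_lt_trans hb hr2).
have := h3 b (le_lt_trans hb hr3).
rewrite cos0 sin0 expR0 mul0r !mul1r !subr0 => kc ks kE.
have ae : `|a| < e := le_lt_trans ha he.
have be : `|b| < e := le_lt_trans hb he.
have H0 := cmod_ge0 h.
have ab0 : 0 <= `|a| /\ 0 <= `|b| by rewrite !normr_ge0.
have B1 : `|expR a - 1| <= 2 * `|a|.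
  rewrite -[_ - _](subrK a); apply: le_trans (ler_normD _ _) _; nra.
have B2 : `|expR a| <= 3.
  rewrite -[expR a](subrK 1); apply: le_trans (ler_normD _ _) _; rewrite normr1; lra.
have B3 : `|sin b| <= 2 * `|b|.
  rewrite -[sin b](subrK b); apply: le_trans (ler_normD _ _) _; nra.
have main : cmod (cexp h - 1 - h) <= 9 * e * cmod h.
  apply: le_trans (cmod_le _) _.
  rewrite !cReD !cImD !cReN !cImN /cexp cReM cImM /= -/a -/b !mul0r subr0 addr0 oppr0 addr0.
  rewrite (_ : _ * _ - 1 - a = (expR a - 1 - a) + expR a * (cos b - 1)); last by ring.
  rewrite (_ : _ * _ - b = (sin b - b) + (expR a - 1) * sin b); last by ring.
  have := ler_normD (expR a - 1 - a) (expR a * (cos b - 1)).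
  have := ler_normD (sin b - b) ((expR a - 1) * sin b).
  rewrite !normrM.
  have e0' := ltW e1.
  have m1 : `|expR a| * `|cos b - 1| <= 3 * (e * cmod h).
    apply: ler_pM => //; apply: le_trans kc _; exact: ler_wpM2l.
  have m2 : `|expR a - 1| * `|sin b| <= 4 * (e * cmod h).
    apply: (@le_trans _ _ (2 * `|a| * (2 * `|b|))); first exact: ler_pM.
    rewrite (_ : 2 * _ * _ = 4 * (`|b| * `|a|)); last by ring.
    rewrite ler_pM2l//; apply: ler_pM; [lra|lra|exact: ltW|exact: ha].
  have m3 : e * `|a| <= e * cmod h by rewrite ler_wpM2l.
  have m4 : e * `|b| <= e * cmod h by rewrite ler_wpM2l.
  lra.
have -> : cexp (z + h) - cexp z - cexp z * h = cexp z * (cexp h - 1 - h).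
  by rewrite cexpD; ring.
rewrite cmodM; apply: le_trans (ler_wpM2l (cmod_ge0 _) main) _.
rewrite [9 * e]mulrC !mulrA ler_wpM2r//.
move: e9; rewrite ler_pdivlMr ?mulr_gt0// => h9.
have := cmod_ge0 (cexp z); nra.
Qed.

End PowerSeriesCalculus.

(** * The logarithm *)

Section Logarithm.
Variable R : realType.

Lemma bdd_inv : bdd (fun k => (k%:R : R[i])^-1) 1.
Proof.
move=> r /andP[r0 r1]; exists 1 => k; rewrite cmodV cmod_nat.
apply: mulr_ile1; rewrite ?invr_ge0 ?exprn_ge0 ?exprn_ile1 ?(ltW r0) ?(ltW r1)//.
by case: k => [|k]; rewrite ?invr0 ?ler01// invf_le1 ?ltr0n// ler1n.
Qed.

(** The convention [0^-1 = 0] removes the term of index 0. *)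
Definition mlog1 (w : R[i]) : R[i] := psum (fun k => (k%:R)^-1) w.

Lemma mlog10 : mlog1 0 = 0.
Proof. by rewrite /mlog1 (expands0 ltr01 (psum_expands bdd_inv)) invr0. Qed.

Lemma expands_geo : expands (fun=> 1) 1 (fun w : R[i] => (1 - w)^-1).
Proof.
move=> r /andP[r0 r1]; exists (1 - r)^-1 => N w wr.
have w1 : 1 - r <= cmod (1 - w).
  by have := cmodD (1 - w) w; rewrite subrK cmod1 => h; lra.
have w0 : 1 - w != 0 by rewrite -cmod_gt0 (lt_le_trans _ w1)// subr_gt0.
have -> : (1 - w)^-1 - \sum_(k < N) 1 * w ^+ k = w ^+ N / (1 - w).
  apply: (mulIf w0); rewrite divfK// mulrBl mulVf//.
  rewrite (eq_bigr (fun k : 'I_N => w ^+ k)) => [|k _]; last by rewrite mul1r.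
  by rewrite mulrC -[1 - w]opprB mulNr -subrX1; ring.
rewrite cmodM cmodX cmodV -mulrA mulrC ler_wpM2r ?exprn_ge0 ?cmod_ge0//.
rewrite -[leRHS]mulr1; apply: ler_pM; rewrite ?invr_ge0 ?cmod_ge0 ?exprn_ge0 ?(ltW r0)//.
  by rewrite lef_pV2 ?posrE ?subr_gt0// cmod_gt0.
by rewrite exprn_ile1 ?(ltW r0) ?(ltW r1).
Qed.

Lemma is_derive_mlog1 (w : cplx R) : cmod w < 1 ->
  is_derive w 1 (mlog1 : cplx R -> cplx R) (1 - w)^-1.
Proof.
move=> w1; have h := expands_is_derive (psum_expands bdd_inv) w1.
have := expands_psum expands_geo w1 => <-.
rewrite (_ : (fun=> 1) = dcoef (fun k => (k%:R : R[i])^-1)); first exact: h.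
by apply/funext => k; rewrite /dcoef mulfV// pnatr_eq0.
Qed.

(** The product [(1 - z) * cexp (mlog1 z)] has derivative 0 and equals 1 at 0. *)
Lemma cexp_mlog1 (w : R[i]) : cmod w < 1 -> cexp (- mlog1 w) = 1 - w.
Proof.
move=> w1.
have H : (fun z => (1 - z) * cexp (mlog1 z)) w = (fun z => (1 - z) * cexp (mlog1 z)) 0.
  apply: (@holo_const _ (fun z => (1 - z) * cexp (mlog1 z)) 1 w w1) => z z1.
  have d1 : is_derive (z : cplx R) 1 (fun x : cplx R => 1 - x : cplx R) (- 1).
    have h := is_deriveB (is_derive_cst (1 : cplx R) (z : cplx R) 1) (is_derive_id (z : cplx R) (1 : cplx R)).
    by rewrite sub0r in h; exact: h.
  have d2 : is_derive (z : cplx R) 1 ((cexp (R := R) : cplx R -> cplx R) \o (mlog1 : cplx R -> cplx R))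
     (cexp (mlog1 z) * (1 - z)^-1).
    exact: is_deriveC_comp (is_derive_cexp _) (is_derive_mlog1 z1).
  have d3 := is_deriveM d1 d2.
  have z0 : 1 - z != 0.
    by rewrite -cmod_gt0; have := cmodD (1 - z) z; rewrite subrK cmod1 => h; lra.
  have e0 : (1 - z) *: (cexp (mlog1 z) * (1 - z)^-1 : cplx R) + cexp (mlog1 z) *: (-1 : cplx R) = 0.
    rewrite -[_ *: _]/(_ * _) -[cexp _ *: _]/(_ * _) mulrCA mulfV//; ring.
  by rewrite -e0; exact: d3.
move: H => /=; rewrite mlog10 cexp0 subr0 mulr1 cexpN => H.
by apply: (mulIf (cexp_neq0 (mlog1 w))); rewrite mulVf ?cexp_neq0// H.
Qed.

(** [expR (- Re) = cmod (1 - w)] is at most 2, hence at most [expR 1]; the sharper bound by [ln 2]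
    would only change [eta]. *)
Lemma Re_mlog1 (w : R[i]) : cmod w < 1 -> - 1 <= complex.Re (mlog1 w).
Proof.
move=> w1; have := cmod_cexp (- mlog1 w); rewrite cexp_mlog1// cReN => h.
have h2 : expR (- complex.Re (mlog1 w)) <= expR 1.
  rewrite -h; apply: le_trans (cmodB _ _) _; rewrite cmod1.
  by have := expR_ge1Dx (1 : R); lra.
by move: h2; rewrite ler_expR; lra.
Qed.

Lemma cos_Im_mlog1 (w : R[i]) : cmod w < 1 -> 0 < cos (complex.Im (mlog1 w)).
Proof.
move=> w1; have E := cexp_mlog1 w1.
have : 0 < complex.Re (cexp (- mlog1 w)).
  by rewrite E cReD cReN /=; have := ler_norm (complex.Re w); have := Re_le_cmod w; lra.
rewrite /cexp cReM /= mul0r subr0 cImN cosN cReN.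
by rewrite pmulr_rgt0 ?expR_gt0.
Qed.

(** Positivity of the cosine locates the imaginary part only modulo [2 * pi]. Along the segment from
    0 to [w] it starts at 0 and varies continuously, so to leave the interval it would have to meet
    a zero of the cosine. *)
Lemma Im_mlog1 (w : R[i]) : cmod w < 1 -> `|complex.Im (mlog1 w)| < pi / 2.
Proof.
move=> w1; rewrite ltNge; apply/negP => Ige.
pose g (t : R) : R := complex.Im (mlog1 (t%:C * w)).
have tw t : 0 <= t <= 1 -> cmod (t%:C * w) < 1.
  move=> /andP[t0 t1]; rewrite cmodM cmodR ger0_norm//.
  by apply: le_lt_trans w1; rewrite ler_piMl ?cmod_ge0.
have cg : {within `[0, 1], continuous g}.
  apply: continuous_in_subspaceT => t; rewrite inE /= in_itv /= => t01.
  apply/cvgrPdist_lt => e e0.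
  have cm : (mlog1 : cplx R -> cplx R) @ (t%:C * w : cplx R) --> (mlog1 (t%:C * w) : cplx R).
    by apply: derivableC_continuous; have [] := is_derive_mlog1 (tw _ t01).
  have /cvgC_cmod/(_ e e0)/(nbhs_cmod (t%:C * w))[r r0 hr] := cm.
  apply: filterS (nbhsx_ballx t r r0) => s; rewrite /ball /= => ts.
  rewrite /g -cImN -cImD; apply: le_lt_trans (Im_le_cmod _) _; apply: hr.
  rewrite -mulrBl -rmorphB cmodM cmodR distrC; apply: le_lt_trans ts.
  by rewrite ler_piMr// ltW.
have g0 : g 0 = 0 by rewrite /g mul0r mlog10.
have g1 : g 1 = complex.Im (mlog1 w) by rewrite /g mul1r.
have pi0 : 0 < pi / 2 :> R by rewrite divr_gt0 ?pi_gt0.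
have [c c01 hc] : exists2 c, c \in `[0, 1] & `|g c| = pi / 2.
  have [g10|g10] := leP 0 (g 1).
    have [|c c01 hc] := @IVT _ g 0 1 (pi / 2) ler01 cg.
      rewrite g0 ge_min le_max (ltW pi0) /= g1.
      by move: Ige; rewrite ger0_norm -?g1// => ->; rewrite orbT.
    by exists c => //; rewrite hc gtr0_norm.
  have [|c c01 hc] := @IVT _ g 0 1 (- (pi / 2)) ler01 cg.
    rewrite g0 ge_min le_max oppr_le0 (ltW pi0) /= andbT g1.
    by move: Ige; rewrite ltr0_norm -?g1// lerNr => ->; rewrite orbT.
  by exists c => //; rewrite hc normrN gtr0_norm.
move: c01; rewrite in_itv /= => /tw /cos_Im_mlog1; rewrite -/(g c).
by rewrite -cos_norm hc cos_pihalf ltxx.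
Qed.

(** The modulus of [1 - w] determines the real part. The imaginary part has sine 0 and lies strictly
    between [- pi / 2] and [pi / 2], so it is 0. *)
Lemma mlog1_real (s : R) : 0 <= s -> mlog1 (1 - expR (- s))%:C = s%:C.
Proof.
move=> s0; set w := (_)%:C.
have e0 := expR_gt0 (- s).
have e1 : expR (- s) <= 1 by rewrite -expR0 ler_expR; lra.
have w1 : cmod w < 1 by rewrite cmodR ger0_norm; lra.
have E := cexp_mlog1 w1.
have wE : 1 - w = (expR (- s))%:C by rewrite /w rmorphB /= rmorph1; ring.
have C := cmod_cexp (- mlog1 w).
rewrite E wE cmodR ger0_norm ?expR_ge0// in C.
have ReE : complex.Re (mlog1 w) = s.
  by have := expR_inj C; rewrite cReN; lra.
have : complex.Im (cexp (- mlog1 w)) = 0 by rewrite E wE.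
rewrite /cexp cImM /= mul0r addr0 cImN sinN => /eqP.
rewrite mulf_eq0 gt_eqF ?expR_gt0//= oppr_eq0 => /eqP sI.
have := Im_mlog1 w1; rewrite ltr_norml => /andP[I1 I2].
apply: cplxP; rewrite ?ReE//=; apply: sin_inj; rewrite ?sin0// in_itv /=.
  by rewrite !ltW.
by have := @pi_gt0 R; lra.
Qed.

End Logarithm.

(** * Affine functions as limits *)

Section DirectionalDerivative.
Variables (R : realType) (V : normedModType R).

Definition pder (v : V) (g : V -> R[i]) (x : V) (e : R[i]) : Prop :=
  is_derive x v (fun y => complex.Re (g y) : R) (complex.Re e) /\
  is_derive x v (fun y => complex.Im (g y) : R) (complex.Im e).

Lemma pder_cst v (c : R[i]) x : pder v (fun=> c) x 0.
Proof. by split; exact: is_derive_cst. Qed.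

Lemma pderD v f g x a b : pder v f x a -> pder v g x b ->
  pder v (fun y => f y + g y) x (a + b).
Proof.
move=> [f1 f2] [g1 g2]; split.
  rewrite (_ : (fun y => _) = (fun y => complex.Re (f y)) \+ (fun y => complex.Re (g y))).
    by rewrite cReD; exact: is_deriveD.
  by apply/funext => y; rewrite /= cReD.
rewrite (_ : (fun y => _) = (fun y => complex.Im (f y)) \+ (fun y => complex.Im (g y))).
  by rewrite cImD; exact: is_deriveD.
by apply/funext => y; rewrite /= cImD.
Qed.

Lemma pderM v f g x a b : pder v f x a -> pder v g x b ->
  pder v (fun y => f y * g y) x (a * g x + f x * b).
Proof.
move=> [f1 f2] [g1 g2]; split.
  rewrite (_ : (fun y => _) = (fun y => complex.Re (f y)) * (fun y => complex.Re (g y))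
     - (fun y => complex.Im (f y)) * (fun y => complex.Im (g y))); last first.
    by apply/funext => y; rewrite cReM.
  have := is_deriveB (is_deriveM f1 g1) (is_deriveM f2 g2).
  by move=> h; apply: (is_derive_eq h); rewrite cReD !cReM /GRing.scale /=; ring.
rewrite (_ : (fun y => _) = (fun y => complex.Re (f y)) * (fun y => complex.Im (g y))
     + (fun y => complex.Im (f y)) * (fun y => complex.Re (g y))); last first.
  by apply/funext => y; rewrite cImM.
have := is_deriveD (is_deriveM f1 g2) (is_deriveM f2 g1).
by move=> h; apply: (is_derive_eq h); rewrite cImD !cImM /GRing.scale /=; ring.
Qed.

Lemma pder_sum v (I : Type) (r : seq I) (F : I -> V -> R[i]) x (e : I -> R[i]) :
  (forall i, pder v (F i) x (e i)) ->
  pder v (fun y => \sum_(i <- r) F i y) x (\sum_(i <- r) e i).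
Proof.
move=> h; elim: r => [|i r IH].
  rewrite big_nil (_ : (fun y => _) = fun=> 0); first exact: pder_cst.
  by apply/funext => y; rewrite big_nil.
rewrite big_cons (_ : (fun y => _) = fun y => F i y + \sum_(j <- r) F j y).
  exact: pderD.
by apply/funext => y; rewrite big_cons.
Qed.

Lemma pderZ v (c : R[i]) f x a : pder v f x a -> pder v (fun y => c * f y) x (c * a).
Proof.
by move=> h; have := pderM (pder_cst v c x) h; rewrite mul0r add0r.
Qed.

Lemma pder_eq v f x a b : a = b -> pder v f x a -> pder v f x b.
Proof. by move->. Qed.

Lemma pder_near v f g x a : (\forall y \near x, f y = g y) -> pder v f x a -> pder v g x a.
Proof.
move=> fg [f1 f2]; split.
  by apply: near_eq_is_derive f1; apply: filterS fg => y ->.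
by apply: near_eq_is_derive f2; apply: filterS fg => y ->.
Qed.

Lemma is_derive_line (f : V -> R) (x v : V) (e : R) :
  is_derive (0 : R) 1 (fun h => f (h *: v + x)) e -> is_derive x v f e.
Proof.
move=> [df <-].
have E : (fun h : R => h^-1 *: (f (h *: v + x) - f x)) =
    (fun h : R => h^-1 *: (f ((h *: (1 : R) + 0) *: v + x) - f (0 *: v + x))).
  by apply/funext => h; rewrite scale0r add0r addr0 -[h *: 1]/(h * 1) mulr1.
apply: DeriveDef; first by rewrite /derivable E; exact: df.
by rewrite /derive E.
Qed.

End DirectionalDerivative.

Section PartialDerivatives.
Variables (R : realType) (n : nat).
Implicit Types (x : 'rV[R]_n).

Lemma pder_partial (i : 'I_n) f x e : pder (delta_mx 0 i) f x e ->
  partial_exists i f x /\ partial i f x = e.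
Proof.
move=> [[d1 e1] [d2 e2]]; split; first by split.
by rewrite /partial e1 e2; case: (e).
Qed.

Lemma pder_coord (i j : 'I_n) x :
  pder (delta_mx 0 i) (fun y : 'rV[R]_n => (y 0 j)%:C) x (i == j)%:R.
Proof.
split => /=; last by rewrite (_ : complex.Im _ = 0); [exact: is_derive_cst|case: eqP].
apply: is_derive_line.
rewrite (_ : (fun h : R => _) = fun h : R => h * (i == j)%:R + x 0 j); last first.
  by apply/funext => h; rewrite !mxE eqxx /= eq_sym.
by apply: trigger_derive; rewrite /GRing.scale /=; case: eqP => /= _; ring.
Qed.

Lemma pder_fexp (i : 'I_n) (u x : 'rV[R]_n) :
  pder (delta_mx 0 i) (fexp u) x ('i%C * (u 0 i)%:C * fexp u x).
Proof.
have dl (h : R) : dotv u (h *: delta_mx 0 i + x) = h * u 0 i + dotv u x.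
  rewrite /dotv; under eq_bigr do rewrite !mxE eqxx /= mulrDr.
  rewrite big_split /=; congr (_ + _); rewrite (bigD1 i) //= eqxx mulr1 mulrC big1 ?addr0//.
  by move=> k ki; rewrite (negbTE ki) mulr0 mulr0.
have fE (y : 'rV[R]_n) : fexp u y = cos (dotv u y) +i* sin (dotv u y).
  have iE (t : R) : 'i%C * t%:C = 0 +i* t :> R[i] by apply: cplxP => /=; ring.
  by rewrite /fexp iE /cexp /= expR0 mul1r.
split.
  apply: is_derive_line.
  rewrite (_ : (fun h : R => _) = fun h : R => cos (h * u 0 i + dotv u x)); last first.
    by apply/funext => h; rewrite fE dl.
  apply: trigger_derive; rewrite fE !cReM !cImM /GRing.scale /= mul0r add0r; ring.
apply: is_derive_line.
rewrite (_ : (fun h : R => _) = fun h : R => sin (h * u 0 i + dotv u x)); last first.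
  by apply/funext => h; rewrite fE dl.
apply: trigger_derive; rewrite fE !cImM !cReM /GRing.scale /= mul0r add0r; ring.
Qed.

End PartialDerivatives.

Section AffineLimit.
Variables (R : realType) (n : nat).

Definition affineC (g : 'rV[R]_n -> R[i]) (X : set 'rV[R]_n) :=
  exists (a : R[i]) (b : 'rV[R[i]]_n),
    forall x, X x -> g x = a + \sum_(j < n) (x 0 j)%:C * b 0 j.

Lemma affineC_lin (X : set 'rV[R]_n) (c : R[i]) f g : affineC f X -> affineC g X ->
  affineC (fun x => c * f x + g x) X.
Proof.
move=> [a [b h]] [a' [b' h']]; exists (c * a + a'), (c *: b + b') => x Xx.
rewrite h// h'// mulrDr -!addrA; congr (_ + _); rewrite addrCA; congr (_ + _).
rewrite mulr_sumr -big_split /=; apply: eq_bigr => j _; rewrite !mxE; ring.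
Qed.

Lemma affineC_ext (X : set 'rV[R]_n) f g : (forall x, X x -> f x = g x) -> affineC f X -> affineC g X.
Proof. by move=> fg [a [b h]]; exists a, b => x Xx; rewrite -fg// h. Qed.

End AffineLimit.

Lemma open_axes (R : realType) (n : nat) (X : set 'rV[R]_n) x : open X -> X x ->
  exists2 e : R, 0 < e & forall j, X (x + e *: delta_mx 0 j).
Proof.
move=> oX Xx; have /nbhs_normP[e /= e0 he] := open_nbhs_nbhs (conj oX Xx).
exists (e / 2); first by rewrite divr_gt0.
move=> j; apply: he; rewrite /ball_ /= opprD addrA subrr add0r normrN normrZ.
rewrite gtr0_norm ?divr_gt0//.
apply: (@le_lt_trans _ _ (e / 2 * 1)); last by rewrite mulr1 ltr_pdivrMr// ltr_pMr// ltr1n.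
rewrite ler_wpM2l ?divr_ge0 ?(ltW e0)//.
rewrite /Num.Def.normr /= mx_normrE; apply: bigmax_le => //= k _; rewrite !mxE.
by case: (_ && _); rewrite ?normr1 ?normr0.
Qed.

Section ComplexLimits.
Variable R : realType.
Implicit Types (u v : nat -> cplx R) (a b : cplx R).

Lemma ccvgD u v a b : u @ \oo --> a -> v @ \oo --> b -> (fun k => u k + v k : cplx R) @ \oo --> (a + b : cplx R).
Proof. by move=> hu hv; exact (cvgD hu hv). Qed.

Lemma ccvgB u v a b : u @ \oo --> a -> v @ \oo --> b -> (fun k => u k - v k : cplx R) @ \oo --> (a - b : cplx R).
Proof. by move=> hu hv; exact (cvgB hu hv). Qed.

Lemma ccvgZ (c : cplx R) u a : u @ \oo --> a -> (fun k => c * u k : cplx R) @ \oo --> (c * a : cplx R).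
Proof. by move=> h; exact (cvgM (cvg_cst c) h). Qed.

Lemma ccvg_sum (I : Type) (r : seq I) (F : I -> nat -> cplx R) (l : I -> cplx R) :
  (forall i, F i @ \oo --> l i) ->
  (fun k => \sum_(i <- r) F i k : cplx R) @ \oo --> (\sum_(i <- r) l i : cplx R).
Proof.
move=> h; elim: r => [|i r IH].
  by rewrite big_nil; under eq_fun do rewrite big_nil; exact: cvg_cst.
rewrite big_cons; under eq_fun do rewrite big_cons.
exact (ccvgD (h i) IH).
Qed.

End ComplexLimits.

(** An affine function is a fixed linear combination of its values at [x0] and at the points
    [x0 + e *: delta_mx 0 j], all in [X]; this formula passes to the limit. *)
Lemma affineC_lim (R : realType) (n : nat) (X : set 'rV[R]_n) (B : nat -> 'rV[R]_n -> R[i]) g :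
  open X -> (forall N, affineC (B N) X) ->
  (forall x, X x -> (B ^~ x : nat -> cplx R) @ \oo --> (g x : cplx R)) -> affineC g X.
Proof.
move=> oX aB hB.
have [[x0 Xx0]|NX] := pselect (exists x, X x); last first.
  by exists 0, 0 => x Xx; case: NX; exists x.
have [e e0 he] := open_axes oX Xx0.
have eC : e%:C != 0 :> R[i] by rewrite -cmod_gt0 cmodR gtr0_norm.
exists (g x0 - \sum_(j < n) (x0 0 j)%:C * ((g (x0 + e *: delta_mx 0 j) - g x0) / e%:C)),
  (\row_j ((g (x0 + e *: delta_mx 0 j) - g x0) / e%:C)) => x Xx.
rewrite -addrA addrC -sumrN -big_split /=.
have EB N : B N x = \sum_(j < n) ((x 0 j)%:C - (x0 0 j)%:C) / e%:C *
      (B N (x0 + e *: delta_mx 0 j) - B N x0) + B N x0.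
  have [a [b hb]] := aB N.
  have E j : B N (x0 + e *: delta_mx 0 j) - B N x0 = e%:C * b 0 j.
    rewrite (hb _ (he j)) (hb _ Xx0) opprD addrACA subrr add0r -sumrB (bigD1 j)//= big1 ?addr0.
      by rewrite !mxE !eqxx /= mulr1 rmorphD /=; ring.
    by move=> k kj; rewrite !mxE eqxx /= (negbTE kj) mulr0 addr0 subrr.
  rewrite (eq_bigr (fun j => ((x 0 j)%:C - (x0 0 j)%:C) * b 0 j)) => [|j _].
    rewrite (hb _ Xx) (hb _ Xx0) addrCA; congr (_ + _); rewrite -big_split /=.
    by apply: eq_bigr => j _; ring.
  by rewrite E mulrA divfK.
transitivity (\sum_(j < n) ((x 0 j)%:C - (x0 0 j)%:C) / e%:C *
    (g (x0 + e *: delta_mx 0 j) - g x0) + g x0); last first.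
  congr (_ + _); apply: eq_bigr => j _; rewrite !mxE; ring.
have lim1 : (B ^~ x : nat -> cplx R) @ \oo --> (g x : cplx R) by exact: hB.
have lim2 : (B ^~ x : nat -> cplx R) @ \oo --> (\sum_(j < n) ((x 0 j)%:C - (x0 0 j)%:C) / e%:C *
   (g (x0 + e *: delta_mx 0 j) - g x0) + g x0 : cplx R).
  rewrite (_ : B ^~ x = fun N => \sum_(j < n) ((x 0 j)%:C - (x0 0 j)%:C) / e%:C *
      (B N (x0 + e *: delta_mx 0 j) - B N x0) + B N x0); last by apply/funext => N; rewrite EB.
  apply: (ccvgD (u := fun N => \sum_(j < n) ((x 0 j)%:C - (x0 0 j)%:C) / e%:C *
      (B N (x0 + e *: delta_mx 0 j) - B N x0)) _ (hB x0 Xx0)).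
  apply: (ccvg_sum (F := fun (j : 'I_n) N => ((x 0 j)%:C - (x0 0 j)%:C) / e%:C *
      (B N (x0 + e *: delta_mx 0 j) - B N x0))) => j.
  apply: (ccvgZ (u := fun N => B N (x0 + e *: delta_mx 0 j) - B N x0)).
  exact (ccvgB (hB _ (he j)) (hB x0 Xx0)).
exact: (cvg_unique (@norm_hausdorff _ (cplx R)) lim1 lim2).
Qed.

(** * The recursion for the coefficients *)

Section Operator.
Variables (R : realType) (n : nat) (X : set 'rV[R]_n) (A : closed_operator X).
Implicit Types (f g : 'rV[R]_n -> R[i]).

Lemma clo_fun0 x : X x -> A (fun=> 0) x = 0.
Proof.
move=> Xx; have [_ h] := clo_linear (-1) (clo_dom0 A) (clo_dom0 A).
have E y : X y -> (0 : R[i]) = -1 * 0 + 0 by move=> _; rewrite mulr0 addr0.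
have [_ h2] := clo_ext E (clo_dom0 A).
by rewrite (h2 x Xx) (h x Xx); ring.
Qed.

Lemma clo_sum f (N : nat) (e : nat -> R[i]) : (forall m, clo_dom A (iter m A f)) ->
  clo_dom A (fun x => \sum_(m < N) e m * iter m A f x) /\
  forall x, X x -> A (fun x => \sum_(m < N) e m * iter m A f x) x =
    \sum_(m < N) e m * iter m.+1 A f x.
Proof.
move=> df; elim: N => [|N [IH1 IH2]].
  have -> : (fun x => \sum_(m < 0) e m * iter m A f x) = fun=> 0.
    by apply/funext => x; rewrite big_ord0.
  split=> [|x Xx]; first exact: clo_dom0.
  by rewrite big_ord0 clo_fun0.
have -> : (fun x => \sum_(m < N.+1) e m * iter m A f x) =
    fun x => e N * iter N A f x + \sum_(m < N) e m * iter m A f x.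
  by apply/funext => x; rewrite big_ord_recr /= addrC.
have [h1 h2] := clo_linear (e N) (df N) IH1.
by split=> // x Xx; rewrite h2// IH2// big_ord_recr /= addrC.
Qed.

(** The coefficient of [A ^ m] in the rising product of order [k]: an unsigned Stirling number of
    the first kind divided by [eta ^+ m]. *)
Fixpoint rcoef (eta : R) (k m : nat) : R[i] :=
  if k is j.+1 then (eta^-1)%:C * (if m is l.+1 then rcoef eta j l else 0) + j%:R * rcoef eta j m
  else (m == 0)%:R.

Lemma rcoef_big eta k m : (k < m)%N -> rcoef eta k m = 0.
Proof.
elim: k m => [|k IH] [|m] //= km.
by rewrite IH// IH ?mulr0 ?addr0// ltnW.
Qed.

Lemma rcoef_sum eta k (t : nat -> R[i]) :
  \sum_(m < k.+2) rcoef eta k.+1 m * t m =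
  (eta^-1)%:C * \sum_(m < k.+1) rcoef eta k m * t m.+1 + k%:R * \sum_(m < k.+1) rcoef eta k m * t m.
Proof.
rewrite [rcoef]lock -lock.
transitivity (\sum_(m < k.+2) ((eta^-1)%:C * (if (m : nat) is l.+1 then rcoef eta k l else 0) * t m
    + k%:R * (rcoef eta k m * t m))).
  by apply: eq_bigr => m _; rewrite /= mulrDl mulrA.
rewrite big_split /=; congr (_ + _).
  rewrite big_ord_recl /= mulr0 mul0r add0r mulr_sumr; apply: eq_bigr => m _ /=.
  by rewrite mulrA.
by rewrite -mulr_sumr big_ord_recr /= rcoef_big// mul0r addr0.
Qed.

(** Values of [A] mean nothing off [X], so the two sides are compared on [X] only and [clo_ext]
    carries the equality through the next application of [A]. *)
Lemma rising_op_sum eta k f : (forall m, clo_dom A (iter m A f)) ->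
  forall x, X x -> rising_op A eta k f x = \sum_(m < k.+1) rcoef eta k m * iter m A f x.
Proof.
move=> df; elim: k => [|k IH] x Xx.
  by rewrite big_ord_recl big_ord0 /= mul1r addr0.
rewrite (rcoef_sum eta k (fun m => iter m A f x)) -(IH x Xx).
rewrite [LHS]/=; congr (_ * _ + _).
have [h1 h2] := clo_sum k.+1 (rcoef eta k) df.
have [_ h3] := clo_ext (fun y Xy => esym (IH y Xy)) h1.
by rewrite -(h3 x Xx) h2.
Qed.

Lemma rising_op_dom eta k f : (forall m, clo_dom A (iter m A f)) -> clo_dom A (rising_op A eta k f).
Proof.
move=> df; have [h1 _] := clo_sum k.+1 (rcoef eta k) df.
by have [] := clo_ext (fun y Xy => esym (rising_op_sum eta k df Xy)) h1.
Qed.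

End Operator.

Lemma affineC_sum (R : realType) (n : nat) (X : set 'rV[R]_n) (I : Type) (r : seq I) (P : pred I)
  (F : I -> 'rV[R]_n -> R[i]) : (forall i, affineC (F i) X) ->
  affineC (fun x => \sum_(i <- r | P i) F i x) X.
Proof.
move=> h; elim: r => [|i r IH].
  exists 0, 0 => x _; rewrite big_nil big1 ?addr0// => j _.
  by rewrite mxE mulr0.
case Pi : (P i); last by apply: (affineC_ext _ IH) => x _; rewrite big_cons Pi.
apply: (affineC_ext _ (affineC_lin 1 (h i) IH)) => x _.
by rewrite big_cons Pi mul1r.
Qed.

(** * Affinity of the coefficients, by formal power series in the variable $w$ *)

Section Affine.
Variables (R : realType) (n : nat) (X : set 'rV[R]_n).
Hypothesis X_open : open X.
Variables (c : multi_index n -> R) (d : multi_index n -> 'rV[R]_n) (A : closed_operator X).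
Hypothesis A_acts : acts_as A (affine_coef c d).
Hypothesis symbol_cvg : forall u x : 'rV[R]_n, X x ->
     abs_summable (fun al : multi_index n => (affine_coef c d al x)%:C *
                       mi_pow (fun j => 'i * (u 0 j)%:C) al).
Variables (u : 'rV[R]_n) (eta : R).
Hypothesis eta0 : 0 < eta.
Hypothesis domA : forall m, clo_dom A (iter m A (fexp u)).

Let q k x := qfun A eta u k x.
Let rh k x := rho A eta u k x.

Lemma fexp_neq0 (x : 'rV[R]_n) : fexp u x != 0. Proof. exact: cexp_neq0. Qed.

Lemma q0E x : q 0 x = fexp u x.
Proof. by rewrite /q /qfun /= invr1 mul1r. Qed.

Let factk_neq0 k : (k`!%:R : R[i]) != 0.
Proof. by rewrite pnatr_eq0 -lt0n fact_gt0. Qed.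

Let q_lin k : (fun x => (k`!%:R)^-1 * rising_op A eta k (fexp u) x + 0) = q k.
Proof. by apply/funext => x; rewrite addr0. Qed.

Lemma q_dom k : clo_dom A (q k).
Proof. by have [h _] := clo_linear (k`!%:R)^-1 (rising_op_dom eta k domA) (clo_dom0 A); rewrite q_lin in h. Qed.

(** The coefficient of $w^k$ in $\eta(1-w)Q'=AQ$. *)
Lemma A_q k x : X x -> A (q k) x = eta%:C * (k.+1%:R * q k.+1 x - k%:R * q k x).
Proof.
move=> Xx; have [_ h] := clo_linear (k`!%:R)^-1 (rising_op_dom eta k domA) (clo_dom0 A).
rewrite q_lin in h; rewrite h// clo_fun0// addr0 /q /qfun factS natrM /=.
have e0 : eta%:C != 0 :> R[i] by rewrite -cmod_gt0 cmodR gtr0_norm.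
have -> : (eta^-1)%:C = (eta%:C)^-1 :> R[i] by exact: fmorphV.
have := factk_neq0 k; have k0 : (k.+1%:R : R[i]) != 0 by rewrite pnatr_eq0.
move: (A _ x) (rising_op _ _ _ _ x) (k`!%:R : R[i]) (k.+1%:R : R[i]) k0 (eta%:C : R[i]) e0.
move=> a b F K K0 E E0 F0; field; by rewrite ?F0 ?K0 ?E0.
Qed.

(** The recursion for [rho] solved for [q]: the coefficient of $w^k$ in $wQ'=(wS')Q$ with
    $S=\sum\rho_jw^j$. *)
Lemma q_rho k x : k%:R * q k x = \sum_(j < k.+1) j%:R * rh j x * q (k - j) x.
Proof.
case: k => [|k]; first by rewrite big_ord_recl big_ord0 /= !mul0r addr0.
rewrite big_ord_recr /= subnn q0E /rh rhoE// mulrC.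
have k0 : (k.+1%:R : R[i]) != 0 by rewrite pnatr_eq0.
rewrite big_add1 /= big_mkord big_ord_recl /= !mul0r add0r.
set S := (X in X + _); set S' := (X in _ - _ * X).
have <- : S = S' by apply: eq_bigr => i _; rewrite /bump leq0n add1n.
have := fexp_neq0 x; rewrite -/(q k.+1 x).
by move: (fexp u x) (q k.+1 x) (k.+1%:R : R[i]) k0 S => f Q K K0 S0 f0; field; rewrite ?f0 ?K0.
Qed.

(** The coefficient of $w^k$ in $(1-w)Q'=((1-w)S')Q$. *)
Lemma q_tau k x : k.+1%:R * q k.+1 x - k%:R * q k x =
  \sum_(j < k.+1) (j.+1%:R * rh j.+1 x - j%:R * rh j x) * q (k - j) x.
Proof.
rewrite !q_rho [in LHS]big_ord_recl /= !mul0r add0r -sumrB; apply: eq_bigr => j _.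
by rewrite /bump leq0n add1n subSS; ring.
Qed.

Section Step.
Variables (k : nat) (r0 : nat -> R[i]) (r1 : nat -> 'rV[R[i]]_n).
Hypothesis rhE : forall j x, (j <= k)%N -> X x ->
  rh j x = r0 j + \sum_(i < n) (x 0 i)%:C * r1 j 0 i.

(** Power series in $w$ cut at degree [k]: [p i] is the partial derivative of $\sum\rho_lw^l$ in
    direction [i], free of [x] by affinity; [Q] is the exponential and [T] is $w$ times the
    derivative of its exponent. Only coefficients up to [k] are meaningful. *)
Let p (i : 'I_n) : {poly R[i]} := \poly_(l < k.+1) r1 l 0 i.
Let Q x : {poly R[i]} := \poly_(l < k.+1) q l x.
Let T x : {poly R[i]} := \poly_(l < k.+1) (l%:R * rh l x).

Let TQ j x : (j <= k)%N -> (T x * Q x)`_j = ('X * (Q x)^`())`_j.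
Proof.
move=> jk; rewrite coefM coefXM coef_deriv.
transitivity (j%:R * q j x).
  rewrite q_rho; apply: eq_bigr => m _; rewrite !coef_poly ltnS (leq_trans (leq_ord m) jk).
  by rewrite ltnS (leq_trans (leq_subr _ _) jk).
case: j jk => [|j] jk /=; first by rewrite mul0r.
by rewrite coef_poly ltnS jk mulr_natl.
Qed.

Let coefMl (P S S' : {poly R[i]}) j : (forall m, (m <= j)%N -> S`_m = S'`_m) -> (P * S)`_j = (P * S')`_j.
Proof. by move=> h; rewrite !coefM; apply: eq_bigr => m _; rewrite h// leq_subr. Qed.

(** Coefficientwise form of $\partial_ie^S=(\partial_iS)e^S$, obtained by differentiating [q_rho],
    which expresses each [q] through earlier ones. *)
Let dq j (i : 'I_n) x : (j <= k)%N -> X x -> pder (delta_mx 0 i) (q j) x (p i * Q x)`_j.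
Proof.
elim/ltn_ind: j x => j IH x jk Xx.
have Xn : \forall y \near x, X y by exact: open_nbhs_nbhs.
have Qc m y : (m <= k)%N -> (Q y)`_m = q m y by move=> mk; rewrite coef_poly ltnS mk.
case: j jk IH => [|j] jk IH.
  have -> : (p i * Q x)`_0 = 'i%C * (u 0 i)%:C * fexp u x.
    rewrite coefM big_ord_recl big_ord0 addr0 subnn Qc// q0E coef_poly /=; congr (_ * _).
    (* [rhE] holds on [X] only, so [r1 0 0 i] is identified with ['i * u 0 i] by comparing two
       points of [X] on a line parallel to an axis. *)
    have [e e0 he] := open_axes X_open Xx.
    have h0 y : X y -> 'i%C * (dotv u y)%:C = r0 0 + \sum_(l < n) (y 0 l)%:C * r1 0 0 l.
      by move=> Xy; rewrite -rhE.
    have := h0 _ (he i); have := h0 _ Xx => E1 E2.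
    have eC : e%:C != 0 :> R[i] by rewrite -cmod_gt0 cmodR gtr0_norm.
    apply: (mulfI eC); transitivity ((r0 0 + \sum_(l < n) ((x + e *: delta_mx 0 i) 0 l)%:C * r1 0 0 l) -
       (r0 0 + \sum_(l < n) (x 0 l)%:C * r1 0 0 l)).
      rewrite opprD addrACA subrr add0r -sumrB (bigD1 i)//= big1 ?addr0.
        by rewrite !mxE !eqxx /= mulr1 rmorphD /=; ring.
      by move=> l li; rewrite !mxE eqxx /= (negbTE li) mulr0 addr0 subrr.
    rewrite -E1 -E2 -mulrBr -rmorphB mulrCA -rmorphM; congr (_ * _%:C).
    rewrite /dotv -sumrB (bigD1 i)//= big1 ?addr0.
      by rewrite !mxE !eqxx /= mulr1; ring.
    by move=> l li; rewrite !mxE eqxx /= (negbTE li) mulr0 addr0 subrr.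
  apply: (pder_near (f := fexp u)); last exact: pder_fexp.
  by apply: filterS Xn => y _; rewrite q0E.
pose G (y : 'rV[R]_n) := (j.+1%:R)^-1 * \sum_(m < j.+2) m%:R * (r0 m + \sum_(l < n) (y 0 l)%:C * r1 m 0 l) * q (j.+1 - m)%N y.
have j0 : (j.+1%:R : R[i]) != 0 by rewrite pnatr_eq0.
apply: (pder_near (f := G)).
  apply: filterS Xn => y Xy; apply: (mulfI j0); rewrite q_rho mulrA mulfV// mul1r.
  by apply: eq_bigr => m _; rewrite rhE// (leq_trans (leq_ord m) jk).
have dR m (y : 'rV[R]_n) : pder (delta_mx 0 i) (fun y : 'rV[R]_n => r0 m + \sum_(l < n) (y 0 l)%:C * r1 m 0 l) y (r1 m 0 i).
  apply: pder_eq (pderD (pder_cst _ (r0 m) y) (pder_sum _ (fun l => pderM (pder_coord i l y) (pder_cst _ (r1 m 0 l) y)))).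
  rewrite add0r (bigD1 i)//= eqxx mul1r mulr0 addr0 big1 ?addr0// => l li.
  by rewrite eq_sym (negbTE li) mul0r mulr0 addr0.
(* The entry [m = 0] carries the factor 0, which avoids the derivative of [q j.+1] itself. *)
pose D (m : nat) := if m is 0%N then 0 else m%:R * r1 m 0 i * q (j.+1 - m)%N x +
    m%:R * (r0 m + \sum_(l < n) (x 0 l)%:C * r1 m 0 l) * (p i * Q x)`_(j.+1 - m)%N.
apply: (pder_eq (a := (j.+1%:R)^-1 * \sum_(m < j.+2) D m)); last first.
  apply: pderZ; apply: pder_sum => -[[|m] mj] /=.
    rewrite (_ : (fun y => _) = fun=> 0); first exact: pder_cst.
    by apply/funext => y; rewrite !mul0r.
  apply: pderM; first exact: pderZ.
  by apply: IH => //; [rewrite ltn_subrL|rewrite (leq_trans (leq_subr _ _) jk)].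
apply: (mulfI j0); rewrite mulrA mulfV// mul1r.
transitivity (('X * (p i)^`() * Q x)`_j.+1 + (T x * (p i * Q x))`_j.+1).
  rewrite !coefM -big_split /=; apply: eq_bigr => m _.
  have mk : (m <= k)%N := leq_trans (leq_ord m) jk.
  rewrite Qc ?(leq_trans (leq_subr _ _) jk)// coef_poly ltnS mk coefXM coef_deriv rhE//.
  rewrite /D; case: (m : nat) mk => [|l] lk /=; first by rewrite !mul0r addr0.
  have -> : (p i)`_l.+1 = r1 l.+1 0 i by rewrite coef_poly ltnS lk.
  by rewrite -[r1 _ _ _ *+ _]mulr_natl.
(* The product rule: with [T * Q = 'X * Q'] the sum is ['X * (p i * Q)'], whose coefficient at
   [j.+1] is [j.+1] times that of [p i * Q]. *)
rewrite [T x * _]mulrCA (coefMl (p i) (S := T x * Q x) (S' := 'X * (Q x)^`())); last by move=> m mj; rewrite TQ// (leq_trans mj jk).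
rewrite -coefD -mulrA (mulrCA (p i)) -mulrDr -derivM coefXM /= coef_deriv mulr_natl.
by [].
Qed.

(** This family of functions is stable under partial derivatives, each of which multiplies [S] by
    some [p i]. *)
Let V j (S : {poly R[i]}) x := (S * Q x)`_j.

Let VE j S x : (j <= k)%N -> V j S x = \sum_(m < j.+1) S`_m * q (j - m)%N x.
Proof.
move=> jk; rewrite /V coefM; apply: eq_bigr => m _.
by rewrite [(Q x)`_ _]coef_poly ltnS (leq_trans (leq_subr _ _) jk).
Qed.

Let V_dom j S : (j <= k)%N -> clo_dom A (V j S).
Proof.
move=> jk; have -> : V j S = fun x => \sum_(m < j.+1) S`_m * q (j - m)%N x.
  by apply/funext => x; rewrite VE.
elim: j.+1 => [|N IH].
  have -> : (fun x => \sum_(m < 0) S`_m * q (j - m)%N x) = fun=> 0.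
    by apply/funext => x; rewrite big_ord0.
  exact: clo_dom0.
have -> : (fun x => \sum_(m < N.+1) S`_m * q (j - m)%N x) =
    fun x => S`_N * q (j - N)%N x + \sum_(m < N) S`_m * q (j - m)%N x.
  by apply/funext => x; rewrite big_ord_recr /= addrC.
by have [] := clo_linear S`_N (q_dom (j - N)) IH.
Qed.

Let dV j S i x : (j <= k)%N -> X x -> pder (delta_mx 0 i) (V j S) x (V j (S * p i) x).
Proof.
move=> jk Xx; have -> : V j S = fun x => \sum_(m < j.+1) S`_m * q (j - m)%N x.
  by apply/funext => y; rewrite VE.
have -> : V j (S * p i) x = \sum_(m < j.+1) S`_m * (p i * Q x)`_(j - m)%N.
  by rewrite /V -mulrA coefM.
apply: pder_sum => m; apply: pderZ; apply: dq => //.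
exact: leq_trans (leq_subr _ _) jk.
Qed.

Let partial_V g j S i : (j <= k)%N -> (forall x, X x -> g x = V j S x) ->
  forall x, X x -> partial_exists i g x /\ partial i g x = V j (S * p i) x.
Proof.
move=> jk gV x Xx; apply: pder_partial; apply: (pder_near (f := V j S)); last exact: dV.
have : \forall y \near x, X y by exact: open_nbhs_nbhs.
by apply: filterS => y Xy; rewrite gV.
Qed.

Let iter_V g j S i a : (j <= k)%N -> (forall x, X x -> g x = V j S x) ->
  forall x, X x -> iter a (partial i) g x = V j (S * p i ^+ a) x.
Proof.
move=> jk gV; elim: a => [|a IH] x Xx; first by rewrite /= expr0 mulr1 gV.
by have [_] := partial_V i jk IH Xx; rewrite exprSr mulrA.
Qed.

Let q_V j x : (j <= k)%N -> q j x = V j 1 x.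
Proof. by move=> jk; rewrite /V mul1r coef_poly ltnS jk. Qed.

Let mi_partial_V j (al : multi_index n) x : (j <= k)%N -> X x ->
  mi_partial al (q j) x = V j (\prod_(i < n) p i ^+ al i) x.
Proof.
move=> jk; rewrite -big_enum /= /mi_partial; elim: (enum 'I_n) x => [|i s IH] x Xx /=.
  by rewrite big_nil q_V.
by rewrite big_cons (iter_V _ _ jk IH)// mulrC.
Qed.

(** Every iterated partial derivative is a combination of some [q m] with constant coefficients,
    hence in the domain of [A], whose elements are continuous on [X]. *)
Let smooth_q j : (j <= k)%N -> smooth_on X (q j).
Proof.
move=> jk js.
have E x : X x -> foldr (@partial R n) (q j) js x = V j (\prod_(i <- js) p i) x.
  elim: js x => [|i s IH] x Xx /=; first by rewrite big_nil q_V.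
  by have [_ ->] := partial_V i jk IH Xx; rewrite big_cons mulrC.
split; last by move=> i x Xx; have [] := partial_V i jk E Xx.
have [h _] := clo_ext (fun x Xx => esym (E x Xx)) (V_dom (\prod_(i <- js) p i) jk).
by have [] := clo_cont h.
Qed.

(** Multiplication by [p i] enlarges a bound on the coefficients up to [k] by at most this factor;
    [k.+1] counts the terms of the convolution. *)
Let M (i : 'I_n) : R := k.+1%:R * \sum_(l < k.+1) cmod (p i)`_l.

Let M0 i : 0 <= M i. Proof. by rewrite mulr_ge0// sumr_ge0// => l _; exact: cmod_ge0. Qed.

Let bd (S : {poly R[i]}) (K : R) := forall l, (l <= k)%N -> cmod S`_l <= K.

Let bdM S K i : 0 <= K -> bd S K -> bd (S * p i) (K * M i).
Proof.
move=> K0 h l lk; rewrite coefM; apply: le_trans (cmod_sum _ _ _) _.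
apply: (@le_trans _ _ (\sum_(m < l.+1) K * \sum_(l < k.+1) cmod (p i)`_l)).
  apply: ler_sum => m _; rewrite cmodM; apply: ler_pM; rewrite ?cmod_ge0//.
    by apply: h; exact: leq_trans (leq_ord m) lk.
  have lm : (l - m < k.+1)%N by rewrite ltnS (leq_trans (leq_subr _ _) lk).
  by rewrite (bigD1 (Ordinal lm))//= lerDl sumr_ge0// => ? _; exact: cmod_ge0.
rewrite sumr_const card_ord /M; set B := \sum_(_ < k.+1) _.
rewrite -[_ *+ l.+1]mulr_natl mulrCA; apply: ler_wpM2l => //; apply: ler_wpM2r.
  by rewrite sumr_ge0// => ? _; exact: cmod_ge0.
by rewrite ler_nat ltnS.
Qed.

Let bd_prod (al : multi_index n) : bd (\prod_(i < n) p i ^+ al i) (\prod_(i < n) M i ^+ al i).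
Proof.
(* Generalised to an arbitrary left factor [S'], because [bdM] appends one [p i] at a time. *)
pose P (S : {poly R[i]}) (K : R) := forall S' K', 0 <= K' -> bd S' K' -> 0 <= K /\ bd (S' * S) (K' * K).
have : P (\prod_(i < n) p i ^+ al i) (\prod_(i < n) M i ^+ al i).
  elim/big_rec2: _ => [|i K S _ IH] S' K' K0 h; first by rewrite !mulr1.
  have H a : 0 <= M i ^+ a /\ bd (S' * p i ^+ a) (K' * M i ^+ a).
    elim: a => [|a [IH1 IH2]]; first by rewrite !expr0 !mulr1.
    split; first by rewrite exprn_ge0.
    rewrite (exprSr (p i)) (exprSr (M i)) (mulrA S') (mulrA K' _ (M i)).
    exact: bdM (mulr_ge0 K0 IH1) IH2.
  have [H1 H2] := H (al i).
  have [H3 H4] := IH _ _ (mulr_ge0 K0 H1) H2.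
  by split; [exact: mulr_ge0|rewrite (mulrA S') (mulrA K' _ K)].
move=> /(_ 1 1 ler01); rewrite !mul1r => h; apply: (h _).2 => l lk.
by rewrite coef1; case: eqP => _; rewrite ?cmod1 ?cmod0.
Qed.

(** The derivative of index [al] is at most [Cx] times the monomial of [M]. As [al] is nonzero,
    [Cx <= (1 + Cx) ^+ mi_deg al], so the symbol at the real vector [(1 + Cx) * M i] dominates. *)
Let q_summable j x : (j <= k)%N -> X x ->
  abs_summable (fun al => (affine_coef c d al x)%:C * mi_partial al (q j) x).
Proof.
move=> jk Xx.
pose Cx := \sum_(m < j.+1) cmod (Q x)`_(j - m)%N.
have Cx0 : 0 <= Cx by rewrite sumr_ge0// => ? _; exact: cmod_ge0.
pose u' : 'rV[R]_n := \row_i ((1 + Cx) * M i).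
apply: le_lt_trans (symbol_cvg u' Xx); apply: le_esum => al /= al0.
rewrite lee_fin !cmodM ler_wpM2l ?cmod_ge0// mi_partial_V//.
apply: (@le_trans _ _ (\prod_(i < n) M i ^+ al i * Cx)).
  rewrite /V coefM; apply: le_trans (cmod_sum _ _ _) _; rewrite /Cx mulr_sumr.
  apply: ler_sum => m _; rewrite cmodM ler_wpM2r ?cmod_ge0//.
  by apply: bd_prod; exact: leq_trans (leq_ord m) jk.
have -> : cmod (mi_pow (fun i => 'i%C * (u' 0 i)%:C) al) = \prod_(i < n) (1 + Cx) ^+ al i * \prod_(i < n) M i ^+ al i.
  rewrite /mi_pow -big_split /=; elim/big_rec2: _ => [|i y z _ IH]; first by rewrite cmod1.
  rewrite cmodM IH cmodX cmodM cmod_i mul1r cmodR mxE ger0_norm ?exprMn//.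
  by rewrite mulr_ge0// addr_ge0.
rewrite mulrC ler_wpM2r//.
  by apply: prodr_ge0 => i _; rewrite exprn_ge0.
have -> : \prod_(i < n) (1 + Cx) ^+ al i = (1 + Cx) ^+ mi_deg al by rewrite prodrXr.
apply: (@le_trans _ _ (1 + Cx)); first by rewrite lerDr.
by rewrite ler_eXnr// lerDl.
Qed.

(** Partial sums of the symbol with the polynomials [p i] in place of the frequencies; formally $AQ$
    is their limit times $Q$. *)
Let BN N x : {poly R[i]} := \sum_(al : {ffun 'I_n -> 'I_N}
        | (0 < mi_deg [ffun j => nat_of_ord (al j)])%N)
   (affine_coef c d [ffun j => nat_of_ord (al j)] x)%:C *:
     \prod_(i < n) p i ^+ ([ffun j => nat_of_ord (al j)] : multi_index n) i.

Let box_q j x N : (j <= k)%N -> X x ->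
  box_sum (fun al => (affine_coef c d al x)%:C * mi_partial al (q j) x) N = V j (BN N x) x.
Proof.
move=> jk Xx; rewrite /box_sum /V /BN mulr_suml coef_sum; apply: eq_bigr => al _.
by rewrite mi_partial_V// -scalerAl coefZ.
Qed.

Let tau m x : R[i] := eta%:C * (m.+1%:R * rh m.+1 x - m%:R * rh m x).

(** Both [tau] and the limits of the coefficients of [BN] express [A (q m)] as a convolution with
    [q]. With lower indices settled by induction, the top term is isolated by dividing by [q 0],
    which is [fexp u] and nowhere zero. *)
Let BN_cvg m x : (m <= k)%N -> X x ->
  (fun N => (BN N x)`_m : cplx R) @ \oo --> (tau m x : cplx R).
Proof.
elim/ltn_ind: m => m IH mk Xx.
have f0 := fexp_neq0 x.
have S1 (b : nat -> R[i]) : (fexp u x)^-1 *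
    (\sum_(l < m.+1) b l * q (m - l)%N x - \sum_(l < m) q (m - l)%N x * b l) = b m.
  rewrite big_ord_recr /= subnn q0E.
  have -> : \sum_(l < m) b l * q (m - l)%N x = \sum_(l < m) q (m - l)%N x * b l.
    by apply: eq_bigr => l _; rewrite mulrC.
  by rewrite addrAC subrr add0r mulrC mulfK.
have AqE : A (q m) x = \sum_(l < m.+1) tau l x * q (m - l)%N x.
  rewrite (A_q m Xx) q_tau mulr_sumr; apply: eq_bigr => l _.
  by rewrite /tau mulrA.
have VN : box_sum (fun al => (affine_coef c d al x)%:C * mi_partial al (q m) x) =
    (fun N => \sum_(l < m.+1) (BN N x)`_l * q (m - l)%N x).
  by apply/funext => N; rewrite (box_q N mk Xx) VE.
have H := A_acts (q_dom m) (smooth_q mk) (fun y Xy => q_summable mk Xy) Xx.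
rewrite VN AqE in H.
have H2 : (fun N => \sum_(l < m) q (m - l)%N x * (BN N x)`_l : cplx R) @ \oo -->
    (\sum_(l < m) q (m - l)%N x * tau l x : cplx R).
  apply: (ccvg_sum (F := fun (l : 'I_m) N => q (m - l)%N x * (BN N x)`_l)) => l.
  apply: (ccvgZ (u := fun N => (BN N x)`_l)); apply: IH => //.
  exact: leq_trans (ltnW (ltn_ord l)) mk.
have H3 := ccvgZ (c := (fexp u x)^-1) (ccvgB H H2).
rewrite (S1 (fun l => tau l x)) in H3.
have E : (fun N => (fexp u x)^-1 * (\sum_(l < m.+1) (BN N x)`_l * q (m - l)%N x -
     \sum_(l < m) q (m - l)%N x * (BN N x)`_l)) = fun N => (BN N x)`_m.
  by apply/funext => N; rewrite (S1 (fun l => (BN N x)`_l)).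
by rewrite -E; exact H3.
Qed.

(** The coefficients of [BN N] are affine because [x] enters only through [affine_coef]. So is their
    limit [tau k], from which [rho] at [k.+1] is recovered using [rho] at [k]. *)
Lemma affine_step : affineC (rh k) X -> affineC (rh k.+1) X.
Proof.
move=> hk.
have aB N : affineC (fun x => (BN N x)`_k) X.
  have E x : (BN N x)`_k = \sum_(al : {ffun 'I_n -> 'I_N} | (0 < mi_deg [ffun j => nat_of_ord (al j)])%N)
     (affine_coef c d [ffun j => nat_of_ord (al j)] x)%:C *
     (\prod_(i < n) p i ^+ ([ffun j => nat_of_ord (al j)] : multi_index n) i)`_k.
    by rewrite /BN coef_sum; apply: eq_bigr => al _; rewrite coefZ.
  apply: (affineC_ext (fun x _ => esym (E x))).
  have term (b : multi_index n) (s : R[i]) : affineC (fun x => (affine_coef c d b x)%:C * s) X.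
    exists ((c b)%:C * s), (\row_j ((d b 0 j)%:C * s)) => x _.
    rewrite /affine_coef /dotv rmorphD mulrDl rmorph_sum mulr_suml; congr (_ + _).
    by apply: eq_bigr => j _; rewrite mxE rmorphM mulrA.
  by apply: affineC_sum => al; exact: term.
have aT : affineC (tau k) X by apply: (affineC_lim X_open aB) => x Xx; exact: BN_cvg.
have e0 : eta%:C != 0 :> R[i] by rewrite -cmod_gt0 cmodR gtr0_norm.
have k0 : (k.+1%:R : R[i]) != 0 by rewrite pnatr_eq0.
apply: (affineC_ext _ (affineC_lin ((eta%:C * k.+1%:R)^-1) aT (affineC_lin (k%:R / k.+1%:R - 1) hk hk))).
move=> x Xx; rewrite /tau.
by move: (rh k.+1 x) (rh k x) (eta%:C : R[i]) e0 (k.+1%:R : R[i]) k0 => a b E E0 K K0; field; rewrite ?E0 ?K0.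
Qed.

End Step.

Lemma rho_affine k : affineC (rho A eta u k) X.
Proof.
elim/ltn_ind: k => -[|k] IH.
  exists 0, (\row_j ('i%C * (u 0 j)%:C)) => x _.
  rewrite rho0 /dotv rmorph_sum mulr_sumr add0r; apply: eq_bigr => j _.
  by apply: cplxP; rewrite mxE /=; ring.
(* The guard [j <= k] sits inside the existential so that [choice] applies to all [j]; beyond [k]
   the values are dummies. *)
have ex (j : nat) : exists ab : R[i] * 'rV[R[i]]_n, (j <= k)%N -> forall x, X x ->
    rh j x = ab.1 + \sum_(i < n) (x 0 i)%:C * ab.2 0 i.
  have [jk|jk] := leqP j k; last by exists (0, 0).
  by have [a [b h]] := IH j jk; exists (a, b).
have [f hf] := choice ex.
exact: (@affine_step k (fun j => (f j).1) (fun j => (f j).2) (fun j x jk Xx => hf j jk x Xx) (IH k (ltnSn k))).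
Qed.

End Affine.

(** * The local solution given by analytic vectors *)

Section CompactConvergence.
Variables (R : realType) (n : nat) (X : set 'rV[R]_n).

Lemma cvg_compacta_real (f_ : nat -> 'rV[R]_n -> R) (f : 'rV[R]_n -> R) (K : set 'rV[R]_n) (e : R) :
  cvg_compacta X f_ f -> compact K -> K `<=` X -> 0 < e ->
  exists N0, forall N, (N0 <= N)%N -> forall x, K x -> `|f x - f_ N x| < e.
Proof.
move=> h cK KX e0.
have FF : Filter (f_ @ \oo) by exact: fmap_filter.
have hK := (fam_cvgP _ _ FF).1 h K (conj cK KX).
have nb : nbhs (f : {uniform` K -> R}) [set g | forall x, K x -> `|f x - g x| < e].
  apply/uniform_nbhs; exists [set xy | ball xy.1 e xy.2]; split => //.
  by rewrite -entourage_ballE; exists e.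
by have [N0 _ hN] := hK _ nb; exists N0 => N NN; exact: hN.
Qed.

Lemma cvg_compacta_cplx (f_ : nat -> 'rV[R]_n -> R[i]) (f : 'rV[R]_n -> R[i]) :
  (forall K e, compact K -> K `<=` X -> 0 < e ->
    exists N0, forall N, (N0 <= N)%N -> forall x, K x -> cmod (f x - f_ N x) < e) ->
  @cvg_compacta R n (cplx R) X f_ f.
Proof.
move=> h; apply/fam_cvgP => K [cK KX] P /uniform_nbhs[E [entE subP]].
move: entE; rewrite -entourage_ballE => -[e /= e0 he].
have /andP[/eqP ie re] : (complex.Im e == 0) && (0 < complex.Re e) by move: e0; rewrite ltcE.
have [N0 hN] := h K (complex.Re e) cK KX re.
exists N0 => // N /= NN; apply: subP => x Kx; apply: he => /=.
rewrite /ball /= normC_cmod (lt_le_trans (y := (complex.Re e)%:C))//.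
  by rewrite ltcR; exact: hN.
by rewrite lecE /= ie eqxx lexx.
Qed.

(** Weierstrass test with majorants depending on the point, of which only uniformly small tails are
    required. *)
Lemma unif_series (t : nat -> 'rV[R]_n -> R[i]) (v : nat -> 'rV[R]_n -> R) (w : 'rV[R]_n -> R[i])
    (K : set 'rV[R]_n) (e : R) (N0 : nat) :
  (forall k x, K x -> cmod (t k x) <= v k x) ->
  (forall N M, (N0 <= N)%N -> (N <= M)%N -> forall x, K x -> \sum_(N <= k < M) v k x <= e) ->
  (forall x, K x -> series (fun k => t k x : cplx R) @ \oo --> (w x : cplx R)) ->
  forall N, (N0 <= N)%N -> forall x, K x -> cmod (w x - \sum_(k < N) t k x) <= e.
Proof.
move=> tv hv hw N NN x Kx; apply/ler_addgt0Pl => d d0.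
have /cvgC_cmod/(_ d d0)[M0 _ hM] := hw x Kx.
pose M := maxn M0 N.
have := hM M (leq_maxl _ _); rewrite /series /= => h1.
apply: le_trans (cmod_dist _ (\sum_(0 <= k < M) t k x) _) _.
apply: lerD; first exact: ltW.
rewrite (big_cat_nat (leq0n N) (leq_maxr M0 N)) /= big_mkord addrAC subrr add0r.
apply: le_trans (cmod_sum _ _ _) _; apply: le_trans (hv N M NN (leq_maxr _ _) x Kx).
by apply: ler_sum => k _; exact: tv.
Qed.

End CompactConvergence.

Section LocalSolution.
Variables (R : realType) (n : nat) (X : set 'rV[R]_n) (A : closed_operator X) (f : 'rV[R]_n -> R[i]).
Hypothesis domA : forall m, clo_dom A (iter m A f).
Variable r : R.
Hypothesis r0 : 0 < r.
Hypothesis ana : forall s : R, 0 <= s < r -> exists S : 'rV[R]_n -> R,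
  cvg_compacta X (fun N x => \sum_(k < N) s ^+ k / k`!%:R * cmod (iter k A f x)) S.

Definition tcoef (x : 'rV[R]_n) (k : nat) : R[i] := iter k A f x / k`!%:R.

Let term (s : R) k (x : 'rV[R]_n) : R := s ^+ k / k`!%:R * cmod (iter k A f x).

Let term_ge0 s k x : 0 <= s -> 0 <= term s k x.
Proof. by move=> s0; rewrite mulr_ge0 ?cmod_ge0// divr_ge0 ?exprn_ge0. Qed.

Let tail (s : R) (K : set 'rV[R]_n) (e : R) : 0 <= s < r -> compact K -> K `<=` X -> 0 < e ->
  exists N0, forall N M, (N0 <= N)%N -> (N <= M)%N -> forall x, K x -> \sum_(N <= k < M) term s k x <= e.
Proof.
move=> sr cK KX e0; have [S hS] := ana sr.
have e2 : 0 < e / 2 by rewrite divr_gt0.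
have [N0 hN] := cvg_compacta_real hS cK KX e2; exists N0 => N M NN NM x Kx.
have h1 := hN N NN x Kx; have h2 := hN M (leq_trans NN NM) x Kx.
move: h2; rewrite -(big_mkord xpredT (fun k => term s k x)) (big_cat_nat (leq0n N) NM) /=.
rewrite big_mkord => h2; move: h1 h2; rewrite !ltr_norml.
set T := \sum_(k < N) _; rewrite -/T; move: (\sum_(N <= k < M) _) => T2.
by move=> /andP[h1 h2] /andP[h3 h4]; rewrite /T /term in h1 h2 h3 h4 *; lra.
Qed.

Lemma tcoef_bdd x : X x -> bdd (tcoef x) r.
Proof.
move=> Xx s /andP[s0 sr].
have s0' := ltW s0.
have sr' : 0 <= s < r by rewrite s0'.
have X1 : [set x] `<=` X by move=> y ->.
have [N0 hN] := tail sr' (@compact_set1 _ x) X1 ltr01.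
exists (\sum_(0 <= k < N0) term s k x + 1) => k.
have tE : cmod (tcoef x k) * s ^+ k = term s k x.
  by rewrite /tcoef /term cmodM cmodV cmod_nat; ring.
rewrite tE; have [kN|kN] := ltnP k N0.
  have -> : \sum_(0 <= i < N0) term s i x =
      \sum_(0 <= i < k) term s i x + (term s k x + \sum_(k.+1 <= i < N0) term s i x).
    by rewrite (big_cat_nat (leq0n k) (ltnW kN)) /=; congr (_ + _); exact: big_ltn.
  have t1 : 0 <= \sum_(0 <= i < k) term s i x by rewrite sumr_ge0// => i _; exact: term_ge0.
  have t2 : 0 <= \sum_(k.+1 <= i < N0) term s i x by rewrite sumr_ge0// => i _; exact: term_ge0.
  lra.
have := hN k k.+1 kN (leqnSn k) x erefl; rewrite big_nat1 => h.
have t1 : 0 <= \sum_(0 <= i < N0) term s i x by rewrite sumr_ge0// => i _; exact: term_ge0.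
lra.
Qed.

Let W (s : R) (x : 'rV[R]_n) : R[i] := psum (tcoef x) s%:C.

Let W_dom s : 0 <= s < r -> clo_dom A (W s) /\ forall x, X x -> A (W s) x = psum (dcoef (tcoef x)) s%:C.
Proof.
move=> /andP[s0 sr].
pose e k : R[i] := s%:C ^+ k / k`!%:R.
(* That factor is absorbed by [nat_geo] in passing from [s1] to [s2]; [s1] is positive even for
   [s = 0]. *)
pose s1 := (s + r) / 2; pose s2 := (s1 + r) / 2.
have s10 : 0 < s1 by rewrite /s1; lra.
have ss1 : s <= s1 by rewrite /s1; lra.
have s12 : s1 < s2 by rewrite /s2 /s1; lra.
have s2r : 0 <= s2 < r by rewrite /s2 /s1; apply/andP; split; lra.
have s20 : 0 <= s2 by case/andP: s2r.
have cs : cmod s%:C < r by rewrite cmodR ger0_norm.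
have fact0 k : (k`!%:R : R[i]) != 0 by rewrite pnatr_eq0 -lt0n fact_gt0.
have factR k : 0 < k`!%:R :> R by rewrite ltr0n fact_gt0.
have H N := clo_sum N e domA.
apply: (clo_closed (f_ := fun N x => \sum_(m < N) e m * iter m A f x)).
- by move=> N; have [] := H N.
- apply: cvg_compacta_cplx => K ep cK KX ep0.
  have [N0 hN] := tail s2r cK KX (divr_gt0 ep0 (ltr0n _ 2)).
  exists N0 => N NN x Kx; apply: (@le_lt_trans _ _ (ep / 2)).
    apply: (@unif_series R n (fun k x => e k * iter k A f x) (term s2) (W s) K (ep / 2) N0 _ hN _ N NN x Kx) => [k y Ky|y Ky].
      rewrite /e /term !cmodM cmodX cmodV cmod_nat cmodR ger0_norm//.
      rewrite ler_wpM2r ?cmod_ge0// ler_pM2r ?invr_gt0// lerXn2r ?nnegrE//.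
      exact: le_trans ss1 (ltW s12).
    have := expands_cvg (psum_expands (tcoef_bdd (KX y Ky))) cs.
    have -> // : (fun k => tcoef y k * s%:C ^+ k : cplx R) = (fun k => e k * iter k A f y : cplx R).
    by apply/funext => k; rewrite /tcoef /e; ring.
  by rewrite ltr_pdivrMr// ltr_pMr// ltr1n.
apply: cvg_compacta_cplx => K ep cK KX ep0.
have s21 : 0 < s2 - s1 by rewrite subr_gt0.
have [N0 hN] := tail s2r cK KX (mulr_gt0 (divr_gt0 ep0 (ltr0n _ 2)) s21).
exists N0 => N NN x Kx; apply: (@le_lt_trans _ _ (ep / 2)).
  have [_ ->] := H N; last exact: KX.
  apply: (@unif_series R n (fun k x => e k * iter k.+1 A f x) (fun k x => term s2 k.+1 x / (s2 - s1)) (fun x => psum (dcoef (tcoef x)) s%:C) K (ep / 2) N0 _ _ _ N NN x Kx) => [k y Ky|N' M' NN' NM' y Ky|y Ky].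
  - rewrite /e /term !cmodM cmodX cmodV cmod_nat cmodR ger0_norm//.
    rewrite [leRHS]mulrAC ler_wpM2r ?cmod_ge0//.
    have ng := nat_geo k.+1 (_ : 0 < s1 < s2); rewrite s10 s12 in ng.
    have {}ng : k.+1%:R * s1 ^+ k * (s2 - s1) <= s2 ^+ k.+1.
      rewrite -(ler_pM2l s10); apply: le_trans (ng erefl).
      by rewrite le_eqVlt exprS; apply/orP; left; apply/eqP; ring.
    rewrite ler_pdivlMr// ler_pdivlMr// factS natrM.
    have -> : s ^+ k / k`!%:R * (s2 - s1) * (k.+1%:R * k`!%:R) = k.+1%:R * s ^+ k * (s2 - s1).
      by have := lt0r_neq0 (factR k); move: (k`!%:R : R) (s ^+ k) => F S F0; field; rewrite F0.
    apply: le_trans ng; rewrite ler_wpM2r ?(ltW s21)// ler_wpM2l// lerXn2r ?nnegrE ?(ltW s10)//.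
  - rewrite -mulr_suml ler_pdivrMr//.
    have := hN N'.+1 M'.+1 (leqW NN') NM' y Ky.
    by rewrite big_add1.
  have := expands_cvg (psum_expands (bdd_dcoef (tcoef_bdd (KX y Ky)))) cs.
  have -> // : (fun k => dcoef (tcoef y) k * s%:C ^+ k : cplx R) = (fun k => e k * iter k.+1 A f y : cplx R).
  apply/funext => k; rewrite /dcoef /tcoef /e factS natrM.
  have k0 : (k.+1%:R : R[i]) != 0 by rewrite pnatr_eq0.
  by have := fact0 k; move: (k`!%:R : R[i]) (k.+1%:R : R[i]) k0 (iter _ _ _ _) => F K0 H0 I F0; field; rewrite ?F0 ?H0.
by rewrite ltr_pdivrMr// ltr_pMr// ltr1n.
Qed.

Lemma local_cauchy_solution : cauchy_solution A f r%:E (fun s x => psum (tcoef x) s%:C).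
Proof.
split=> [x Xx|s s0].
  by rewrite (expands0 r0 (psum_expands (tcoef_bdd Xx))) /tcoef /= invr1 mulr1.
rewrite lte_fin => sr; have sr' : 0 <= s < r by rewrite s0.
have [h1 h2] := W_dom sr'; split=> // x Xx.
rewrite (h2 x Xx).
have cs : cmod s%:C < r by rewrite cmodR ger0_norm.
have /is_deriveC D := expands_is_derive (psum_expands (tcoef_bdd Xx)) cs.
apply/cvgC_cmod => e e0.
have [d d0 hd] := D _ (divr_gt0 e0 (ltr0n _ 2)).
(* The complex derivative controls increments of either sign, so it covers the one-sided quotient at
   [s = 0]. *)
rewrite near_withinE near_withinE.
apply: filterS (nbhsx_ballx (0 : R) d d0) => h; rewrite /ball /= sub0r normrN => hh h0 _.
have hp : 0 < `|h| by rewrite normr_gt0.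
have hC : h%:C != 0 :> R[i] by rewrite -cmod_gt0 cmodR.
have := hd h%:C; rewrite cmodR => /(_ hh) h3.
have E F G D1 : (D1 - h%:C^-1 * (F - G)) * h%:C = - (F - G - D1 * h%:C) :> R[i].
  by field.
rewrite -(ltr_pM2r hp) -[X in _ * X < _]cmodR -cmodM E cmodN rmorphD /=.
apply: le_lt_trans h3 _.
by rewrite ltr_pM2r// ltr_pdivrMr// ltr_pMr// ltr1n.
Qed.

End LocalSolution.

(** * Substituting the logarithm *)

Section LogSubstitution.
Variable R : realType.
Implicit Types (t : nat -> R[i]) (w : R[i]).

Lemma mlog1_small (r : R) : 0 < r ->
  exists2 d : R, 0 < d <= 1 & forall w, cmod w < d -> cmod (mlog1 w) < r.
Proof.
move=> r0; have c01 : cmod (0 : R[i]) < 1 by rewrite -[0]/((0 : R)%:C) cmodR normr0.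
have /is_deriveC/(_ 1 ltr01)[d d0 hd] := is_derive_mlog1 c01.
exists (Num.min d (Num.min 1 (r / 2))).
  by rewrite !lt_min d0 ltr01 divr_gt0//= !ge_min lexx orbT.
move=> w; rewrite !lt_min => /andP[wd /andP[_ wr]].
have := hd w wd; rewrite add0r mlog10 !subr0 invr1 mul1r mul1r => h.
have := cmodD (mlog1 w - w) w; rewrite subrK; lra.
Qed.

Lemma is_derive_mlog1_scale (c : R) (w : cplx R) : 0 < c -> cmod w < 1 ->
  is_derive w 1 (fun z => mlog1 z * c%:C : cplx R) ((1 - w)^-1 * c%:C).
Proof.
move=> c0 w1; apply/is_deriveC => e e0.
have ec : 0 < e / c by rewrite divr_gt0.
have /is_deriveC/(_ _ ec)[d d0 hd] := is_derive_mlog1 w1.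
exists d => // h /hd {}hd.
have -> : mlog1 (w + h) * c%:C - mlog1 w * c%:C - (1 - w)^-1 * c%:C * h =
  (mlog1 (w + h) - mlog1 w - (1 - w)^-1 * h) * c%:C.
  by rewrite !mulrBl [_ * c%:C * h]mulrAC.
rewrite cmodM cmodR gtr0_norm// -ler_pdivlMr//.
by rewrite mulrAC.
Qed.

(** Taylor coefficients of the [m]-th derivative of the exponential generating function of [t]. *)
Definition shiftc t (m k : nat) : R[i] := t (m + k)%N / k`!%:R.

Lemma dcoef_shiftc t m : dcoef (shiftc t m) = shiftc t m.+1.
Proof.
apply/funext => k; rewrite /dcoef /shiftc addnS addSn factS natrM.
have k0 : (k.+1%:R : R[i]) != 0 by rewrite pnatr_eq0.
have f0 : (k`!%:R : R[i]) != 0 by rewrite pnatr_eq0 -lt0n fact_gt0.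
by move: (t _) (k.+1%:R : R[i]) (k`!%:R : R[i]) k0 f0 => a b F b0 F0; field; rewrite b0 F0.
Qed.

Lemma bdd_shiftc t m (r : R) : bdd (shiftc t 0) r -> bdd (shiftc t m) r.
Proof. by move=> h; elim: m => // m IH; rewrite -dcoef_shiftc; exact: bdd_dcoef. Qed.

(** If [Q m] is the [m]-th derivative of the generating function after substitution, then
    [(1 - w) * Q m' = eta^-1 * Q (m+1)]. Comparing coefficients gives the recursion of [rcoef]; it
    links [m] to [m.+1], so all [m] are treated together. *)
Lemma rising_coef t (eta r : R) : 0 < eta -> 0 < r -> bdd (shiftc t 0) r ->
  exists2 d : R, 0 < d & (forall w, cmod w < d -> cmod (mlog1 w * (eta^-1)%:C) < r) /\
    expands (fun k => (k`!%:R)^-1 * \sum_(l < k.+1) rcoef eta k l * t l) d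
      (fun w => psum (shiftc t 0) (mlog1 w * (eta^-1)%:C)).
Proof.
move=> eta0 r0 tb; pose c := eta^-1.
have c0 : 0 < c by rewrite invr_gt0.
have [d /andP[d0 d1] hd] := mlog1_small (mulr_gt0 r0 eta0).
have small w : cmod w < d -> cmod (mlog1 w * c%:C) < r.
  by move=> /hd h; rewrite cmodM cmodR gtr0_norm// ltr_pdivrMr.
exists d => //; split=> //.
pose Q m w := psum (shiftc t m) (mlog1 w * c%:C).
have QD m (w : cplx R) : cmod w < d ->
    is_derive w 1 (Q m : cplx R -> cplx R) (Q m.+1 w * ((1 - w)^-1 * c%:C)).
  move=> wd; have w1 := lt_le_trans wd d1.
  have D1 := expands_is_derive (psum_expands (bdd_shiftc m tb)) (small w wd).
  rewrite dcoef_shiftc in D1.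
  exact: (is_deriveC_comp (f := psum (shiftc t m)) (g := fun z => mlog1 z * c%:C) D1
    (is_derive_mlog1_scale c0 w1)).
have QE m : exists a, expands a d (Q m).
  by apply: taylor => // z zd; have [] := QD m z zd.
have [am ham] := choice QE.
have am0 m : am m 0%N = t m.
  rewrite -(expands0 d0 (ham m)) /Q mlog10 mul0r.
  by rewrite (expands0 r0 (psum_expands (bdd_shiftc m tb))) /shiftc addn0 invr1 mulr1.
have rec m k : k.+1%:R * am m k.+1 = c%:C * \sum_(j < k.+1) am m.+1 j.
  have h1 := expands_asym d0 (expands_dcoef (ham m) (QD m)).
  have h2 := asymM (expands_asym d0 (ham m.+1)) (expands_asym ltr01 (@expands_geo R)).
  have h3 := asymM (expands_asym d0 (@expands_cst R c%:C d)) h2.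
  have E : dcoef (am m) =1 conv (fun k => if k is 0%N then c%:C else 0) (conv (am m.+1) (fun=> 1)).
    by apply: (asym_uniq ltr01 h1 h3) => x _; exact: etrans (mulrA _ _ _) (mulrC _ _).
  have := E k; rewrite {1}/dcoef => ->; rewrite /conv big_ord_recl /= subn0.
  rewrite [X in _ + X]big1 ?addr0 => [|i _]; last by rewrite mul0r.
  by congr (_ * _); apply: eq_bigr => i _; rewrite mulr1.
have rec2 m k : k.+1%:R * am m k.+1 = k%:R * am m k + c%:C * am m.+1 k.
  case: k => [|k]; first by rewrite rec big_ord_recr big_ord0 /= add0r mul0r add0r.
  by rewrite rec big_ord_recr /= mulrDr -rec.
have key k m : k`!%:R * am m k = \sum_(l < k.+1) rcoef eta k l * t (m + l)%N.
  elim: k m => [|k IH] m.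
    by rewrite am0 big_ord_recr big_ord0 /= add0r addn0.
  rewrite (rcoef_sum eta k (fun l => t (m + l)%N)) -IH.
  have -> : \sum_(l < k.+1) rcoef eta k l * t (m + l.+1)%N = k`!%:R * am m.+1 k.
    by rewrite IH; apply: eq_bigr => l _; rewrite addSnnS.
  rewrite factS mulnC natrM -mulrA rec2 -/c.
  move: (k`!%:R : R[i]) (am m k) (am m.+1 k) (k%:R : R[i]) (c%:C) => F a b K C; ring.
have := ham 0%N; congr (expands _ _ _); apply/funext => k.
have := key k 0%N; under [X in _ = X]eq_bigr do rewrite add0n.
by move=> <-; rewrite mulKf// pnatr_eq0 -lt0n fact_gt0.
Qed.

(** Where the real part is positive, the bound on the imaginary part gives the half-strip. Elsewhere
    the real part is between -1 and 0, the modulus is at most [1 + pi / 2], and the disc takes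
    over. *)
Lemma mlog1_strip (eta Ru : R) w : 0 < eta -> (1 + pi / 2) / eta < Ru -> cmod w < 1 ->
  disc_strip Ru (mlog1 w * (eta^-1)%:C).
Proof.
move=> eta0 hR w1; have := Im_mlog1 w1; have := Re_mlog1 w1.
have ie : 0 < eta^-1 by rewrite invr_gt0.
have pi0 : 0 < pi :> R := pi_gt0 R.
case: (mlog1 w) => a b /= ha hb; have [a0|a0] := ltP 0 a.
  right; rewrite /= !mulr0 subr0 add0r; split; first exact: mulr_gt0.
  rewrite normrM (gtr0_norm ie); apply: lt_trans hR.
  by rewrite ltr_pM2r//; lra.
left; rewrite /= cmodM cmodR gtr0_norm//; apply: le_lt_trans hR.
rewrite ler_pM2r//; apply: le_trans (cmod_le _) _ => /=.
by rewrite ler0_norm//; lra.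
Qed.

(* Both [dcoef rho] and the coefficients of the logarithmic derivative [Q' / Q]
   satisfy the recursion coming from [Q' = (Q' / Q) * Q]. *)
Lemma exp_series Q (q rho : nat -> R[i]) :
  (forall w, cmod w < 1 -> derivable (Q : cplx R -> cplx R) w 1) ->
  (forall w, cmod w < 1 -> Q w != 0) -> expands q 1 Q -> q 0%N = cexp (rho 0%N) ->
  (forall k, k%:R * q k = \sum_(j < k.+1) j%:R * rho j * q (k - j)%N) ->
  bdd rho 1 /\ forall w, cmod w < 1 -> Q w = cexp (psum rho w).
Proof.
move=> dQ Q0 hq q0 hrho.
pose g w := psum (dcoef q) w / Q w.
have hq' := psum_expands (bdd_dcoef (expands_bdd hq)).
have [b hb] : exists b, expands b 1 g.
  apply: (taylor ltr01) => z z1.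
  have d1 := expands_derivable hq' z1.
  have d2 : derivable (fun y : cplx R => (Q y : cplx R)^-1) z 1.
    exact: (@derivableV _ _ (Q : cplx R -> cplx R) z 1 (Q0 z z1) (dQ z z1)).
  have d3 := derivableM d1 d2.
  exact: d3.
have h := asymM (expands_asym ltr01 hb) (expands_asym ltr01 hq).
have E : dcoef q =1 conv b q.
  apply: (asym_uniq ltr01 (expands_asym ltr01 hq') h) => x /andP[x0 x1].
  by rewrite /g divfK// Q0// cmodR gtr0_norm.
have q00 : q 0%N != 0 by rewrite q0 cexp_neq0.
have bE k : b k = dcoef rho k.
  elim/ltn_ind: k => k IH.
  have H : \sum_(i < k.+1) dcoef rho i * q (k - i)%N = \sum_(j < k.+1) b j * q (k - j)%N.
    rewrite -[RHS]/(conv b q k) -E /dcoef hrho [RHS]big_ord_recl /= !mul0r add0r.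
    by apply: eq_bigr => i _; rewrite /bump leq0n add1n subSS.
  rewrite !big_ord_recr /= subnn in H.
  have HS : \sum_(i < k) dcoef rho i * q (k - i)%N = \sum_(i < k) b i * q (k - i)%N.
    by apply: eq_bigr => i _; rewrite IH.
  by move: H; rewrite HS => /addrI/(mulIf q00).
have hr : bdd rho 1.
  move=> s s01; have /andP[s0 s1] := s01.
  have [C hC] := expands_bdd hb s01; exists (cmod (rho 0%N) + C).
  have C0 : 0 <= C by apply: le_trans (hC 0%N); rewrite expr0 mulr1 cmod_ge0.
  case=> [|k]; first by rewrite expr0 mulr1; lra.
  have h1 : cmod (rho k.+1) <= cmod (b k).
    by rewrite bE /dcoef cmodM cmod_nat ler_peMl ?cmod_ge0// ler1n.
  have h2 : cmod (rho k.+1) * s ^+ k.+1 <= cmod (b k) * s ^+ k.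
    apply: ler_pM => //; rewrite ?cmod_ge0 ?exprn_ge0 ?(ltW s0)//.
    by rewrite exprS ler_piMl ?exprn_ge0 ?(ltW s0) ?(ltW s1).
  have := hC k; have := cmod_ge0 (rho 0%N); lra.
split=> // w w1.
have gE z : cmod z < 1 -> psum (dcoef rho) z = g z.
  by move=> z1; rewrite -(expands_psum hb z1); congr psum; apply/funext => k; rewrite bE.
(* Since $Q'/Q$ is the derivative of the exponent, this product has derivative 0. *)
have H : (fun z => Q z * cexp (- psum rho z)) w = (fun z => Q z * cexp (- psum rho z)) 0.
  apply: (@holo_const _ (fun z => Q z * cexp (- psum rho z)) 1 w w1) => z z1.
  have d1 := expands_is_derive hq z1.
  have d2 := expands_is_derive (psum_expands hr) z1.
  have d3 := is_deriveC_comp (f := cexp (R := R)) (g := fun z => - psum rho z)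
    (is_derive_cexp (- psum rho z)) (is_deriveN d2).
  have d4 := is_deriveM d1 d3.
  have e0 : Q z *: (cexp (- psum rho z) * - psum (dcoef rho) z : cplx R)
     + cexp (- psum rho z) *: (psum (dcoef q) z : cplx R) = 0.
    rewrite -[_ *: _]/(_ * _) -[cexp _ *: _]/(_ * _) gE// /g.
    by have := Q0 z z1; move: (Q z) (psum _ z) (cexp _) => a b' c a0; field.
  by rewrite -e0; exact: d4.
move: H => /=; rewrite (expands0 ltr01 hq) (expands0 ltr01 (psum_expands hr)) q0 !cexpN.
rewrite mulfV ?cexp_neq0// => H.
by apply: (mulIf (invr_neq0 (cexp_neq0 (psum rho w)))); rewrite H mulfV// cexp_neq0.
Qed.

End LogSubstitution.

(** * From the extension of [p] to the exponential series on the unit disc *)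

Theorem theorem5p3 (R : realType) (n : nat) (X : set 'rV[R]_n)
  (X_open : open X) (X_connected : connected X)
  (c : multi_index n -> R) (d : multi_index n -> 'rV[R]_n)
  (A : closed_operator X)
  (A_acts : acts_as A (affine_coef c d))
  (symbol_cvg : forall u x : 'rV[R]_n, X x ->
     abs_summable (fun al : multi_index n => (affine_coef c d al x)%:C *
                       mi_pow (fun j => 'i * (u 0 j)%:C) al))
  (A_cauchy : forall u, cauchy_uniquely_solvable A (fexp u))
  (A_analytic : analytic_vectors A (@fexp R n))
  (p : R -> 'rV[R]_n -> 'rV[R]_n -> R[i])
  (p_sol : forall u, cauchy_solution A (fexp u) +oo%E (fun s x => p s x u))
  (u : 'rV[R]_n) (Ru : R) (Ru_gt0 : 0 < Ru)
  (p_ext : forall x, X x -> exists P : R[i] -> R[i],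
     [/\ holomorphic_on (disc_strip Ru) P,
         (forall s : R, 0 <= s -> P s%:C = p s x u) &
         (forall z, disc_strip Ru z -> P z != 0)]) :
  exists2 eta : R, 0 < eta &
  exists (r0 : nat -> R[i]) (r1 : nat -> 'rV[R[i]]_n),
    (forall k x, X x ->
       rho A eta u k x = r0 k + \sum_(j < n) (x 0 j)%:C * r1 k 0 j) /\
    (forall (s : R) x, 0 <= s -> X x ->
       exists2 L : R[i],
         series (fun k => (r0 k + \sum_(j < n) (x 0 j)%:C * r1 k 0 j) *
                          ((1 - expR (- (eta * s))) ^+ k)%:C : cplx R) @ \oo
           --> (L : cplx R) &
         p s x u = cexp L).

Proof.
have [dom ana0] := A_analytic.
have domA m : clo_dom A (iter m A (fexp u)) := dom u m.
have [r r_gt0 ana] := ana0 u.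
have pi0 : 0 < pi :> R := pi_gt0 R.
pose eta := (1 + pi) / Ru.
have eta0 : 0 < eta by rewrite divr_gt0// addr_gt0.
have etaR : (1 + pi / 2) / eta < Ru.
  rewrite ltr_pdivrMr// /eta [ltRHS]mulrC divfK ?gt_eqF//; lra.
exists eta => //.
have aff k : exists ab : R[i] * 'rV[R[i]]_n, forall x, X x ->
    rho A eta u k x = ab.1 + \sum_(j < n) (x 0 j)%:C * ab.2 0 j.
  by have [a [b h]] := rho_affine X_open A_acts symbol_cvg eta0 domA k; exists (a, b).
have [ab hab] := choice aff.
exists (fun k => (ab k).1), (fun k => (ab k).2); split=> // s x s0 Xx.
have [P [holP Pp P0]] := p_ext x Xx.
pose t k := iter k A (fexp u) x.
(* The local series and [P] both restrict to the solution on a real segment at 0, by uniqueness on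
   [[0, r)]. The coefficients thus agree, and the local series inherits the radius [Ru] even when
   [r] is smaller. *)
have expP : expands (shiftc t 0) Ru P.
  have [e he] : exists e, expands e Ru P by apply: taylor => // z zR; apply: holP; left.
  have tb : bdd (shiftc t 0) r := tcoef_bdd ana Xx.
  rewrite (_ : shiftc t 0 = e)//; apply/funext.
  apply: (asym_uniq r_gt0 (expands_asym r_gt0 (psum_expands tb)) (expands_asym Ru_gt0 he)).
  move=> y /andP[y0 yr]; rewrite Pp; last exact: ltW.
  have [_ uniq] := A_cauchy u.
  have loc := local_cauchy_solution domA r_gt0 ana.
  have glob : cauchy_solution A (fexp u) r%:E (fun s x => p s x u).
    have [i1 i2] := p_sol u; split=> // s' s'0 _; apply: i2 => //; exact: ltry.
  have yr' : (y%:E < r%:E)%E by rewrite lte_fin.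
  exact: (uniq _ _ _ loc glob y x (ltW y0) yr' Xx).
pose Q w := P (mlog1 w * (eta^-1)%:C).
have strip w : cmod w < 1 -> disc_strip Ru (mlog1 w * (eta^-1)%:C).
  by move=> w1; exact: mlog1_strip.
have ie : 0 < eta^-1 by rewrite invr_gt0.
have dQ w : cmod w < 1 -> derivable (Q : cplx R -> cplx R) w 1.
  move=> w1; have D1 := derivableP (holP _ (strip w w1)).
  by have [] := is_deriveC_comp (f := P) (g := fun z => mlog1 z * (eta^-1)%:C) D1
    (is_derive_mlog1_scale ie w1).
have Q0 w : cmod w < 1 -> Q w != 0 by move=> w1; apply: P0; exact: strip.
have [aq haq] := taylor ltr01 dQ.
have [dl dl0 [small hd]] := rising_coef eta0 Ru_gt0 (expands_bdd expP).
(* [aq] expands [Q] on the whole unit disc, [rising_coef] only on a disc of radius [dl]; a common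
   real segment identifies the coefficients. *)
have aqE k : aq k = qfun A eta u k x.
  rewrite /qfun (rising_op_sum eta k domA Xx).
  apply: (asym_uniq dl0 (expands_asym ltr01 haq) (expands_asym dl0 hd)).
  move=> y /andP[y0 yd]; rewrite /Q; symmetry; apply: (expands_psum expP).
  by apply: small; rewrite cmodR gtr0_norm.
have q0 : aq 0%N = cexp (rho A eta u 0 x) by rewrite aqE /qfun /= invr1 mul1r.
have hrho k : k%:R * aq k = \sum_(j < k.+1) j%:R * rho A eta u j x * aq (k - j)%N.
  rewrite aqE; have := q_rho A u eta k x => /= ->.
  by apply: eq_bigr => j _; rewrite aqE.
have [rb hQ] := exp_series (rho := fun k => rho A eta u k x) dQ Q0 haq q0 hrho.
pose w : R[i] := (1 - expR (- (eta * s)))%:C.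
have es0 : 0 <= eta * s by rewrite mulr_ge0// ltW.
have w1 : cmod w < 1.
  have h1 : expR (- (eta * s)) <= 1 by rewrite -expR0 ler_expR oppr_le0.
  have h2 := expR_gt0 (- (eta * s)).
  by rewrite /w cmodR ger0_norm; lra.
exists (psum (fun k => rho A eta u k x) w).
  have := expands_cvg (psum_expands rb) w1.
  rewrite (_ : (fun k => rho A eta u k x * w ^+ k : cplx R) = (fun k =>
    ((ab k).1 + \sum_(j < n) (x 0 j)%:C * (ab k).2 0 j) *
    ((1 - expR (- (eta * s))) ^+ k)%:C : cplx R)); first exact.
  by apply/funext => k; rewrite hab// /w -rmorphXn.
(* At this [w] the substitution returns the real time [eta * s / eta = s]. *)
rewrite -Pp// -(hQ w w1) /Q mlog1_real//; congr P.
by rewrite -rmorphM /= mulrAC mulfV ?gt_eqF// mul1r.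
Qed.
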